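(* There is a constant $d>0$ such that the following holds. Let $p$ be a prime, $n\geq 2$ an integer, $c>\frac{\sqrt{3/2}}{\pi}$ a real number, and let $\lambda=(a_1^{b_1},\ldots,a_h^{b_h})\in\Omega_p(n)$. Assume that for some $1\leq i\leq h$ there exists an integer $s\geq 0$ with $p^s\leq b_i$ and $a_ip^s\geq c\sqrt{n}\log(n)$. Then for every $\mu\in K_p(\lambda)$, \[\frac{|\{\alpha\in P(n):\chi^\alpha_\mu\equiv 0 \pmod p\}|}{p(n)}\geq 1-\frac{c^4d\log(n)}{n^{c\pi/\sqrt{6}-1/2}}.\]
   Context: $P(n)$ denotes the set of partitions of $n$ and $p(n)=|P(n)|$. $\Omega_p(n)$ is the set of partitions of $n$ all of whose parts are not divisible by $p$. The notation $\lambda=(a_1^{b_1},\ldots,a_h^{b_h})$ means $\lambda$ has exactly $h$ distinct part sizes $a_1,\ldots,a_h$, with $a_j$ occurring $b_j\geq 1$ times. For a partition $\mu=(\mu_1,\mu_2,\ldots)$ of $n$, $\mu^*\in\Omega_p(n)$ is the partition obtained by replacing each part $\mu_i=p^{k_i}a_i$ with $p\nmid a_i$ by $p^{k_i}$ parts equal to $a_i$. For $\lambda\in\Omega_p(n)$, $K_p(\lambda)=\{\mu\in P(n):\mu^*=\lambda\}$. For $\alpha,\beta\in P(n)$, $\chi^\alpha$ is the irreducible character of the symmetric group $S_n$ indexed by $\alpha$ and $\chi^\alpha_\beta$ is its value on the conjugacy class of cycle type $\beta$. $\log$ is the natural logarithm. *)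

(* Defs.v *)
From HB Require Import structures.
From mathcomp Require Import all_boot all_order all_fingroup all_algebra.
From mathcomp Require Import all_solvable all_field all_character.

Set Implicit Arguments.
Unset Strict Implicit.
Unset Printing Implicit Defensive.

Import GRing.Theory.

Definition is_partition (n : nat) (s : seq nat) : bool :=
  [&& sorted geq s, 0 \notin s & sumn s == n].

(* P(n).  Partitions of n have at most n parts, each at most n; encoding them
   as bounded sequences makes P(n) a finType, so that p(n) is #|{: intpart n}|. *)
Definition intpart (n : nat) : predArgType :=
  {s : n.-bseq 'I_n.+1 | is_partition n (map val s)}.

Definition parts (n : nat) (la : intpart n) : seq nat := map val (val la).

Definition Omega (p n : nat) : {set intpart n} :=
  [set la | all (fun a => ~~ (p %| a)) (parts la)].

(* For m > 0, m`_p is the largest power of p dividing m, and m`_(p^') = m %/ m`_p. *)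
Definition pstar (p : nat) (mu : seq nat) : seq nat :=
  sort geq (flatten [seq nseq m`_p%N m`_(p^')%N | m <- mu]).

Definition K (p n : nat) (la : intpart n) : {set intpart n} :=
  [set mu | pstar p (parts mu) == parts la].

Definition cycle_type (n : nat) (s : 'S_n) : seq nat :=
  sort geq [seq #|pred_of_set A| | A : {set 'I_n} <- enum (porbits s)].

(* The Young tableau of shape al in which 0, ..., n-1 are written along the
   successive rows: k stands in row (reshape_index al k) and in column
   (reshape_offset al k). *)
Definition row_stab (n : nat) (al : intpart n) : {set 'S_n} :=
  [set s : 'S_n |
    [forall k, reshape_index (parts al) (s k) == reshape_index (parts al) k]].

Definition col_stab (n : nat) (al : intpart n) : {set 'S_n} :=
  [set s : 'S_n |
    [forall k, reshape_offset (parts al) (s k) == reshape_offset (parts al) k]].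

Section SpechtModule.

Variable n : nat.
Local Notation Sn := [set: 'S_n]%G.
Local Notation aG := (regular_repr algC Sn).
Local Open Scope ring_scope.

(* The Young symmetrizer, as an element of the group algebra of 'S_n acting on
   the right regular module. *)
Definition young_symmetrizer (al : intpart n) : 'rV[algC]_#|Sn| :=
  gring_row (\sum_(r in row_stab al) \sum_(c in col_stab al)
               (-1) ^+ odd_perm c *: aG (r * c)%g).

(* The right ideal generated by the Young symmetrizer, that is, the Specht
   module of shape al. *)
Definition specht_repr (al : intpart n) :=
  submod_repr (cyclic_mx_module aG (young_symmetrizer al)).

Definition chi (al : intpart n) : 'CF(Sn) := cfRepr (specht_repr al).

(* Some permutation of cycle type be always exists, and chi al takes the same
   value at all of them; the default 1 is never used. *)
Definition chi_val (al be : intpart n) : algC :=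
  chi al (odflt 1%g [pick s : 'S_n | cycle_type s == parts be]).

End SpechtModule.

(* Main.v *)
(* For t = a p^s, the multiplicity of a in lambda provides a permutation whose
   character values are congruent modulo p to those at an element of cycle type mu
   and which has a cycle of length t: in Frobenius's formula, permuting cyclically
   p^s cycles of equal length does not change the sum modulo p.  By the
   Murnaghan-Nakayama rule, which here is a cancellation in the same formula, the
   value is 0 modulo p as soon as alpha is a t-core.

   A partition of n that is not a t-core arises from a partition of n - t by
   adding a rim hook of length t, which can be done in O(t) ways when n < t^2.
   The theorem thus reduces to p(n - t) / p(n) = O(exp (- pi t / sqrt (6 n))).
   This follows from p(n) being of order exp (pi sqrt (2n/3)) / n, proved by
   comparing p with explicit super- and subsolutions of the recurrence
   n p(n) = sum_m sigma(m) p(n - m).  Evaluating the latter only requires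
   sum_m sigma(m) exp (- s m) = pi^2 / (6 s^2) - 1 / (2 s) + O(1) as s tends to 0,
   and the first derivatives of this expansion, which finite differences provide. *)

Require Import Defs.
From mathcomp Require Import all_boot all_order all_fingroup all_algebra.
From mathcomp Require Import all_solvable all_field all_character.
From mathcomp Require Import zify ring lra.
From mathcomp Require boolp classical_sets functions interval_inference topology.
From mathcomp Require normedtype derive realfun sequences.
From mathcomp Require Import reals exp trigo.

Set Implicit Arguments.
Unset Strict Implicit.
Unset Printing Implicit Defensive.

Import GRing.Theory Num.Theory.

(** * Young symmetrizers *)

(** A congruence needs an integral formula, whereas the ideal generated by the Young symmetrizer
    only gives [kappa^-1 * sum_x e(x g^-1 x^-1)], with [e] the coefficients of the symmetrizer.
    Frobenius's class function [Theta] is therefore identified with [chi] by scalar products: the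
    two norms and the mixed product all agree, so the squares of the differences sum to 0. The norm
    of [chi] rests on [e t e] being a multiple of [e] for every [t]; the norm of [Theta] is a signed
    count of integer matrices, of which an involution and dominance leave a single diagonal one. For
    the ratio of partition numbers, [p(n)] is needed up to a constant factor. The errors in the
    recurrence must then be bounded, not merely of lower order than the main term, which is why the
    expansion goes down to O(1) and why moments up to the fourth occur. The exponent in the theorem
    is what [t exp (- pi t / sqrt (6 n))] yields at [t = c sqrt n log n]: the factor [sqrt n]
    accounts for the [1/2]. The lower bound on [c] says that this exponent is positive. *)

Section RightIdealCharacter.

Variable gT : finGroupType.
Local Notation G := [set: gT]%G.
Local Notation aG := (regular_repr algC G).
Local Notation gi := (gring_index G).
Variable e : gT -> algC.
Variable kappa : algC.
Local Open Scope ring_scope.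
Hypothesis e_idem :
  forall y, \sum_x e x * e (x^-1 * y)%g = kappa * e y.

(** Left multiplication by the group algebra element with coefficients [e], in the basis of group
    elements. It commutes with the right regular representation, and its row space is the right
    ideal generated by that element. *)
Definition left_mulmx : 'M[algC]_#|G| :=
  \matrix_(i, j) e (enum_val j * (enum_val i)^-1)%g.
Local Notation L := left_mulmx.

Lemma big_gring_index (F : gT -> algC) :
  \sum_(i < #|G|) F (enum_val i) = \sum_x F x.
Proof.
rewrite [RHS](reindex (fun i : 'I_#|G| => enum_val i)) //.
by exists gi => i _; rewrite ?gring_valK ?gring_indexK ?inE.
Qed.

Lemma left_mulmx_regl (g : gT) i j :
  (aG g *m L) i j = e (enum_val j * g^-1 * (enum_val i)^-1)%g.
Proof.
rewrite !mxE (bigD1 (gi (enum_val i * g)%g)) //= !mxE.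
rewrite !eqxx mul1r gring_indexK ?inE // big1 ?addr0 => [|k /negPf nk].
  by rewrite invMg mulgA.
by rewrite !mxE nk andbF mul0r.
Qed.

Lemma left_mulmx_regr (g : gT) i j :
  (L *m aG g) i j = e (enum_val j * g^-1 * (enum_val i)^-1)%g.
Proof.
rewrite !mxE (bigD1 (gi (enum_val j * g^-1)%g)) //= !mxE.
rewrite gring_indexK ?inE // mulgKV gring_valK !eqxx mulr1 big1 ?addr0 //.
move=> k nk; rewrite !mxE /=.
have [ej|_] := eqVneq j (gi (enum_val k * g)%g); last by rewrite mulr0.
by move: nk; rewrite ej gring_indexK ?inE // mulgK gring_valK eqxx.
Qed.

Lemma left_mulmx_comm (g : gT) : L *m aG g = aG g *m L.
Proof.
by apply/matrixP=> i j; rewrite left_mulmx_regl left_mulmx_regr.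
Qed.

Lemma left_mulmx_idem : L *m L = kappa *: L.
Proof.
apply/matrixP=> i j; rewrite !mxE -e_idem.
under eq_bigr do rewrite !mxE.
rewrite (big_gring_index (fun x => e (x * (enum_val i)^-1)%g *
   e (enum_val j * x^-1)%g)).
rewrite (reindex (fun x : gT => (x^-1 * enum_val j)%g)) /=.
  by apply: eq_bigr => x _; rewrite mulrC invMg invgK mulKVg mulgA.
exists (fun x : gT => (enum_val j * x^-1)%g) => x _;
  by rewrite ?invMg ?invgK ?mulKVg ?mulgKV ?mulgK.
Qed.

Lemma gring_row_left_mulmx :
  gring_row (\sum_y e y *: aG y) = row (gi 1%g) L.
Proof.
apply/rowP=> j; rewrite /gring_row linear_sum !mxE summxE.
rewrite (bigD1 (enum_val j)) //= !mxE gring_indexK ?inE // mul1g gring_valK.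
rewrite !eqxx mulr1 big1 ?addr0 ?invg1 ?mulg1 // => y ny.
rewrite !mxE gring_indexK ?inE // mul1g /=.
have [ej|_] := eqVneq j (gi y); last by rewrite mulr0.
by move: ny; rewrite ej gring_indexK ?inE ?eqxx.
Qed.

(** If [kappa = 0] then [L] squares to 0: it factors through its row space as [Q *m B] with
    [B *m Q = 0], so its trace is 0. But all its diagonal entries are [e 1]. *)
Lemma quasi_idem_neq0 : e 1%g != 0 -> kappa != 0.
Proof.
apply: contraNneq => k0; have := left_mulmx_idem; rewrite k0 scale0r => LL.
set Q := in_submod L L; set B := val_submod (U := L) 1%:M.
have QB : Q *m B = L by rewrite -val_submodE in_submodK.
have /submxP[W BW] : (B <= L)%MS by rewrite val_submod1.
have BQ : B *m Q = 0.
  apply: (val_submod_inj (U := L)).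
  by rewrite val_submodE -mulmxA QB {1}BW -mulmxA LL mulmx0 linear0.
have trL : \tr L = #|G|%:R * e 1%g.
  rewrite mulr_natl -[in RHS](card_ord #|G|) -sumr_const.
  by apply: eq_bigr => i _; rewrite mxE mulgV.
have : \tr L = 0 by rewrite -QB mxtrace_mulC BQ linear0.
by rewrite trL => /eqP; rewrite mulf_eq0 pnatr_eq0 eqn0Ngt cardG_gt0.
Qed.

Local Notation v := (gring_row (\sum_y e y *: aG y)).

Lemma cyclic_left_mulmx : (cyclic_mx aG v :=: L)%MS.
Proof.
apply/eqmxP/andP; split.
  apply: cyclic_mx_sub; last by rewrite gring_row_left_mulmx row_sub.
  apply/mxmoduleP=> x _; rewrite left_mulmx_comm submxMl //.
apply/row_subP=> i; have -> : row i L = v *m aG (enum_val i).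
  rewrite gring_row_left_mulmx -row_mul left_mulmx_comm; apply/rowP=> j.
  rewrite [in LHS]mxE [in RHS]mxE left_mulmx_regl mxE.
  by rewrite gring_indexK ?inE // invg1 mulg1.
by apply: mxmodule_trans; rewrite ?cyclic_mx_module ?inE ?cyclic_mx_id.
Qed.

Hypothesis kappa_neq0 : kappa != 0.

(** [L] acts on its own row space as the scalar [kappa], so [kappa] times the trace of [g] on the
    ideal is the trace of [L *m aG g] on the whole regular module. *)
Lemma cfRepr_cyclic_mx (g : gT) :
  cfRepr (submod_repr (cyclic_mx_module aG v)) g =
    kappa^-1 * \sum_x e (x * g^-1 * x^-1)%g.
Proof.
rewrite cfunE inE mulr1n.
set U := cyclic_mx aG v; set S := submod_repr _ g.
have LU : (L <= U)%MS by rewrite cyclic_left_mulmx.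
have LQ : val_submod (in_submod U L) = L by rewrite in_submodK.
set Q := in_submod U L in LQ; set B := val_submod (U := U) 1%:M.
have /submxP[W BW] : (B <= L)%MS by rewrite -cyclic_left_mulmx val_submod1.
have BQ : B *m Q = kappa%:M.
  apply: (val_submod_inj (U := U)).
  rewrite val_submodE -mulmxA -val_submodE LQ {1}BW -mulmxA left_mulmx_idem.
  by rewrite -scalemxAr -BW -scalemx1 linearZ.
have SB : S *m B = B *m aG g.
  rewrite -val_submodE /S /= /submod_mx in_submodK //.
  by rewrite mxmodule_trans ?cyclic_mx_module ?inE ?val_submodP.
apply: (mulfI kappa_neq0); rewrite mulVKf //.
rewrite -(big_gring_index (fun x => e (x * g^-1 * x^-1)%g)).
have -> : kappa * \tr S = \tr (S *m (B *m Q)).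
  by rewrite BQ mul_mx_scalar linearZ.
rewrite mulmxA SB mxtrace_mulC mulmxA -val_submodE LQ.
by apply: eq_bigr => i _; rewrite left_mulmx_regr.
Qed.

End RightIdealCharacter.

(** * Counting through the fibres of a map *)

Section FiberCount.

Variable T : finType.
Implicit Types (A : {set T}) (f g : T -> nat).

Lemma leq_card_bounded A f m :
  {in A &, injective f} -> {in A, forall x, f x < m} -> #|A| <= m.
Proof.
move=> injf ltf; rewrite cardE -(size_map f) -(size_iota 0 m).
apply: uniq_leq_size; last first.
  by move=> c /mapP[x]; rewrite mem_enum => Ax ->; rewrite mem_iota ltf.
rewrite map_inj_in_uniq ?enum_uniq // => x y.
by rewrite !mem_enum; apply: injf.
Qed.

Lemma leq_card_onto A f m :
  (forall c, c < m -> exists2 x, x \in A & f x = c) -> m <= #|A|.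
Proof.
move=> ontof; rewrite cardE -(size_map f) -(size_iota 0 m).
apply: uniq_leq_size; first exact: iota_uniq.
move=> c; rewrite mem_iota => /ontof[x Ax <-].
by rewrite map_f ?mem_enum.
Qed.

Lemma sum_card_fiber A g m :
  {in A, forall x, g x < m} ->
  \sum_(c < m) #|[set x in A | g x == c]| = #|A|.
Proof.
move=> ltg; rewrite -sum1_card.
transitivity (\sum_(c < m) \sum_(x in [set x in A | g x == c]) 1).
  by apply: eq_bigr => c _; rewrite sum1_card.
rewrite (exchange_big_dep (mem A)) /= => [|c x _]; last by rewrite inE => /andP[].
apply: eq_bigr => x Ax; rewrite (bigD1 (Ordinal (ltg x Ax))) /= ?inE ?Ax ?eqxx //.
rewrite big1 // => c; rewrite inE Ax /= => /andP[/eqP eg /eqP[]].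
by apply: val_inj => /=.
Qed.

End FiberCount.

(** * Tableaux of shape [a], given by the row and the column of each entry *)

Section Tableau.

Variables (n : nat) (a : nat -> nat) (row col : 'I_n -> nat).
Hypothesis a_mono : forall i j, i <= j -> a j <= a i.
Hypothesis a_supp : forall i, n <= i -> a i = 0.
Hypothesis col_lt : forall k, col k < a (row k).
Hypothesis cell_onto : forall i c, c < a i -> exists k, row k = i /\ col k = c.
Hypothesis cell_inj : forall k l, row k = row l -> col k = col l -> k = l.

Lemma row_lt k : row k < n.
Proof.
by rewrite ltnNge; apply/negP=> /a_supp a0; move: (col_lt k); rewrite a0.
Qed.

Lemma card_row_col i c : #|[set k | (row k == i) && (col k < c)]| = minn c (a i).
Proof.
apply/eqP; rewrite eqn_leq; apply/andP; split.
  apply: (leq_card_bounded (f := col)) => [k l|k]; rewrite !inE.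
    by case/andP=> /eqP ri _ /andP[/eqP rl _]; apply: cell_inj; rewrite ri rl.
  by case/andP=> /eqP <- ck; rewrite leq_min ck col_lt.
apply: (leq_card_onto (f := col)) => d; rewrite leq_min => /andP[dc da].
have [k [rk ck]] := cell_onto da.
by exists k; rewrite // inE rk ck eqxx dc.
Qed.

Lemma card_row i : #|[set k | row k == i]| = a i.
Proof.
rewrite -[RHS](minnn (a i)) -card_row_col; apply: eq_card => k; rewrite !inE.
by case: eqP => //= <-; rewrite col_lt.
Qed.

(** In each fibre of [f] over [i], at most [minn c (a i)] entries have [q < c]. Summed over [i],
    these bounds give exactly the number of entries with [col < c], so each is attained; for
    [c = a (f k0)] the whole fibre of [k0] lies below [c]. *)
Lemma fiber_in_diagram (f q : 'I_n -> nat) :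
    (forall i, #|[set k | f k == i]| = a i) ->
    (forall c, #|[set k | q k < c]| = #|[set k | col k < c]|) ->
    (forall k l, f k = f l -> q k = q l -> k = l) ->
  forall k, q k < a (f k).
Proof.
move=> cf cq inj k0; set c := a (f k0).
have ltf k : f k < n.
  rewrite ltnNge; apply/negP=> /a_supp; rewrite -cf => /eqP.
  by rewrite cards_eq0 => /eqP/setP/(_ k); rewrite !inE eqxx.
have le_i i : #|[set k in [set k | q k < c] | f k == i]| <= minn c (a i).
  rewrite leq_min; apply/andP; split.
    apply: (leq_card_bounded (f := q)) => [k l|k]; rewrite !inE.
      by case/andP=> _ /eqP fi /andP[_ /eqP fl]; apply: inj; rewrite fi fl.
    by case/andP.
  by rewrite -cf subset_leq_card //; apply/subsetP=> k; rewrite !inE => /andP[].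
have eq_sum : \sum_(i < n) #|[set k in [set k | q k < c] | f k == i]|
            = \sum_(i < n) minn c (a i).
  rewrite sum_card_fiber // cq -(sum_card_fiber (g := row) (m := n)).
    apply: eq_bigr => i _; rewrite -card_row_col; apply: eq_card => k.
    by rewrite !inE andbC.
  by move=> k _; apply: row_lt.
have eq0 : #|[set k in [set k | q k < c] | f k == f k0]| = c.
  apply/eqP; rewrite eqn_leq; apply/andP; split.
    by have := le_i (f k0); rewrite minnn.
  rewrite leqNgt; apply/negP=> lt0.
  suff: \sum_(i < n) #|[set k in [set k | q k < c] | f k == i]|
            < \sum_(i < n) minn c (a i) by rewrite eq_sum ltnn.
  rewrite (bigD1 (Ordinal (ltf k0))) //= [ltnRHS](bigD1 (Ordinal (ltf k0))) //=.
  rewrite -addSn leq_add ?minnn //.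
  by apply: leq_sum => i _; apply: le_i.
have /subset_leqif_cards[_ /esym] :
    [set k in [set k | q k < c] | f k == f k0] \subset [set k | f k == f k0].
  by apply/subsetP=> k; rewrite !inE => /andP[].
rewrite eq0 cf eqxx => /eqP/setP/(_ k0).
by rewrite !inE eqxx andbT.
Qed.

(** Column by column: the entries of one column have distinct values of [f], so at most [j] of them
    are below [j], and [row] attains the minimum of [j] and the column length. *)
Lemma dominance (f : 'I_n -> nat) :
    (forall k l, f k = f l -> col k = col l -> k = l) ->
  forall j, #|[set k | f k < j]| <= #|[set k | row k < j]|.
Proof.
move=> inj j; set m := (\max_k col k).+1.
have ltm k : col k < m by rewrite ltnS leq_bigmax.
rewrite -(sum_card_fiber (g := col) (m := m)) //.
rewrite -[leqRHS](sum_card_fiber (g := col) (m := m)) //.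
apply: leq_sum => c _.
have [/forallP ltc|] := boolP [forall i : 'I_j, c < a i].
  apply: (@leq_trans j).
    apply: (leq_card_bounded (f := f)) => [k l|k]; rewrite !inE; last by case/andP.
    by case/andP=> _ /eqP ck /andP[_ /eqP cl]; move/inj; apply; rewrite ck cl.
  apply: (leq_card_onto (f := row)) => i ij.
  have [k [rk ck]] := cell_onto (ltc (Ordinal ij)).
  by exists k; rewrite // !inE rk ck ij eqxx.
rewrite negb_forall => /existsP[i]; rewrite -leqNgt => aic.
apply: subset_leq_card; apply/subsetP=> k; rewrite !inE => /andP[_ ck].
rewrite ck andbT ltnNge; apply/negP=> jk.
have := col_lt k; rewrite (eqP ck) ltnNge (leq_trans _ aic) // a_mono //.
by rewrite ltnW // (leq_trans _ jk).
Qed.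

End Tableau.

(** * The Young symmetrizer is a quasi-idempotent *)

Section YoungSymmetrizer.

Variables (n : nat) (a : nat -> nat) (row col : 'I_n -> nat).
Hypothesis a_mono : forall i j, i <= j -> a j <= a i.
Hypothesis a_supp : forall i, n <= i -> a i = 0.
Hypothesis col_lt : forall k, col k < a (row k).
Hypothesis cell_onto : forall i c, c < a i -> exists k, row k = i /\ col k = c.
Hypothesis cell_inj : forall k l, row k = row l -> col k = col l -> k = l.

Lemma cell_perm (f q : 'I_n -> nat) :
    (forall k, q k < a (f k)) ->
    (forall k l, f k = f l -> q k = q l -> k = l) ->
  exists s : 'S_n, forall k, row (s k) = f k /\ col (s k) = q k.
Proof.
move=> lt inj.
pose s0 k := odflt k [pick l | (row l == f k) && (col l == q k)].
have s0P k : row (s0 k) = f k /\ col (s0 k) = q k.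
  rewrite /s0; case: pickP => [l /andP[/eqP -> /eqP ->] //|no].
  by have [l [rl cl]] := cell_onto (lt k); have := no l; rewrite rl cl !eqxx.
have s0_inj : injective s0.
  move=> k l eq_s; have [fk qk] := s0P k; have [fl ql] := s0P l.
  by apply: inj; rewrite -?fk -?qk eq_s.
by exists (perm s0_inj) => k; rewrite permE.
Qed.

Local Open Scope group_scope.

Definition rowS : {set 'S_n} := [set s : 'S_n | [forall k, row (s k) == row k]].
Definition colS : {set 'S_n} := [set s : 'S_n | [forall k, col (s k) == col k]].

Lemma rowSP (s : 'S_n) : reflect (forall k, row (s k) = row k) (s \in rowS).
Proof. by rewrite inE; apply: (iffP forallP) => h k; apply/eqP/h. Qed.

Lemma colSP (s : 'S_n) : reflect (forall k, col (s k) = col k) (s \in colS).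
Proof. by rewrite inE; apply: (iffP forallP) => h k; apply/eqP/h. Qed.

Lemma R_group : group_set rowS.
Proof.
apply/group_setP; split=> [|s t /rowSP sR /rowSP tR]; apply/rowSP=> k.
  by rewrite perm1.
by rewrite permM tR.
Qed.
Canonical R_gr := Group R_group.

Lemma C_group : group_set colS.
Proof.
apply/group_setP; split=> [|s t /colSP sC /colSP tC]; apply/colSP=> k.
  by rewrite perm1.
by rewrite permM tC.
Qed.
Canonical C_gr := Group C_group.

Lemma RC1 s : s \in rowS -> s \in colS -> s = 1.
Proof.
by move=> /rowSP sR /colSP sC; apply/permP=> k; rewrite perm1; apply: cell_inj.
Qed.

(** By [fiber_in_diagram], the columns to which [y] sends a row all fit in that row. Moving each
    entry [k] inside its row to the column of [y k] defines [r], and what remains of [y] preserves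
    columns. *)
Lemma mem_RC (y : 'S_n) :
    (forall i j, row i = row j -> col (y i) = col (y j) -> i = j) ->
  exists r c, [/\ r \in rowS, c \in colS & y = r * c].
Proof.
move=> inj.
have lt k : col (y k) < a (row k).
  apply: (@fiber_in_diagram n a row col _ _ _ _ row (fun k => col (y k))) => //.
    by move=> i; apply: (@card_row n a row col).
  move=> c; rewrite -(card_imset _ (@perm_inj _ y)).
  apply: eq_card => l; rewrite -[l](permKV y) mem_imset ?inE //.
  exact: perm_inj.
have [r rP] := cell_perm lt inj.
exists r, (r^-1 * y); split; last by rewrite mulKVg.
  by apply/rowSP=> k; have [] := rP k.
apply/colSP=> k; rewrite permM; have [_ <-] := rP (r^-1 k).
by rewrite permKV.
Qed.

Local Open Scope ring_scope.

Definition ysym (y : 'S_n) : algC :=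
  \sum_(r in rowS) \sum_(c in colS) (-1) ^+ odd_perm c * ((r * c)%g == y)%:R.
Local Notation e := ysym.

Lemma ysymM r c y : r \in rowS -> c \in colS ->
  e (r * y * c)%g = (-1) ^+ odd_perm c * e y.
Proof.
move=> rR cC; rewrite /e (reindex_inj (mulgI r)) /= mulr_sumr.
apply: eq_big => [r'|r' _]; first by rewrite groupMl.
rewrite (reindex_inj (mulIg c)) /= mulr_sumr.
apply: eq_big => [c'|c' _]; first by rewrite groupMr.
rewrite odd_permM signr_addb mulrA [_ ^+ c * _ ^+ c']mulrC; congr (_ * _%:R).
by rewrite !mulgA (inj_eq (mulIg c)) -!mulgA (inj_eq (mulgI r)).
Qed.

Lemma ysym1 : e 1%g = 1.
Proof.
rewrite /e (bigD1 1%g) ?group1 //= (bigD1 1%g) ?group1 //=.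
rewrite mulg1 eqxx odd_perm1 mulr1 big1 ?big1 ?addr0 // => [r|c].
  case/andP=> rR nr; rewrite big1 // => c cC; case: eqP => [rc|]; last by rewrite mulr0.
  by case/eqP: nr; apply: RC1 => //; rewrite -[r]invgK (mulg1_eq rc) groupV in cC *.
by case/andP=> _ /negPf nc; rewrite mul1g nc mulr0.
Qed.

Lemma ysymRC r c : r \in rowS -> c \in colS -> e (r * c)%g = (-1) ^+ odd_perm c.
Proof. by move=> rR cC; rewrite -[r]mulg1 ysymM // ysym1 mulr1. Qed.

(* Outside rowS * colS some two entries of a row lie in one column of the permuted
   tableau; their transposition makes both functions vanish there. *)
Lemma ysym_uniq (u : 'S_n -> algC) :
    (forall r c y, r \in rowS -> c \in colS ->
       u (r * y * c)%g = (-1) ^+ odd_perm c * u y) ->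
  forall y, u y = u 1%g * e y.
Proof.
move=> uM y.
have [/forallP inj|] := boolP [forall i, [forall j,
    (row i == row j) && (col (y i) == col (y j)) ==> (i == j)]].
  have [|r [c [rR cC ->]]] := mem_RC (y := y).
    move=> i j ri ci; apply/eqP; have /forallP/(_ j)/implyP := inj i.
    by apply; rewrite ri ci !eqxx.
  by rewrite ysymRC // -[r]mulg1 uM // mulrC.
rewrite negb_forall => /existsP[i]; rewrite negb_forall => /existsP[j].
rewrite negb_imply => /andP[/andP[/eqP rij /eqP cij] nij].
have tR : tperm i j \in rowS.
  by apply/rowSP=> k; case: tpermP => [->|->|].
have tC : tperm (y i) (y j) \in colS.
  by apply/colSP=> k; case: tpermP => [->|->|].
have ty : (tperm i j * y * tperm (y i) (y j) = y)%g.
  by rewrite -tpermJ conjgE !mulgA mulgK tperm2 mul1g.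
have key (w : 'S_n -> algC) : (forall r c y, r \in rowS -> c \in colS ->
    w (r * y * c)%g = (-1) ^+ odd_perm c * w y) -> w y = 0.
  move=> /(_ _ _ y tR tC); rewrite ty odd_tperm (inj_eq perm_inj) nij expr1.
  by move/eqP; rewrite mulN1r -addr_eq0 -mulr2n mulrn_eq0 => /eqP.
by rewrite !key ?mulr0 // => *; apply: ysymM.
Qed.

Definition ykappa : algC := \sum_x e x * e (x^-1)%g.
Local Notation kappa := ykappa.

(** The left side is the coefficient at [y] of [e t e] in the group algebra. It has the same
    symmetry under [rowS] and [colS] as [e], hence is a multiple of [e]. *)
Lemma ysym_sandwich t y :
  \sum_x e x * e (t^-1 * x^-1 * y)%g = (\sum_x e x * e (t^-1 * x^-1)%g) * e y.
Proof.
rewrite (@ysym_uniq (fun y => \sum_x e x * e (t^-1 * x^-1 * y)%g)).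
  by congr (_ * _); apply: eq_bigr => x _; rewrite mulg1.
move=> r c z rR cC; rewrite (reindex_inj (mulgI r)) mulr_sumr /=.
apply: eq_bigr => x _; rewrite -[(r * x)%g]mulg1 ysymM ?group1 // odd_perm1 mul1r.
rewrite mulg1 mulrCA; congr (_ * _); rewrite invMg.
rewrite -(@ysymM 1%g) ?group1 // mul1g; congr (e _).
by rewrite !mulgA mulgKV.
Qed.

Lemma ysym_idem y : \sum_x e x * e (x^-1 * y)%g = kappa * e y.
Proof.
have := ysym_sandwich 1 y; rewrite invg1.
by under eq_bigr do rewrite mul1g; under [in RHS]eq_bigr do rewrite mul1g.
Qed.

End YoungSymmetrizer.

Definition stable n (s : 'S_n) (f : {ffun 'I_n -> 'I_n}) : bool :=
  [forall k, f (s k) == f k].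

Lemma stableP n (s : 'S_n) (f : {ffun 'I_n -> 'I_n}) :
  reflect (forall k, f (s k) = f k) (stable s f).
Proof. by apply: (iffP forallP) => h k; apply/eqP/h. Qed.

Definition content n (f : {ffun 'I_n -> 'I_n}) (i : 'I_n) : nat :=
  #|[set k | f k == i]|.

(** * Scalar products of the Specht character with permutation characters *)

Section ConjugationSum.

Variables (n : nat) (e : 'S_n -> algC).
Local Open Scope ring_scope.
Local Open Scope group_scope.

Definition conj_sum (g : 'S_n) : algC := (\sum_x e (x * g^-1 * x^-1)%g)%R.

(** The cardinal is the permutation character of the colourings satisfying [Q]. Each conjugation
    inside [conj_sum] is undone by moving the colouring along, since [Q] is invariant. *)
Lemma conj_sum_stable (Q : pred {ffun 'I_n -> 'I_n}) :
    (forall (f : {ffun 'I_n -> 'I_n}) (x : 'S_n), Q [ffun k => f (x k)] = Q f) ->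
  (\sum_g conj_sum g * #|[set f | Q f & stable g f]|%:R
     = n`!%:R * \sum_(f | Q f) \sum_(g | stable g f) e g)%R.
Proof.
move=> Qx; have -> : n`! = #|'S_n| by rewrite card_Sn.
rewrite mulr_natl -sumr_const /=.
transitivity (\sum_g \sum_(x : 'S_n) \sum_(f | Q f && stable g f)
     e (x * g^-1 * x^-1)%g)%R.
  apply: eq_bigr => g _; rewrite mulr_suml; apply: eq_bigr => x _.
  by rewrite mulr_natr -sumr_const; apply: eq_bigl => f; rewrite inE.
rewrite exchange_big /=; apply: eq_bigr => x _.
transitivity (\sum_g \sum_(f | Q f && stable g f) e g)%R; last first.
  rewrite (exchange_big_dep Q) /= => [|g f _ /andP[]//].
  by apply: eq_bigr => f Qf; apply: eq_bigl => g; rewrite Qf.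
rewrite (reindex_inj (inj_comp (mulgI x^-1) (inj_comp (mulIg x) invg_inj))) /=.
apply: eq_bigr => g _; rewrite !mulgA.
have -> : x * (x^-1 * g^-1 * x)^-1 * x^-1 = g.
  by rewrite !invMg !invgK !mulgA mulgK mulgV mul1g.
pose F (y : 'S_n) (f : {ffun 'I_n -> 'I_n}) := [ffun k => f (y k)].
have F_inj y : injective (F y).
  move=> f1 f2 /ffunP eqF; apply/ffunP=> k.
  by have := eqF (y^-1 k); rewrite !ffunE permKV.
rewrite (reindex_inj (F_inj x^-1)) /=; apply: eq_bigl => f.
rewrite Qx; congr (_ && _); apply/stableP/stableP=> st k.
  have := st (x (g k)); rewrite /F !ffunE !permM !permK => <- //.
rewrite /F !ffunE !permM permK -[LHS]st permKV //.
Qed.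

End ConjugationSum.

Section YoungInner.

Variables (n : nat) (a : nat -> nat) (row col : 'I_n -> nat).
Hypothesis a_mono : forall i j, i <= j -> a j <= a i.
Hypothesis a_supp : forall i, n <= i -> a i = 0.
Hypothesis col_lt : forall k, col k < a (row k).
Hypothesis cell_onto : forall i c, c < a i -> exists k, row k = i /\ col k = c.
Hypothesis cell_inj : forall k l, row k = row l -> col k = col l -> k = l.

Local Notation R := (rowS row).
Local Notation C := (colS col).
Local Notation e := (ysym row col).
Local Notation kappa := (ykappa row col).
Local Open Scope group_scope.

(** As [conj_sum] is [kappa] times the character, this says that the character has norm 1. One of
    the two conjugations is undone by reindexing; what remains has the form [e t e]. *)
Lemma conj_sum_norm :
  (\sum_g conj_sum e g * conj_sum e g^-1 = n`!%:R * kappa ^+ 2)%R.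
Proof.
have -> : n`! = #|'S_n| by rewrite card_Sn.
rewrite mulr_natl -sumr_const /=.
under eq_bigr do rewrite mulr_suml.
rewrite exchange_big /=; apply: eq_bigr => x _.
have idem := ysym_idem a_supp col_lt cell_onto cell_inj.
have sand := ysym_sandwich a_supp col_lt cell_onto cell_inj.
rewrite (reindex_inj (inj_comp (mulgI x^-1) (inj_comp (mulIg x) invg_inj))) /=.
transitivity (\sum_g e g * \sum_z e (z * g^-1 * z^-1))%R.
  apply: eq_bigr => g _; congr (e _ * _)%R.
    by rewrite !invMg !invgK !mulgA mulgK mulgV mul1g.
  rewrite /conj_sum (reindex_inj (mulIg x)); apply: eq_bigr => z _; congr e.
  by rewrite invgK invMg !mulgA !mulgK.
under eq_bigr do rewrite mulr_sumr.
rewrite exchange_big /=.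
transitivity (\sum_z \sum_x e x * (e (z * x^-1) * e z^-1))%R.
  apply: eq_bigr => z _; have := sand z^-1 z^-1; rewrite invgK => ->.
  by rewrite mulr_suml; apply: eq_bigr => y _; rewrite mulrA.
rewrite exchange_big expr2 {2}/ykappa mulr_sumr /=; apply: eq_bigr => y _.
rewrite -mulr_sumr mulrCA -idem; congr (_ * _)%R.
rewrite (reindex_inj invg_inj); apply: eq_bigr => z _.
by rewrite invgK mulrC.
Qed.

Definition fiber_inj (f : {ffun 'I_n -> 'I_n}) :=
  [forall k, [forall l, (f k == f l) && (col k == col l) ==> (k == l)]].

Lemma fiber_injP (f : {ffun 'I_n -> 'I_n}) :
  reflect (forall k l, f k = f l -> col k = col l -> k = l) (fiber_inj f).
Proof.
apply: (iffP forallP) => [h k l fkl ckl|h k].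
  by have /forallP/(_ l) := h k; rewrite fkl ckl !eqxx => /eqP.
by apply/forallP=> l; apply/implyP=> /andP[/eqP fkl /eqP ckl]; rewrite (h k l).
Qed.

(** The transposition of two entries with the same column and colour lies in [colS] and stabilizes
    [f]; multiplying by it pairs terms of opposite sign. *)
Lemma sum_stable_eq0 f : ~~ fiber_inj f -> (\sum_(g | stable g f) e g = 0)%R.
Proof.
rewrite negb_forall => /existsP[i]; rewrite negb_forall => /existsP[j].
rewrite negb_imply => /andP[/andP[/eqP fij /eqP cij] nij].
have tC : tperm i j \in C by apply/colSP=> k; case: tpermP => [->|->|].
have ft k : f (tperm i j k) = f k by case: tpermP => [->|->|].
apply/eqP; rewrite -[_ == _](@mulrn_eq0 _ _ 2) mulr2n addr_eq0; apply/eqP.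
rewrite {1}(reindex_inj (mulIg (tperm i j))) /= -sumrN.
apply: eq_big => [g|g _].
  by apply/stableP/stableP=> st k; have := st k; rewrite permM ft.
rewrite -[X in e X]mul1g mulgA ysymM ?group1 //.
by rewrite odd_tperm nij expr1 mulN1r.
Qed.

Lemma conj_sum_dominance (Q : pred {ffun 'I_n -> 'I_n}) :
    (forall (f : {ffun 'I_n -> 'I_n}) (x : 'S_n), Q [ffun k => f (x k)] = Q f) ->
    (forall f : {ffun 'I_n -> 'I_n}, Q f -> exists j,
       (#|[set k | row k < j]| < #|[set k | f k < j]|)%N) ->
  (\sum_g conj_sum e g * #|[set f | Q f & stable g f]|%:R = 0)%R.
Proof.
move=> Qx dom; rewrite conj_sum_stable // big1 ?mulr0 // => f /dom[j].
move=> ltj; apply: sum_stable_eq0; apply: contraL ltj => /fiber_injP inj.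
rewrite -leqNgt.
apply: (@dominance n a row col _ _ _ (fun k => val (f k)))=> // k l /val_inj.
exact: inj.
Qed.

Let rowO k : 'I_n := Ordinal (row_lt a_supp col_lt k).

(** Among the colourings of content [a], those injective on columns are the colouring by rows moved
    by some [c] in [colS]; the stabilizer is [c rowS c^-1], and the sum of [e] over all these
    conjugates is [ykappa]. So the character occurs exactly once in this permutation character. *)
Lemma conj_sum_diag :
  (\sum_g conj_sum e g *
     #|[set f : {ffun 'I_n -> 'I_n} | [forall i, content f i == a i]
                                    & stable g f]|%:R = n`!%:R * kappa)%R.
Proof.
rewrite conj_sum_stable => [|f x]; last first.
  apply: eq_forallb => i; congr (_ == _).
  rewrite /content -(card_imset _ (@perm_inj _ x)).
  apply: eq_card => l; rewrite -[l](permKV x) mem_imset ?inE ?ffunE //.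
  exact: perm_inj.
congr (_ * _)%R.
pose F (c : 'S_n) := [ffun k => rowO (c k)].
have F_inj : {in C &, injective F}.
  move=> c d /colSP cC /colSP dC /ffunP eqF; apply/permP=> k; apply: cell_inj.
    by have := eqF k; rewrite !ffunE => /(congr1 val).
  by rewrite cC dC.
have imF : F @: C = [set f : {ffun 'I_n -> 'I_n} |
                       [forall i, content f i == a i] & fiber_inj f].
  apply/setP=> f; rewrite inE; apply/imsetP/andP=> [[c cC ->]|].
    split; last first.
      apply/fiber_injP=> k l; rewrite !ffunE => /(congr1 val) /= rkl ckl.
      apply: (@perm_inj _ c); apply: cell_inj => //.
      by rewrite !(colSP _ _ cC).
    apply/forallP=> i; apply/eqP.
    rewrite -[RHS](card_row col_lt cell_onto cell_inj) /content.
    rewrite -(card_imset _ (@perm_inj _ c)).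
    apply: eq_card => l; rewrite -[l](permKV c) mem_imset ?inE ?ffunE //.
    exact: perm_inj.
  case=> /forallP cf /fiber_injP inj.
  have [|||s sP] := @cell_perm n a row col _ (fun k => val (f k)) col => //.
  - apply: (@fiber_in_diagram n a row col _ _ _ _ (fun k => val (f k)) col) => //.
      move=> i; have [lin|lni] := ltnP i n.
        by rewrite -(eqP (cf (Ordinal lin))); apply: eq_card => k; rewrite !inE.
      rewrite a_supp //; apply/eqP; rewrite cards_eq0; apply/eqP/setP=> k.
      by rewrite !inE; apply/negbTE; rewrite neq_ltn (leq_trans (ltn_ord _) lni).
    by move=> k l /val_inj; apply: inj.
  - by move=> k l /val_inj; apply: inj.
  exists s; first by apply/colSP=> k; have [] := sP k.
  by apply/ffunP=> k; apply: val_inj; rewrite ffunE /=; have [] := sP k.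
rewrite (bigID fiber_inj) /= [X in (_ + X)%R]big1 ?addr0; last first.
  by move=> f /andP[_ nf]; apply: sum_stable_eq0.
transitivity (\sum_(f in F @: C) \sum_(g | stable g f) e g)%R.
  by apply: eq_bigl => f; rewrite imF inE.
rewrite big_imset //=.
transitivity (\sum_(c in C) \sum_(r in R) e (c * r * c^-1)%g)%R.
  apply: eq_bigr => c cC.
  rewrite (reindex_inj (inj_comp (mulIg c^-1) (mulgI c))) /=.
  apply: eq_bigl => r; apply/stableP/rowSP=> st k.
    have := st (c^-1 k); rewrite /F !ffunE !permM !permKV => /(congr1 val) //.
  rewrite /F !ffunE !permM permKV; apply: val_inj => /=.
  by rewrite st.
rewrite exchange_big /ykappa.
transitivity (\sum_x \sum_(r in R) \sum_(c in C)
    (-1) ^+ odd_perm c * ((r * c)%g == x^-1%g)%:R * e x)%R; last first.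
  apply: eq_bigr => x _; rewrite {3}/ysym mulr_sumr; apply: eq_bigr => r _.
  by rewrite mulr_sumr; apply: eq_bigr => c _; rewrite mulrC.
rewrite [RHS]exchange_big /= [RHS](reindex_inj invg_inj).
apply: eq_big => [r|r rR]; first by rewrite groupV.
rewrite [RHS]exchange_big /= [RHS](reindex_inj invg_inj).
apply: eq_big => [c|c cC]; first by rewrite groupV.
rewrite (bigD1 (c * r)%g) //= invMg eqxx mulr1 big1 ?addr0 => [|x nx].
  by rewrite -[X in e X]mul1g mulgA ysymM ?group1 ?groupV // mul1g.
case: eqP => [eqx|_]; last by rewrite mulr0 mul0r.
by case/eqP: nx; rewrite -[x]invgK -eqx invMg !invgK.
Qed.

End YoungInner.

(** * Frobenius's character formula *)

Section OrbitCount.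

Variables (n : nat) (T : finType).
Implicit Types phi psi : {ffun 'I_n -> T}.

Definition fcount phi : {ffun T -> 'I_n.+1} :=
  [ffun t => inord #|[set k | phi k == t]|].

Lemma fcountE phi t : fcount phi t = #|[set k | phi k == t]| :> nat.
Proof. by rewrite ffunE inordK // ltnS (leq_trans (max_card _)) ?card_ord. Qed.

Lemma fcount_perm phi psi : fcount phi = fcount psi ->
  exists s : 'S_n, forall k, phi k = psi (s k).
Proof.
move=> eqc.
have /tuple_permP[s eqs] : perm_eq [tuple phi i | i < n] [tuple psi i | i < n].
  apply/allP=> t _ /=; apply/eqP.
  have cE (chi : {ffun 'I_n -> T}) : count_mem t [tuple chi i | i < n] = fcount chi t.
    rewrite fcountE -sum1_count /= big_map big_enum_cond /= -sum1_card.
    by apply: eq_bigl => i; rewrite inE.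
  by rewrite !cE eqc.
exists s => k; have := congr1 (fun u => nth (phi k) u k) eqs.
by rewrite -!tnth_nth !tnth_mktuple.
Qed.

Lemma fcount_onto (M : {ffun T -> 'I_n.+1}) :
  \sum_t M t = n :> nat -> exists phi, fcount phi = M.
Proof.
move=> sumM; pose s := flatten [seq nseq (M t) t | t <- enum T].
have sz : size s == n.
  rewrite size_flatten /shape -map_comp sumnE big_map big_enum /= -[X in _ == X]sumM.
  by apply/eqP/eq_bigr => t _; rewrite size_nseq.
exists [ffun k => tnth (Tuple sz) k]; apply/ffunP=> t; apply: val_inj => /=.
rewrite fcountE.
transitivity (count_mem t (Tuple sz)).
  rewrite -[in RHS](map_tnth_enum (Tuple sz)) -sum1_count big_map.
  rewrite big_enum_cond /= -sum1_card.
  by apply: eq_bigl => k; rewrite inE ffunE.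
rewrite /= /s count_flatten -map_comp sumnE big_map big_enum /= (bigD1 t) //=.
rewrite count_nseq /= eqxx mul1n big1 ?addn0 // => u nu.
by rewrite count_nseq /= (negPf nu).
Qed.

(** The colourings with multiplicities [M] form one orbit of the symmetric group, and the stabilizer
    orders along an orbit add up to the group order. *)
Lemma card_fcount_fiber (M : {ffun T -> 'I_n.+1}) : \sum_t M t = n :> nat ->
  \sum_(phi | fcount phi == M) #|[set s : 'S_n | [forall k, phi (s k) == phi k]]|
    = n`!.
Proof.
move=> /fcount_onto[phi0 defM].
have -> : n`! = #|'S_n| by rewrite card_Sn.
rewrite -sum1_card (partition_big (fun s : 'S_n => [ffun k => phi0 (s k)])
  (fun phi => fcount phi == M)) /=; last first.
  move=> s _; rewrite -defM; apply/eqP/ffunP=> t; apply: val_inj; rewrite /= !fcountE.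
  rewrite -[in LHS](card_imset _ (@perm_inj _ s)).
  apply: eq_card => l; rewrite -[l](permKV s) mem_imset ?inE ?ffunE //.
  exact: perm_inj.
apply: eq_bigr => phi /eqP cphi.
transitivity #|[set s : 'S_n | [ffun k => phi0 (s k)] == phi]|; last first.
  by rewrite -sum1_card; apply: eq_bigl => s; rewrite inE.
have [s0 s0P] : exists s : 'S_n, forall k, phi k = phi0 (s k).
  by apply: fcount_perm; rewrite cphi.
rewrite -[LHS](card_imset _ (@mulIg _ s0)).
apply: eq_card => s; rewrite -[s](mulgKV s0).
apply: etrans (mem_imset _ (s * s0^-1)%g (@mulIg _ s0)) _.
rewrite !inE; apply/forallP/eqP=> [st|eqs k].
  by apply/ffunP=> k; rewrite ffunE permM -s0P; apply/eqP.
by have /ffunP/(_ k) := eqs; rewrite ffunE permM -s0P => ->.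
Qed.

Lemma sum_fcount (F : {ffun T -> 'I_n.+1} -> int) :
  (\sum_phi F (fcount phi) *+ #|[set s : 'S_n | [forall k, phi (s k) == phi k]]|
     = (\sum_(M : {ffun T -> 'I_n.+1} | (\sum_t M t)%N == n) F M) *+ n`!)%R.
Proof.
rewrite (partition_big fcount (fun M : {ffun T -> 'I_n.+1} => (\sum_t M t)%N == n)) /=; last first.
  move=> phi _; apply/eqP; under eq_bigr do rewrite fcountE -sum1_card.
  rewrite (exchange_big_dep xpredT) //=.
  transitivity (\sum_(k < n) 1); last by rewrite sum1_card card_ord.
  apply: eq_bigr => k _; rewrite (bigD1 (phi k)) /= ?inE // big1 // => t.
  by rewrite inE => /andP[/eqP-> /eqP].
rewrite -sumrMnl; apply: eq_bigr => M /eqP sumM.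
rewrite -(card_fcount_fiber sumM) -sumrMnr; apply: eq_bigr => phi /eqP -> //.
Qed.

End OrbitCount.

(** * A sign-reversing involution on bead arrangements *)

Section Pieri.

Variable n : nat.
Local Notation X := ('S_n * {ffun 'I_n * 'I_n -> 'I_n.+1})%type.
Implicit Types x : X.

Definition entry_sum x : nat := \sum_t x.2 t.
Definition colsum (M : {ffun 'I_n * 'I_n -> 'I_n.+1}) (l : 'I_n) : nat :=
  \sum_i M (i, l).
Definition rowsum (M : {ffun 'I_n * 'I_n -> 'I_n.+1}) (i : 'I_n) : nat :=
  \sum_l M (i, l).

(* Bead positions after the first k columns of M have been added, column by
   column, to the arrangement of beads given by the permutation. *)
Definition gam x (k : nat) (i : 'I_n) : nat :=
  rev_ord (x.1 i) + \sum_(l < n | l < k) x.2 (i, l).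

Lemma gamS x (k : 'I_n) i : gam x k.+1 i = gam x k i + x.2 (i, k).
Proof.
rewrite /gam -addnA; congr (_ + _); rewrite (bigD1 k) //= addnC; congr (_ + _).
apply: eq_bigl => l; rewrite ltnS [l < k]ltn_neqAle andbC.
by congr (_ && _).
Qed.

Lemma gam0 x i : gam x 0 i = rev_ord (x.1 i).
Proof. by rewrite /gam big_pred0 ?addn0. Qed.

Lemma gamn x i : gam x n i = rev_ord (x.1 i) + rowsum x.2 i.
Proof. by congr (_ + _); apply: eq_bigl => l; rewrite ltn_ord. Qed.

Lemma leq_gam x k k' i : k <= k' -> gam x k i <= gam x k' i.
Proof.
move=> le_k; rewrite leq_add2l [leqRHS](bigID (fun l : 'I_n => l < k)) /=.
apply: leq_trans (leq_addr _ _); apply: eq_leq; apply: eq_bigl => l.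
by apply/idP/andP=> [lk|[]//]; split=> //; apply: leq_trans lk _.
Qed.

(** The beads are exchanged through [t] during the columns before [k], and column [k] is rewritten
    so that all positions after it are as before. Under [le_gam_t] below, the subtraction is
    exact. *)
Definition swap_at (k : 'I_n) (t : 'S_n) x : X :=
  ((t * x.1)%g, [ffun p : 'I_n * 'I_n => if p.2 < k then x.2 (t p.1, p.2)
     else if p.2 == k then inord (gam x k.+1 p.1 - gam x k (t p.1)) else x.2 p]).

Section SwapAt.

Variables (k : 'I_n) (t : 'S_n) (x : X).
Hypothesis t2 : forall i, t (t i) = i.
Hypothesis le_gam_t : forall i, gam x k (t i) <= gam x k.+1 i.
Hypothesis entry_sum_x : entry_sum x = n.
Local Notation y := (swap_at k t x).

Lemma sum_swap_col :
  \sum_i (gam x k.+1 i - gam x k (t i)) = colsum x.2 k.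
Proof.
rewrite sumnB //; have -> : \sum_i gam x k (t i) = \sum_i gam x k i.
  by rewrite [RHS](reindex_inj (@perm_inj _ t)).
under eq_bigr do rewrite gamS.
by rewrite big_split addKn.
Qed.

Lemma colsum_le (l : 'I_n) : colsum x.2 l <= n.
Proof.
rewrite -[leqRHS]entry_sum_x.
have -> : entry_sum x = \sum_i \sum_j x.2 (i, j).
  by rewrite pair_bigA; apply: eq_bigr => -[].
by apply: leq_sum => i _; rewrite (bigD1 l) //= leq_addr.
Qed.

Lemma swap_atE i : y.2 (i, k) = gam x k.+1 i - gam x k (t i) :> nat.
Proof.
rewrite ffunE /= ltnn eqxx inordK // ltnS (leq_trans _ (colsum_le k)) //.
by rewrite -sum_swap_col (bigD1 i) //= leq_addr.
Qed.

Lemma gam_swap_lo k' i : k' <= k -> gam y k' i = gam x k' (t i).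
Proof.
move=> le_k; rewrite /gam permM; congr (_ + _); apply: eq_bigr => l lk'.
by rewrite ffunE /= (leq_trans lk').
Qed.

Lemma gam_swap_hi k' i : k < k' <= n -> gam y k' i = gam x k' i.
Proof.
elim: k' => // k' IHk /andP[]; rewrite ltnS => le_k lt_k'.
have := gamS y (Ordinal lt_k') i; have := gamS x (Ordinal lt_k') i => /= -> ->.
have [eqk|nek] := eqVneq k (Ordinal lt_k').
  have ek : k' = k by rewrite eqk.
  rewrite -eqk swap_atE ek gam_swap_lo // subnKC //.
  by rewrite gamS.
have lt_k : k < k'.
  rewrite ltn_neqAle le_k andbT; apply: contraNneq nek => ek.
  by apply/eqP/val_inj.
rewrite IHk ?lt_k ?(ltnW lt_k') //; congr (_ + _).
by rewrite ffunE /= ltnNge le_k /= eq_sym (negPf nek).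
Qed.

Lemma colsum_swap l : colsum y.2 l = colsum x.2 l.
Proof.
have [->|nlk] := eqVneq l k.
  by rewrite -sum_swap_col; apply: eq_bigr => i _; rewrite swap_atE.
case: (ltnP l k) => lk; last first.
  by apply: eq_bigr => i _; rewrite ffunE /= ltnNge lk (negPf nlk).
rewrite /colsum [RHS](reindex_inj (@perm_inj _ t)).
by apply: eq_bigr => i _; rewrite ffunE /= lk.
Qed.

Lemma entry_sum_colsum z : entry_sum z = \sum_l colsum z.2 l.
Proof.
rewrite /entry_sum /colsum exchange_big /= pair_bigA /=.
by apply: eq_bigr => -[].
Qed.

Lemma entry_sum_swap : entry_sum y = n.
Proof.
by rewrite entry_sum_colsum -[RHS]entry_sum_x entry_sum_colsum; apply: eq_bigr => l _;
  rewrite colsum_swap.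
Qed.

Lemma swap_atK : swap_at k t y = x.
Proof.
rewrite [LHS]/swap_at [RHS]surjective_pairing; congr (_, _).
  by apply/permP=> i; rewrite !permM t2.
apply/ffunP=> -[i l]; rewrite ffunE /=.
have [lk|] := ltnP l k; first by rewrite ffunE /= lk t2.
have [->|nlk] := eqVneq l k => le_k.
  rewrite gam_swap_hi ?leqnn ?ltn_ord // gam_swap_lo // t2 gamS addKn.
  by apply: val_inj => /=; rewrite inordK ?ltn_ord.
by rewrite ffunE /= ltnNge le_k (negPf nlk).
Qed.

End SwapAt.

(** Distinct beads filling the positions below [n - k]: the bead picture of a partition with at most
    [k] parts, which is what adding [k] horizontal strips to the empty partition produces. *)
Definition good x k := injectiveb (gam x k) &&
  [forall d : 'I_n, (d < n - k) ==> [exists i, gam x k i == d]].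

Lemma goodP x k : reflect (injective (gam x k) /\
    forall d, d < n - k -> exists i, gam x k i = d) (good x k).
Proof.
apply: (iffP andP) => -[/injectiveP inj onto]; split=> //.
  move=> d ltd; have dn : d < n by rewrite (leq_trans ltd) ?leq_subr.
  have /forallP/(_ (Ordinal dn)) := onto; rewrite /= ltd /=.
  by case/existsP=> i /eqP ei; exists i.
apply/forallP=> d; apply/implyP=> /onto[i ei].
by apply/existsP; exists i; rewrite ei.
Qed.

Lemma eq_good x y k (t : 'S_n) : (forall i, gam y k i = gam x k (t i)) ->
  good y k = good x k.
Proof.
move=> eqg; apply/goodP/goodP=> -[inj onto]; split.
- by move=> i j eqij; have := inj (t^-1 i)%g (t^-1 j)%g;
    rewrite !eqg !permKV => /(_ eqij)/perm_inj.
- by move=> d /onto[i]; rewrite eqg; exists (t i).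
- by move=> i j; rewrite !eqg => /inj/perm_inj.
- by move=> d /onto[i]; exists (t^-1 i)%g; rewrite eqg permKV.
Qed.

Lemma good0 x : good x 0.
Proof.
apply/goodP; split=> [i j|d]; rewrite ?subn0.
  by rewrite !gam0 => /val_inj/rev_ord_inj/perm_inj.
move=> ltd; exists (x.1^-1 (rev_ord (Ordinal ltd)))%g.
by rewrite gam0 permKV rev_ordK.
Qed.

Definition first_gap x k := find (fun d => ~~ [exists i, gam x k i == d]) (iota 0 n).

(** Two beads that collide after column [k] or, without collision, the beads standing before column
    [k] at the first gap and just above it. The choice depends only on what survives the exchange,
    as an involution requires; [1] is a default value. *)
Definition swapper x (k : nat) : 'S_n :=
  if ~~ injectiveb (gam x k.+1) then
    if [pick p | (p.1 != p.2) && (gam x k.+1 p.1 == gam x k.+1 p.2)] is Some p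
    then tperm p.1 p.2 else 1%g
  else if [pick p | (gam x k p.1 == first_gap x k.+1)
                 && (gam x k p.2 == (first_gap x k.+1).+1)] is Some p
    then tperm p.1 p.2 else 1%g.

Lemma swapperP x k : k < n -> good x k -> ~~ good x k.+1 ->
  [/\ exists i j, i != j /\ swapper x k = tperm i j,
      forall i, gam x k (swapper x k i) <= gam x k.+1 i
    & forall y, (forall i, gam y k i = gam x k (swapper x k i)) ->
        gam y k.+1 =1 gam x k.+1 -> swapper y k = swapper x k].
Proof.
move=> kn /goodP[inj onto]; rewrite negb_and.
case: (boolP (injectiveb (gam x k.+1))) => [/injectiveP inj1|ninj1] /=; last first.
  have swE y : gam y k.+1 =1 gam x k.+1 -> swapper y k =
      if [pick p | (p.1 != p.2) && (gam x k.+1 p.1 == gam x k.+1 p.2)] is Some p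
      then tperm p.1 p.2 else 1%g.
    move=> eqy; rewrite /swapper.
    have -> : injectiveb (gam y k.+1) = false.
      apply/injectiveP=> inj1; case/injectiveP: ninj1 => u v.
      by rewrite -!eqy => /inj1.
    by rewrite (eq_pick (Q := fun p => (p.1 != p.2) &&
      (gam x k.+1 p.1 == gam x k.+1 p.2))) // => p; rewrite /= !eqy.
  have := swE x (frefl _); case: pickP => [[i j] /= /andP[nij /eqP eqij]|no _ _].
    move=> sw_ij; split=> [|l|y _ eqy]; first by exists i, j.
      by rewrite sw_ij; case: tpermP => [->|->|_ _]; rewrite -?eqij ?leq_gam // ?eqij
        ?leq_gam.
    by rewrite (swE y eqy) (swE x (frefl _)).
  case/injectiveP: ninj1 => i j /eqP eqij; apply/eqP/negPn/negP=> nij.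
  by have := no (i, j); rewrite /= nij eqij.
rewrite negb_forall => /existsP[d0]; rewrite negb_imply => /andP[lt_d0 no_d0].
have gapE y : gam y k.+1 =1 gam x k.+1 -> first_gap y k.+1 = first_gap x k.+1.
  move=> eqy; apply: eq_find => d; congr (~~ _).
  by apply: eq_existsb => i; rewrite eqy.
set d := first_gap x k.+1 in gapE *.
have has_gap : has (fun d => ~~ [exists i, gam x k.+1 i == d]) (iota 0 n).
  by apply/hasP; exists (val d0); rewrite // mem_iota ltn_ord.
have lt_dn : d < n by rewrite -[ltnRHS](size_iota 0) -has_find.
have le_d : d <= d0.
  rewrite leqNgt; apply/negP=> lt_d.
  have := before_find 0 lt_d; rewrite nth_iota ?ltn_ord // add0n.
  by rewrite no_d0.
have no_d i : gam x k.+1 i != d.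
  have := nth_find 0 has_gap; rewrite -/d nth_iota // add0n negb_exists.
  by move/forallP/(_ i).
(* Before column [k] both [d] and [d.+1] are thus occupied. The bead at [d] has to leave it and so
   reaches at least [d.+1], which makes the exchange possible. *)
have lt_d : d.+1 < n - k.
  apply: (@leq_ltn_trans d0.+1); first by rewrite ltnS.
  by rewrite ltn_subRL addnS -addSn -ltn_subRL.
have [i ei] := onto _ (ltnW lt_d); have [j ej] := onto _ lt_d.
have swE y : injective (gam y k) -> gam y k.+1 =1 gam x k.+1 ->
    forall i j, gam y k i = d -> gam y k j = d.+1 -> swapper y k = tperm i j.
  move=> injy eqy i' j' ei' ej'; rewrite /swapper.
  have -> : injectiveb (gam y k.+1).
    by apply/injectiveP=> u v; rewrite !eqy; apply: inj1.
  rewrite /= gapE //; case: pickP => [[u v] /= /andP[/eqP eu /eqP ev]|no].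
    by congr tperm; apply: injy; rewrite ?eu ?ev.
  by have := no (i', j'); rewrite /= ei' ej' !eqxx.
rewrite (swE x inj (frefl _) i j ei ej); split.
- by exists i, j; split=> //; apply: contra_eq_neq ei => ->; rewrite ej neq_ltn ltnSn orbT.
- have gt_d u : d <= gam x k u -> d < gam x k.+1 u.
    by move=> le; rewrite ltn_neqAle eq_sym no_d (leq_trans le) ?leq_gam.
  move=> l; case: tpermP => [->|->|_ _]; last exact: leq_gam.
    by rewrite ej gt_d ?ei.
  by rewrite ei ltnW // gt_d // ej.
move=> y eqy eqy1; rewrite tpermC; apply: (swE y) => //.
- by move=> u v; rewrite !eqy => /inj/perm_inj.
- by rewrite eqy tpermR.
by rewrite eqy tpermL.
Qed.

(** The number of columns added before [good] fails; [find] returns [n] when it never does. *)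
Definition stage x := find (fun k => ~~ good x k.+1) (iota 0 n).

Lemma good_stage x k : k <= stage x -> good x k.
Proof.
case: k => [|k] lek; first exact: good0.
have := before_find 0 lek; rewrite nth_iota ?add0n; first by move/negbFE.
by rewrite (leq_trans lek) // -[leqRHS](size_iota 0) find_size.
Qed.

Lemma stage_bad x : stage x < n -> ~~ good x (stage x).+1.
Proof.
move=> lt; have hs : has (fun k => ~~ good x k.+1) (iota 0 n).
  by rewrite has_find size_iota.
by have := nth_find 0 hs; rewrite nth_iota ?add0n.
Qed.

Lemma stageE x k : k < n -> (forall l, l <= k -> good x l) -> ~~ good x k.+1 ->
  stage x = k.
Proof.
move=> kn lo hi; apply/eqP; rewrite eqn_leq; apply/andP; split.
  rewrite leqNgt; apply/negP=> lt.
  by rewrite good_stage in hi.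
rewrite leqNgt; apply/negP=> lt.
have := stage_bad (ltn_trans lt kn).
by rewrite lo.
Qed.

Variables (a b : 'I_n -> nat).

Definition fits x := [&& entry_sum x == n, [forall l, colsum x.2 l == b l]
  & [forall i, gam x n i == a i + rev_ord i]].

(* The sign-reversing involution: at the first column producing a collision or a
   gap below n - k - 1, exchange the two beads responsible. *)
Definition bad_swap x : X :=
  if insub (stage x) is Some k then swap_at k (swapper x k) x else x.

Lemma bad_swapP x : entry_sum x = n -> stage x < n ->
  [/\ stage (bad_swap x) = stage x /\ bad_swap (bad_swap x) = x,
      entry_sum (bad_swap x) = n, forall l, colsum (bad_swap x).2 l = colsum x.2 l,
      forall i, gam (bad_swap x) n i = gam x n i
    & odd_perm (bad_swap x).1 = ~~ odd_perm x.1].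
Proof.
move=> tot ltn; pose k := Ordinal ltn.
have bsE y : stage y = stage x -> bad_swap y = swap_at k (swapper y k) y.
  by move=> eqs; rewrite /bad_swap eqs (insubT (fun m => m < n) ltn).
rewrite bsE //; set t := swapper x k; set y := swap_at k t x.
have [[i [j [nij tE]]] le_t swE] :=
  swapperP ltn (good_stage (leqnn _)) (stage_bad ltn).
have t2 u : t (t u) = u by rewrite /t tE tpermK.
have ylo k' u : k' <= k -> gam y k' u = gam x k' (t u).
  exact: gam_swap_lo.
have yhi k' u : k < k' <= n -> gam y k' u = gam x k' u.
  exact: gam_swap_hi.
have eqst : stage y = stage x.
  apply: stageE => // [l lel|].
    rewrite (@eq_good x y l t) ?good_stage // => u.
    exact: ylo.
  rewrite (@eq_good x y _ 1%g) ?stage_bad // => u.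
  by rewrite perm1 yhi ?leqnn.
have eqt : swapper y k = t.
  by apply: swE => u; [apply: ylo | apply: yhi; rewrite leqnn ltn].
split=> //.
- by split; rewrite // bsE // eqt; apply: swap_atK.
- exact: entry_sum_swap.
- by move=> l; apply: colsum_swap.
- by move=> u; apply: yhi; rewrite ltn leqnn.
by rewrite /= odd_permM /t tE odd_tperm nij.
Qed.

Lemma sum_bad : (\sum_(x | fits x && (stage x < n)%N) (-1) ^+ odd_perm x.1 = 0 :> int)%R.
Proof.
have fitsP x : fits x -> stage x < n -> fits (bad_swap x) && (stage (bad_swap x) < n).
  case/and3P=> /eqP tot /forallP cs /forallP rs lt.
  have [[-> _] totE csE rsE _] := bad_swapP tot lt.
  rewrite lt andbT; apply/and3P; split; first by rewrite totE.
    by apply/forallP=> l; rewrite csE.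
  by apply/forallP=> l; rewrite rsE.
have swK x : fits x -> stage x < n -> bad_swap (bad_swap x) = x.
  by case/and3P=> /eqP tot _ _ /(bad_swapP tot)[[]].
set S := LHS; suff : (S = - S)%R.
  by move/eqP; rewrite -addr_eq0 -mulr2n mulrn_eq0 => /eqP.
rewrite /S -sumrN [LHS](reindex_onto bad_swap bad_swap) /=; last first.
  by move=> x /andP[]; apply: swK.
apply: eq_big => [x|x /andP[/andP[fx sx] /eqP ex]].
  apply/idP/idP=> [/andP[/andP[fx sx] /eqP ex]|/andP[fx sx]].
    by rewrite -ex fitsP.
  by rewrite fitsP // swK // eqxx.
have /and3P[/eqP tot _ _] := fx; have [_ _ _ _] := bad_swapP tot sx.
by rewrite ex => ->; case: odd_perm; rewrite ?expr0 ?expr1 ?opprK.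
Qed.

End Pieri.

Lemma perm_eq_iota (T : finType) (A : {set T}) (f : T -> nat) m :
    {in A &, injective f} -> {in A, forall x, f x < m} ->
    (forall d, d < m -> exists2 x, x \in A & f x = d) ->
  perm_eq (map f (enum A)) (iota 0 m).
Proof.
move=> inj lt onto; apply: uniq_perm.
- by rewrite map_inj_in_uniq ?enum_uniq // => x y; rewrite !mem_enum; apply: inj.
- exact: iota_uniq.
move=> d; rewrite mem_iota; apply/mapP/idP => [[x]|/onto[x Ax <-]].
  by rewrite mem_enum => Ax ->; apply: lt.
by exists x; rewrite // mem_enum.
Qed.

Lemma perm_neq1_least n (w : 'S_n) : w != 1%g ->
  exists2 i : 'I_n, i < w i & forall l : 'I_n, l < i -> w l = l.
Proof.
move=> nw; have [i0 ni0] : exists i, w i != i.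
  apply/existsP; apply: contraNT nw; rewrite negb_exists => /forallP id.
  by apply/eqP/permP=> i; rewrite perm1; apply/eqP/negPn/id.
case: (@arg_minnP _ i0 (fun i => w i != i) (fun i => val i) ni0) => i ni mini.
have fixl (l : 'I_n) : l < i -> w l = l.
  by move=> lt; apply/eqP; apply: contraTT lt => /mini; rewrite -leqNgt.
exists i => //; rewrite ltnNge leq_eqVlt negb_or [_ == _]val_eqE ni /=.
apply/negP=> lt; move/eqP: ni; apply.
by apply: (@perm_inj _ w); rewrite fixl.
Qed.

(** * The surviving arrangements and the dominance order *)

Section GoodTerms.

Variables (n : nat) (a b : 'I_n -> nat).
Hypothesis a_mono : forall i j : 'I_n, i <= j -> a j <= a i.
Local Notation X := ('S_n * {ffun 'I_n * 'I_n -> 'I_n.+1})%type.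
Implicit Types x : X.

Let beta (i : 'I_n) := a i + rev_ord i.

Let beta_lt (i j : 'I_n) : i < j -> beta j < beta i.
Proof.
move=> lt; have := a_mono (ltnW lt); have := ltn_ord j.
by rewrite /beta /=; lia.
Qed.

(** [beta] is strictly decreasing, so replacing an element of [T] that is at least [#|T|] by a
    missing smaller index gains at least 1. *)
Lemma sum_beta_top (T : {set 'I_n}) :
  \sum_(i in T) beta i + #|[set i in T | #|T| <= i]|
     <= \sum_(i < n | i < #|T|) beta i.
Proof.
set j := #|T|; set U := [set i in T | j <= i].
set V := [set i in ~: T | i < j].
have cardV : #|V| = #|U|.
  have cardj : #|[set i : 'I_n | i < j]| = j.
    have jn : j <= n by rewrite -[leqRHS]card_ord max_card.
    transitivity (\sum_(i < n | i < j) 1).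
      by rewrite -sum1_card; apply: eq_bigl => i; rewrite inE.
    by rewrite (big_ord_narrow jn) sum1_card card_ord.
  have : #|U| + #|[set i in T | i < j]| = #|V| + #|[set i in T | i < j]|.
    transitivity #|T|.
      rewrite -(cardsID [set i : 'I_n | i < j] T) addnC; congr (_ + _).
        by apply: eq_card => i; rewrite !inE.
      by apply: eq_card => i; rewrite !inE -leqNgt andbC.
    rewrite -/j -[LHS]cardj -(cardsID T [set i : 'I_n | i < j]) addnC.
    by congr (_ + _); apply: eq_card => i; rewrite !inE // andbC.
  by move/addIn.
have -> : \sum_(i in T) beta i = \sum_(i in U) beta i + \sum_(i in T | i < j) beta i.
  rewrite (bigID (fun i : 'I_n => i < j)) addnC; congr (_ + _).
  by apply: eq_bigl => i; rewrite inE -leqNgt.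
have -> : \sum_(i < n | i < j) beta i
    = \sum_(i in V) beta i + \sum_(i in T | i < j) beta i.
  rewrite (bigID (mem T)) addnC; congr (_ + _); apply: eq_bigl => i;
  by rewrite ?inE andbC.
rewrite addnAC leq_add2r.
have [->|[u0 Uu0]] := set_0Vmem U; first by rewrite big_set0 cards0.
have jn : j < n by move: Uu0; rewrite inE => /andP[_ /leq_ltn_trans]; apply.
apply: (@leq_trans (#|U| * (beta (Ordinal jn)).+1)).
  rewrite mulnS addnC leq_add2l -sum_nat_const; apply: leq_sum => i.
  rewrite inE => /andP[_]; rewrite leq_eqVlt => /orP[/eqP ej|lt].
    by have -> : i = Ordinal jn by apply: val_inj.
  by apply/ltnW/beta_lt.
rewrite -cardV -sum_nat_const; apply: leq_sum => i.
by rewrite inE => /andP[_ lt]; apply: beta_lt.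
Qed.

(** The beads outside [T] fill the lowest [n - j] positions, so the sum of the positions of [T] is
    that of the [j] highest initial positions plus the first [j] column sums. It is at most the sum
    of [beta] over [T], then over the first [j] indices. The two extra terms on the left measure
    these two losses. *)
Lemma good_dominance x j : fits a b x -> j <= n -> good x j ->
  let T := [set i | n - j <= gam x j i] in
  #|T| = j /\
  \sum_(l < n | l < j) b l + (\sum_(i in T) (beta i - gam x j i)
     + #|[set i in T | j <= i]|) <= \sum_(l < n | l < j) a l.
Proof.
case/and3P=> _ /forallP cs /forallP rs jn /goodP[inj onto] T.
have permS : perm_eq (map (gam x j) (enum (~: T))) (iota 0 (n - j)).
  apply: perm_eq_iota => [i k _ _|i|d ltd]; first exact: inj.
    by rewrite !inE -ltnNge.
  by have [i ei] := onto d ltd; exists i; rewrite // !inE -ltnNge ei.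
pose W := [set i : 'I_n | j <= i].
have permW : perm_eq (map (fun i : 'I_n => val (rev_ord i)) (enum W)) (iota 0 (n - j)).
  apply: perm_eq_iota => [i k _ _|i|d ltd].
  - by move/val_inj/rev_ord_inj.
  - rewrite inE => ji; rewrite /= ltn_sub2l // (leq_ltn_trans ji) //.
  have dn : d < n by rewrite (leq_trans ltd) ?leq_subr.
  exists (rev_ord (Ordinal dn)); last by rewrite rev_ordK.
  by rewrite inE /= leq_subRL // addSn addnC -ltn_subRL.
have cardT : #|T| = j.
  have szC : #|~: T| = n - j.
    by rewrite cardE -(size_map (gam x j)) (perm_size permS) size_iota.
  by have := cardsC T; rewrite card_ord szC; lia.
split=> //.
have sum_gam : \sum_i gam x j i = \sum_(i < n) rev_ord i + \sum_(l < n | l < j) b l.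
  rewrite big_split [in RHS](reindex_inj (@perm_inj _ x.1)) /=.
  congr (_ + _); rewrite exchange_big /=; apply: eq_bigr => l _.
  by apply/eqP; apply: cs.
have sumT : \sum_i gam x j i = \sum_(i in T) gam x j i + \sum_(i in W) rev_ord i.
  rewrite (bigID (mem T)) /=; congr (_ + _).
  transitivity (\sum_(i in ~: T) gam x j i); first by apply: eq_bigl => i; rewrite in_setC.
  rewrite -!big_enum -(big_map (gam x j) xpredT id) (perm_big _ permS) /=.
  by rewrite -(perm_big _ permW) big_map.
have sum_rev : \sum_(i < n) rev_ord i
    = \sum_(i in W) rev_ord i + \sum_(i < n | i < j) rev_ord i.
  rewrite (bigID (mem W)) /=; congr (_ + _).
  by apply: eq_bigl => i; rewrite inE -ltnNge.
have le_beta i : gam x j i <= beta i.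
  by rewrite /beta -(eqP (rs i)) leq_gam.
have sum_beta : \sum_(i < n | i < j) beta i
    = \sum_(i < n | i < j) a i + \sum_(i < n | i < j) rev_ord i.
  by rewrite -big_split.
have := sum_beta_top T; rewrite cardT sum_beta => le_top.
have subT : \sum_(i in T) (beta i - gam x j i) + \sum_(i in T) gam x j i
    = \sum_(i in T) beta i.
  by rewrite -big_split /=; apply: eq_bigr => i _; rewrite subnK.
have sum_gamT : \sum_(i in T) gam x j i
    = \sum_(i < n | i < j) rev_ord i + \sum_(l < n | l < j) b l.
  by apply: (@addIn (\sum_(i in W) rev_ord i)); rewrite -sumT sum_gam sum_rev
    -addnA addnC.
move: le_top; rewrite -subT sum_gamT [X in _ <= X]addnC -addnA.
rewrite addnC -!addnA leq_add2l addnCA addnC.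
by rewrite -addnA.
Qed.

End GoodTerms.

Section DiagonalTerm.

Variables (n : nat) (a : 'I_n -> nat).
Hypothesis a_mono : forall i j : 'I_n, i <= j -> a j <= a i.
Hypothesis a_sum : \sum_i a i = n.
Local Notation X := ('S_n * {ffun 'I_n * 'I_n -> 'I_n.+1})%type.
Implicit Types x : X.

Let beta (i : 'I_n) := a i + rev_ord i.

(** For [b = a] both losses in [good_dominance] vanish at every [j]: after [j] columns the first [j]
    beads have reached their final positions and the others are below [n - j]. Hence the permutation
    is trivial and column [l] moves bead [l] only. *)
Lemma fits_diag x : fits a a x -> (forall k, k <= n -> good x k) ->
  x = (1%g, [ffun p : 'I_n * 'I_n => if p.1 == p.2 then inord (a p.1) else ord0]).
Proof.
move=> fx gx; have /and3P[/eqP tot /forallP cs /forallP rs] := fx.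
have key j (i : 'I_n) : j <= n -> (i < j -> gam x j i = beta i) /\ (j <= i -> gam x j i < n - j).
  move=> jn; have [cardT] := good_dominance a_mono fx jn (gx _ jn).
  set T := [set i | _] in cardT *; move=> le.
  move: le; rewrite -[leqRHS]addn0 leq_add2l leqn0 addn_eq0.
  case/andP=> subT0 /eqP cardU.
  have TE : T = [set i : 'I_n | i < j].
    apply/eqP; rewrite eqEcard cardT; apply/andP; split.
      apply/subsetP=> k kT; rewrite inE ltnNge; apply/negP=> jk.
      have /eqP := cardU; rewrite cards_eq0 => /eqP/setP/(_ k).
      by rewrite in_set kT jk in_set0.
    apply: (leq_card_bounded (f := val)) => [k l _ _|k]; first exact: val_inj.
    by rewrite inE.
  have memT k : (k \in T) = (k < j) by rewrite TE inE.
  split=> [ij|ji]; last first.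
    by have := memT i; rewrite inE ltnNge ji [n - j <= _]leqNgt => /negbFE.
  have betaE : beta i = gam x n i by rewrite (eqP (rs i)).
  apply/eqP; rewrite eqn_leq {1}betaE leq_gam //= -subn_eq0.
  move: subT0; rewrite sum_nat_eq0 => /forallP/(_ i).
  by rewrite memT ij.
have gii (i : 'I_n) : gam x i i <= rev_ord i.
  have [_ /(_ (leqnn i))] := key i i (ltnW (ltn_ord i)).
  by have := ltn_ord i; rewrite /=; lia.
have w1 : x.1 = 1%g.
  apply/eqP/negPn/negP=> nw; have := perm_neq1_least (w := x.1^-1)%g.
  rewrite eq_invg1 nw => /(_ isT)[i lti _].
  have := leq_trans (leq_gam x (x.1^-1 i)%g (leq0n _)) (gii (x.1^-1 i)%g).
  rewrite gam0 permKV /=; have := ltn_ord i; have := ltn_ord (x.1^-1 i)%g; lia.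
have rev1 (i : 'I_n) : gam x 0 i = rev_ord i by rewrite gam0 w1 perm1.
have entry0 (i l : 'I_n) : i != l -> x.2 (i, l) = 0 :> nat.
  rewrite neq_ltn => /orP[lt|lt].
    have := gamS x l i; rewrite (key l.+1 i (ltn_ord l)).1 ?leqW //.
    rewrite (key l i (ltnW (ltn_ord l))).1 // -[LHS]addn0.
    by move/addnI.
  have := gamS x l i; have := leq_gam x i lt.
  have := gii i; have := leq_gam x i (leq0n l).
  rewrite rev1 => le1 le2 le3 eqs; apply/eqP; rewrite -leqn0.
  rewrite -(leq_add2l (gam x l i)) addn0 -eqs (leq_trans le3) //.
  exact: leq_trans le1.
rewrite [LHS]surjective_pairing w1; congr (_, _).
apply/ffunP=> -[i l]; rewrite ffunE /=; apply: val_inj.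
have [<-|nil] := eqVneq i l; last by rewrite /= entry0.
apply: (@etrans _ _ (a i)).
  have := eqP (rs i); rewrite gamn w1 perm1 addnC => /addIn <-.
  by rewrite /rowsum (bigD1 i) //= big1 ?addn0 // => k nk; rewrite entry0 // eq_sym.
by rewrite /= inordK // ltnS -[leqRHS]a_sum (bigD1 i) //= leq_addr.
Qed.

Lemma fits_diag_good :
  let x := (1%g, [ffun p : 'I_n * 'I_n => if p.1 == p.2 then inord (a p.1) else ord0]) : X in
  fits a a x /\ forall k, k <= n -> good x k.
Proof.
move=> x.
have xE (i l : 'I_n) : x.2 (i, l) = (if i == l then a i else 0) :> nat.
  rewrite ffunE /=; case: eqP => // _; rewrite inordK // ltnS -[leqRHS]a_sum.
  by rewrite (bigD1 i) //= leq_addr.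
have gamE k (i : 'I_n) : gam x k i = rev_ord i + (if i < k then a i else 0).
  rewrite /gam perm1; congr (_ + _); case: ifP => ik.
    rewrite (bigD1 i) //= xE eqxx big1 ?addn0 // => l /andP[_ nl].
    by rewrite xE eq_sym (negPf nl).
  rewrite big1 // => l lk; rewrite xE; case: eqP lk => // <-.
  by rewrite ik.
have csE (l : 'I_n) : colsum x.2 l = a l.
  rewrite /colsum (bigD1 l) //= xE eqxx big1 ?addn0 // => i ni.
  by rewrite xE (negPf ni).
split.
  apply/and3P; split.
  - rewrite entry_sum_colsum -[X in _ == X]a_sum.
    by apply/eqP/eq_bigr => l _; apply: csE.
  - by apply/forallP=> l; rewrite csE.
  by apply/forallP=> i; rewrite gamE ltn_ord addnC.
move=> k kn; apply/goodP; split=> [i j|d ltd].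
  have lt_gam (u v : 'I_n) : u < v -> gam x k v < gam x k u.
    move=> uv; rewrite !gamE; have := a_mono (ltnW uv).
    have := ltn_ord v; rewrite /=; case: ifP; case: ifP; lia.
  by move=> eqg; apply: val_inj; case: (ltngtP i j) => // /lt_gam; rewrite eqg ltnn.
have dn : d < n by lia.
exists (rev_ord (Ordinal dn)); rewrite gamE rev_ordK /= ifF ?addn0 //.
by apply/negbTE; lia.
Qed.

End DiagonalTerm.

(** * Scalar products of Frobenius's class function *)

Section FrobeniusFormula.

Variables (n : nat) (a : nat -> nat).

Definition fit (w : 'S_n) (m : 'I_n -> nat) :=
  [forall i : 'I_n, m i + rev_ord (w i) == a i + rev_ord i].

(* Coefficient of x^m in det(h_(a_i - i + j)): the shift of a_i is moved to the
   side of m_i, so that no subtraction is truncated. *)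
Definition alt (m : 'I_n -> nat) : int := (\sum_(w | fit w m) (-1) ^+ odd_perm w)%R.

(* Frobenius's formula: the power sums are expanded over the colourings f of the
   points that are constant on the cycles of g. *)
Definition Theta (g : 'S_n) : int := (\sum_(f | stable g f) alt (content f))%R.

Lemma eq_fit w m1 m2 : m1 =1 m2 -> fit w m1 = fit w m2.
Proof. by move=> eqm; apply: eq_forallb => i; rewrite eqm. Qed.

Lemma eq_alt m1 m2 : m1 =1 m2 -> alt m1 = alt m2.
Proof. by move=> eqm; apply: eq_bigl => w; apply: eq_fit. Qed.

Hypothesis a_mono : forall i j, i <= j -> a j <= a i.
Hypothesis a_sum : \sum_(i < n) a i = n.

Let a_mono_ord (i j : 'I_n) : i <= j -> a j <= a i.
Proof. exact: a_mono. Qed.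

Lemma sum_fits1 :
  (\sum_(x | fits (fun i : 'I_n => a i) (fun i => a i) x) (-1) ^+ odd_perm x.1
     = 1 :> int)%R.
Proof.
rewrite (bigID (fun x => (stage x < n)%N)) /= sum_bad add0r.
have [fx gx] := fits_diag_good a_mono_ord a_sum.
rewrite (bigD1 (1%g, [ffun p : 'I_n * 'I_n =>
    if p.1 == p.2 then inord (a p.1) else ord0])) /=; last first.
  by rewrite fx; apply/negP=> lt; have := stage_bad lt; rewrite gx.
rewrite odd_perm1 big1 ?addr0 // => x /andP[/andP[fitx stx]].
rewrite (fits_diag a_mono_ord a_sum fitx) ?eqxx // => k kn.
by apply: good_stage; rewrite (leq_trans kn) // leqNgt.
Qed.

(** At the least [i] moved by [w], the first [i + 1] values of [b] have a larger sum than those of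
    [a], against [good_dominance]; so nothing survives the involution. *)
Lemma sum_fits0 (w : 'S_n) (b : 'I_n -> nat) : w != 1%g -> fit w b ->
  (\sum_(x | fits (fun i : 'I_n => a i) b x) (-1) ^+ odd_perm x.1 = 0 :> int)%R.
Proof.
move=> nw /forallP fw.
rewrite (bigID (fun x => (stage x < n)%N)) /= sum_bad add0r big1 //.
move=> x /andP[fx]; rewrite -leqNgt => st.
have [i lti fixi] := perm_neq1_least nw.
have gx : good x i.+1 by apply: good_stage; rewrite (leq_trans _ st).
have [_] := good_dominance a_mono_ord fx (ltn_ord i) gx.
suff: \sum_(l < n | l < i.+1) a l < \sum_(l < n | l < i.+1) b l.
  by move=> lt /(leq_trans (leq_addr _ _)); rewrite leqNgt lt.
rewrite (bigD1 i) //= [ltnRHS](bigD1 i) //= -addSn leq_add //.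
  by have := eqP (fw i); have := ltn_ord (w i); rewrite /=; lia.
apply: eq_leq; apply: eq_bigr => l /andP[li nl].
have := eqP (fw l); rewrite fixi; last first.
  by rewrite ltn_neqAle val_eqE nl.
by move/addIn.
Qed.

(** The norm of a Schur function, in coefficients. Expanding one determinant through [w'] prescribes
    the column sums: [w' = 1] prescribes [a] and contributes 1, any other [w'] contributes 0. *)
Lemma sum_alt :
  (\sum_(M : {ffun 'I_n * 'I_n -> 'I_n.+1} | (\sum_t M t)%N == n)
     alt (rowsum M) * alt (colsum M) = 1 :> int)%R.
Proof.
transitivity (\sum_(w' : 'S_n) (-1) ^+ odd_perm w' *
    \sum_(x : 'S_n * {ffun 'I_n * 'I_n -> 'I_n.+1} |
       [&& entry_sum x == n, fit w' (colsum x.2) & fit x.1 (rowsum x.2)])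
       (-1) ^+ odd_perm x.1 : int)%R.
  transitivity (\sum_(M : {ffun 'I_n * 'I_n -> 'I_n.+1} | (\sum_t M t)%N == n)
    \sum_(w' : 'S_n | fit w' (colsum M)) \sum_(w : 'S_n | fit w (rowsum M))
      (-1) ^+ odd_perm w' * (-1) ^+ odd_perm w : int)%R.
    apply: eq_bigr => M _; rewrite mulrC /alt mulr_suml; apply: eq_bigr => w' _.
    by rewrite mulr_sumr.
  rewrite (exchange_big_dep xpredT) //=; apply: eq_bigr => w' _.
  rewrite mulr_sumr (exchange_big_dep xpredT) //= pair_big_dep /=.
  by apply: eq_big => -[w M] //=; rewrite /entry_sum /= -andbA.
rewrite (bigD1 1%g) //= odd_perm1 mul1r [X in (_ + X)%R]big1 => [|w' nw'].
  rewrite addr0 -[RHS]sum_fits1; apply: eq_bigl => x; rewrite /fits.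
  congr [&& _, _ & _]; apply: eq_forallb => i.
    by rewrite perm1 eqn_add2r.
  by rewrite gamn addnC.
have [/forallP le|] := boolP [forall l : 'I_n, rev_ord (w' l) <= a l + rev_ord l].
  rewrite -[RHS](mulr0 ((-1) ^+ odd_perm w')%R); congr (_ * _)%R.
  have fb : fit w' (fun l => a l + rev_ord l - rev_ord (w' l)).
    by apply/forallP=> l; rewrite subnK.
  apply: etrans (sum_fits0 nw' fb); apply: eq_bigl => x; rewrite /fits.
  congr [&& _, _ & _]; apply: eq_forallb => i.
    by rewrite -[RHS](eqn_add2r (rev_ord (w' i))) subnK.
  by rewrite gamn addnC.
rewrite negb_forall => /existsP[l lt]; rewrite big_pred0 ?mulr0 // => x.
apply/negbTE; apply: contra lt => /and3P[_ /forallP/(_ l)/eqP <- _].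
exact: leq_addl.
Qed.

(** A pair of colourings is one colouring by pairs, whose multiplicities form a matrix with the two
    contents as row and column sums; [sum_fcount] then reduces the norm to [sum_alt]. *)
Lemma sum_Theta2 : (\sum_(g : 'S_n) Theta g ^+ 2 = n`!%:Z)%R.
Proof.
transitivity (\sum_(phi : {ffun 'I_n -> 'I_n * 'I_n})
  (alt (rowsum (fcount phi)) * alt (colsum (fcount phi)))
    *+ #|[set s : 'S_n | [forall k, phi (s k) == phi k]]|)%R; last first.
  rewrite (sum_fcount (fun M => alt (rowsum M) * alt (colsum M))%R).
  by rewrite sum_alt; rewrite natz.
pose P1 (phi : {ffun 'I_n -> 'I_n * 'I_n}) := [ffun k => (phi k).1].
pose P2 (phi : {ffun 'I_n -> 'I_n * 'I_n}) := [ffun k => (phi k).2].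
have rowE phi : alt (rowsum (fcount phi)) = alt (content (P1 phi)).
  apply: eq_alt => i; rewrite /rowsum /content.
  under eq_bigr do rewrite fcountE.
  rewrite -(sum_card_fiber (A := [set k | P1 phi k == i])
    (g := fun k => val (P2 phi k)) (m := n)); last by move=> k _; apply: ltn_ord.
  apply: eq_bigr => l _; apply: eq_card => k; rewrite !inE !ffunE.
  by rewrite [in LHS](surjective_pairing (phi k)) xpair_eqE.
have colE phi : alt (colsum (fcount phi)) = alt (content (P2 phi)).
  apply: eq_alt => l; rewrite /colsum /content.
  under eq_bigr do rewrite fcountE.
  rewrite -(sum_card_fiber (A := [set k | P2 phi k == l])
    (g := fun k => val (P1 phi k)) (m := n)); last by move=> k _; apply: ltn_ord.
  apply: eq_bigr => i _; apply: eq_card => k; rewrite !inE !ffunE.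
  by rewrite [in LHS](surjective_pairing (phi k)) xpair_eqE andbC.
transitivity (\sum_(fh : {ffun 'I_n -> 'I_n} * {ffun 'I_n -> 'I_n})
  (alt (content fh.1) * alt (content fh.2))
     *+ #|[set s : 'S_n | stable s fh.1 && stable s fh.2]|)%R.
  transitivity (\sum_(g : 'S_n)
     \sum_(fh : {ffun 'I_n -> 'I_n} * {ffun 'I_n -> 'I_n}
            | stable g fh.1 && stable g fh.2)
     alt (content fh.1) * alt (content fh.2))%R.
    apply: eq_bigr => g _; rewrite expr2 /Theta mulr_suml.
    under eq_bigr do rewrite mulr_sumr.
    by rewrite pair_big.
  rewrite (exchange_big_dep xpredT) //=; apply: eq_bigr => fh _.
  by rewrite -sumr_const; apply: eq_bigl => g; rewrite inE.
rewrite (reindex (fun phi => (P1 phi, P2 phi))) /=; last first.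
  exists (fun fh : {ffun 'I_n -> 'I_n} * {ffun 'I_n -> 'I_n} =>
            [ffun k => (fh.1 k, fh.2 k)]) => [phi _|[f h] _] /=.
    by apply/ffunP=> k; rewrite !ffunE -surjective_pairing.
  by congr (_, _); apply/ffunP=> k; rewrite !ffunE.
apply: eq_bigr => phi _; rewrite rowE colE; congr (_ *+ _)%R.
apply: eq_card => s; rewrite !inE; apply/andP/forallP=> [[]|st].
  move=> /stableP st1 /stableP st2 k; have := st1 k; have := st2 k.
  by rewrite !ffunE; case: (phi _) => ? ?; case: (phi _) => ? ? /= -> ->.
by split; apply/stableP=> k; rewrite !ffunE (eqP (st k)).
Qed.

Variables (row col : 'I_n -> nat).
Hypothesis a_supp : forall i, n <= i -> a i = 0.
Hypothesis col_lt : forall k, col k < a (row k).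
Hypothesis cell_onto : forall i c, c < a i -> exists k, row k = i /\ col k = c.
Hypothesis cell_inj : forall k l, row k = row l -> col k = col l -> k = l.
Local Notation e := (ysym row col).
Local Notation kappa := (ykappa row col).

(** [Theta] is an alternating sum over [w] of permutation characters. The term [w = 1] has content
    [a] and is [conj_sum_diag]; every other content exceeds [a] in some partial sum and contributes
    0. *)
Lemma conj_sum_Theta :
  (\sum_(g : 'S_n) conj_sum e g * (Theta g)%:~R = n`!%:R * kappa)%R.
Proof.
transitivity (\sum_(w : 'S_n) (-1) ^+ odd_perm w * \sum_g conj_sum e g *
  #|[set f : {ffun 'I_n -> 'I_n} | fit w (content f) & stable g f]|%:R)%R.
  transitivity (\sum_g \sum_(w : 'S_n) (-1) ^+ odd_perm w * (conj_sum e g *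
    #|[set f : {ffun 'I_n -> 'I_n} | fit w (content f) & stable g f]|%:R))%R.
    apply: eq_bigr => g _; rewrite /Theta /alt.
    rewrite (exchange_big_dep xpredT) //= rmorph_sum /= mulr_sumr.
    apply: eq_bigr => w _; rewrite sumr_const rmorphMn rmorph_sign /=.
    rewrite mulrCA -mulr_natr; congr (_ * (_ * _%:R))%R.
    by apply: eq_card => f; rewrite !inE /= unfold_in andbC.
  by rewrite exchange_big /=; apply: eq_bigr => w _; rewrite mulr_sumr.
have fitQ w (f : {ffun 'I_n -> 'I_n}) (x : 'S_n) :
    fit w (content [ffun k => f (x k)]) = fit w (content f).
  apply: eq_fit => i; rewrite /content -[LHS](card_imset _ (@perm_inj _ x)).
  apply: eq_card => l; rewrite -[l](permKV x) mem_imset ?inE ?ffunE //.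
  exact: perm_inj.
rewrite (bigD1 1%g) //= odd_perm1 mul1r [X in (_ + X)%R]big1 ?addr0.
  rewrite -(conj_sum_diag a_supp col_lt cell_onto cell_inj).
  apply: eq_bigr => g _; congr (_ * _%:R)%R.
  apply: eq_card => f; rewrite !inE; congr (_ && _).
  by apply: eq_forallb => i; rewrite perm1 eqn_add2r.
move=> w nw; rewrite [X in (_ * X)%R](conj_sum_dominance a_mono col_lt cell_onto).
- by rewrite mulr0.
- by move=> f x; apply: fitQ.
move=> f /forallP ff; have [i lti fixi] := perm_neq1_least nw; exists i.+1.
have rowlt := row_lt a_supp col_lt.
rewrite -(sum_card_fiber (A := [set k | row k < i.+1]) (g := row) (m := n)); last first.
  by move=> k _; apply: rowlt.
rewrite -(sum_card_fiber (A := [set k | f k < i.+1]) (g := fun k => val (f k)) (m := n));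
  last by move=> k _; apply: ltn_ord.
have rowE (l : 'I_n) : #|[set k in [set k | row k < i.+1] | row k == l]|
     = if l < i.+1 then a l else 0.
  case: ifP => li.
    rewrite -(card_row col_lt cell_onto cell_inj); apply: eq_card => k; rewrite !inE.
    by case: eqP => [->|]; rewrite ?andbF // li.
  apply/eqP; rewrite cards_eq0; apply/eqP/setP=> k; rewrite !inE.
  by case: eqP => [->|]; rewrite ?andbF // li.
have fE (l : 'I_n) : #|[set k in [set k | f k < i.+1] | val (f k) == l]|
     = if l < i.+1 then content f l else 0.
  case: ifP => li.
    apply: eq_card => k; rewrite !inE val_eqE.
    by case: eqP => [->|]; rewrite ?andbF // li.
  apply/eqP; rewrite cards_eq0; apply/eqP/setP=> k; rewrite !inE val_eqE.
  by case: eqP => [->|]; rewrite ?andbF // li.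
under eq_bigr do rewrite rowE; under [ltnRHS]eq_bigr do rewrite fE.
rewrite (bigD1 i) //= [ltnRHS](bigD1 i) //= ltnSn -addSn leq_add //.
  by have := eqP (ff i); have := ltn_ord (w i); rewrite /=; lia.
apply: leq_sum => l nl; case: ifP => // li.
have := eqP (ff l); rewrite fixi; first by move/addIn->.
by rewrite ltn_neqAle val_eqE nl.
Qed.

End FrobeniusFormula.

(** * The Specht character equals Frobenius's class function *)

Section Parts.

Variables (n : nat) (al : intpart n).

Definition part (i : nat) : nat := nth 0 (parts al) i.

Lemma parts_sorted : sorted geq (parts al).
Proof. by have /and3P[] := valP al. Qed.

Lemma parts_gt0 : 0 \notin parts al.
Proof. by have /and3P[] := valP al. Qed.

Lemma parts_sumn : sumn (parts al) = n.
Proof. by have /and3P[_ _ /eqP] := valP al. Qed.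

Lemma size_parts : size (parts al) <= n.
Proof. by rewrite size_map size_bseq. Qed.

Lemma part_mono i j : i <= j -> part j <= part i.
Proof.
move=> ij; rewrite /part; have [js|] := ltnP j (size (parts al)); last first.
  by move=> /(nth_default 0)->.
have geq_trans : transitive geq by move=> y x z /= xy yz; apply: leq_trans yz xy.
have := sorted_leq_nth geq_trans leqnn 0 parts_sorted; apply=> //.
by rewrite inE (leq_ltn_trans ij).
Qed.

Lemma part_supp i : n <= i -> part i = 0.
Proof. by move=> ni; apply: nth_default; apply: leq_trans size_parts ni. Qed.

Lemma part_sum : \sum_(i < n) part i = n.
Proof.
rewrite -[RHS]parts_sumn sumnE (big_nth 0) big_mkord.
rewrite (big_ord_widen n part size_parts) [RHS]big_mkcond.
by apply: eq_bigr => i _; case: ltnP => // /(nth_default 0).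
Qed.

Let row (k : 'I_n) := reshape_index (parts al) k.
Let col (k : 'I_n) := reshape_offset (parts al) k.

Let col_lt k : col k < part (row k).
Proof. by apply: reshape_offsetP; rewrite parts_sumn. Qed.

Let cell_onto i c : c < part i -> exists k, row k = i /\ col k = c.
Proof.
move=> lt; have := flatten_indexP lt; rewrite parts_sumn => ltn.
by exists (Ordinal ltn); rewrite /row /col /= flatten_indexKl ?flatten_indexKr.
Qed.

Let cell_inj k l : row k = row l -> col k = col l -> k = l.
Proof.
move=> eqr eqc; apply: val_inj => /=.
rewrite -[LHS](reshape_indexK (parts al)) -[RHS](reshape_indexK (parts al)).
by move: eqr eqc; rewrite /row /col => -> ->.
Qed.

Local Open Scope ring_scope.

Lemma young_symmetrizerE :
  young_symmetrizer al
    = gring_row (\sum_y ysym row col y *: regular_repr algC [set: 'S_n]%G y).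
Proof.
rewrite /young_symmetrizer; congr gring_row.
transitivity (\sum_(r in row_stab al) \sum_(c in col_stab al) \sum_y
   ((-1) ^+ odd_perm c * ((r * c)%g == y)%:R) *: regular_repr algC [set: 'S_n]%G y).
  apply: eq_bigr => r _; apply: eq_bigr => c _.
  rewrite (bigD1 (r * c)%g) //= eqxx mulr1 big1 ?addr0 // => y /negPf ny.
  by rewrite eq_sym ny mulr0 scale0r.
rewrite [RHS](eq_bigr (fun y => \sum_(r in row_stab al) \sum_(c in col_stab al)
   ((-1) ^+ odd_perm c * ((r * c)%g == y)%:R) *: regular_repr algC [set: 'S_n]%G y)).
  rewrite [RHS]exchange_big; apply: eq_bigr => r _.
  by rewrite [RHS]exchange_big.
move=> y _; rewrite scaler_suml; apply: eq_bigr => r _.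
by rewrite scaler_suml.
Qed.

(* Both class functions have norm 1 and inner product 1. *)
Lemma chi_Theta (g : 'S_n) : chi al g = (Theta part g)%:~R.
Proof.
have idem := ysym_idem part_supp col_lt cell_onto cell_inj.
set e := ysym row col in idem; set kappa := ykappa row col in idem.
have k0 : kappa != 0.
  by apply: (quasi_idem_neq0 idem); rewrite /e (ysym1 cell_inj) oner_eq0.
have chiE h : chi al h = kappa^-1 * conj_sum e h.
  by rewrite /chi /specht_repr young_symmetrizerE (cfRepr_cyclic_mx idem k0).
(* Real values identify [chi h^-1] with [chi h], which turns [conj_sum_norm] into a sum of squares,
   and they make the final squares nonnegative. *)
have e_real y : (e y)^* = e y.
  rewrite rmorph_sum; apply: eq_bigr => r _; rewrite rmorph_sum.
  by apply: eq_bigr => c _; rewrite rmorphM /= rmorph_sign rmorph_nat.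
have chi_real h : (chi al h)^* = chi al h.
  rewrite chiE rmorphM fmorphV /= !rmorph_sum /=; congr (_^-1 * _).
    by apply: eq_bigr => y _; rewrite rmorphM /= !e_real.
  by apply: eq_bigr => y _; rewrite e_real.
have chiV h : chi al h^-1%g = chi al h.
  by rewrite char_inv ?cfRepr_char.
have nf0 : (n`!)%:R != 0 :> algC by rewrite pnatr_eq0 -lt0n fact_gt0.
have norm1 : \sum_(h : 'S_n) chi al h ^+ 2 = n`!%:R.
  have := conj_sum_norm part_supp col_lt cell_onto cell_inj.
  rewrite -/e -/kappa => norm; apply: (mulIf (expf_neq0 2 k0)).
  rewrite -norm mulr_suml; apply: eq_bigr => h _.
  rewrite expr2 -{2}chiV !chiE; field.
  exact: k0.
have norm2 : \sum_(h : 'S_n) (Theta part h)%:~R ^+ 2 = n`!%:R :> algC.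
  transitivity ((\sum_(h : 'S_n) Theta part h ^+ 2)%:~R : algC).
    by rewrite [RHS]rmorph_sum /=; apply: eq_bigr => h _; rewrite rmorphXn.
  rewrite -[RHS]/((n`!%:Z)%:~R); congr (_%:~R).
  exact: sum_Theta2 part_mono part_sum.
have inner : \sum_(h : 'S_n) chi al h * (Theta part h)%:~R = n`!%:R.
  have := conj_sum_Theta part_mono part_sum part_supp col_lt cell_onto cell_inj.
  rewrite -/e -/kappa => inner; apply: (mulIf k0); rewrite -inner mulr_suml.
  by apply: eq_bigr => h _; rewrite chiE; field.
have diff0 : \sum_(h : 'S_n) (chi al h - (Theta part h)%:~R) ^+ 2 = 0.
  transitivity (\sum_(h : 'S_n) chi al h ^+ 2 + \sum_(h : 'S_n) (Theta part h)%:~R ^+ 2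
     - (\sum_(h : 'S_n) chi al h * (Theta part h)%:~R) *+ 2).
    rewrite -sumrMnl -big_split -sumrB /=; apply: eq_bigr => h _.
    by rewrite sqrrB addrAC.
  by rewrite norm1 norm2 inner mulr2n subrr.
have : (chi al g - (Theta part g)%:~R) ^+ 2 = 0.
  apply: (psumr_eq0P _ diff0) => // h _.
  rewrite real_exprn_even_ge0 // rpredB ?realz //.
  by apply/CrealP; apply: chi_real.
by move/eqP; rewrite sqrf_eq0 subr_eq0 => /eqP.
Qed.

End Parts.

(** * Vanishing and congruences modulo p *)

Definition bead n (a : nat -> nat) (i : 'I_n) : nat := a i + rev_ord i.

(* The shape a, drawn with n beads, is a t-core when no bead can move down by t. *)
Definition core n (a : nat -> nat) (t : nat) : bool :=
  [forall j : 'I_n, (t <= bead a j) ==> [exists i : 'I_n, bead a i + t == bead a j]].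

Definition constant_on n (C : {set 'I_n}) (f : {ffun 'I_n -> 'I_n}) : bool :=
  [forall x in C, [forall y in C, f x == f y]].

Lemma constant_onP n (C : {set 'I_n}) (f : {ffun 'I_n -> 'I_n}) :
  reflect {in C &, forall x y, f x = f y} (constant_on C f).
Proof.
apply: (iffP forall_inP) => [h x y Cx Cy|h x Cx].
  by have /forall_inP/(_ y Cy)/eqP := h x Cx.
by apply/forall_inP=> y Cy; rewrite (h x y).
Qed.

(** * Cancellation for t-cores *)

Section Vanishing.

Variables (n t : nat) (a : nat -> nat) (C : {set 'I_n}) (u : 'S_n).
Hypothesis t_gt0 : 0 < t.
Hypothesis a_core : core n a t.
Hypothesis cardC : #|C| = t.
Hypothesis u_C : forall x, (u x \in C) = (x \in C).

Lemma alt_gt (m : 'I_n -> nat) j : bead a j < m j -> alt a m = 0%R.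
Proof.
move=> lt; rewrite /alt big_pred0 // => w; apply/negbTE.
rewrite negb_forall; apply/existsP; exists j; rewrite -/(bead a j) neq_ltn.
by rewrite [X in _ || X]ltn_addr ?orbT.
Qed.

(** The equation for [j] in [m'] is the equation for [i] in [m] shifted by [t], and conversely: two
    rows of the determinant are exchanged. *)
Lemma alt_swap (m m' : 'I_n -> nat) i j : i != j ->
    bead a i + t = bead a j -> m' j = m i + t -> m' i + t = m j ->
    (forall k, k != i -> k != j -> m' k = m k) ->
  alt a m' = (- alt a m)%R.
Proof.
move=> nij bij mj mi mk; rewrite /alt (reindex_inj (mulgI (tperm i j))) -sumrN /=.
apply: eq_big => [w|w _]; last first.
  by rewrite odd_permM odd_tperm nij /=; case: odd_perm; rewrite ?expr0 ?expr1 ?opprK.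
have fitE k : m' k + rev_ord (w (tperm i j k)) == bead a k =
     (m (tperm i j k) + rev_ord (w (tperm i j k)) == bead a (tperm i j k)).
  case: tpermP => [->|->|/eqP ni /eqP nj]; last by rewrite mk.
    by rewrite -bij -mi -(eqn_add2r t) addnAC.
  by rewrite mj -bij addnAC eqn_add2r.
apply/forallP/forallP=> h k; last first.
  by rewrite permM -/(bead a k) fitE; apply: h.
by have := h (tperm i j k); rewrite permM -/(bead a _) fitE tpermK.
Qed.

(** [C] carries a single colour [j], like one cycle of length [t]. If a bead [i] stands [t] below
    bead [j], exchanging the colours [i] and [j] outside [C] changes the sign of [alt]. If there is
    none, the core condition gives [bead a j < t] while [j] occurs at least [t] times, so [alt] is
    0. *)
Lemma sum_core_eq0 :
  (\sum_(f | stable u f && constant_on C f) alt a (content f) = 0)%R.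
Proof.
have [c0 Cc0] : exists c, c \in C.
  by apply/set0Pn; rewrite -cards_eq0 cardC -lt0n.
pose partner (j : 'I_n) := [pick i : 'I_n | bead a i + t == bead a j].
pose sw (f : {ffun 'I_n -> 'I_n}) : {ffun 'I_n -> 'I_n} :=
  if partner (f c0) is Some i then
    [ffun x => if x \in C then f x else tperm i (f c0) (f x)] else f.
have swc f : sw f c0 = f c0.
  by rewrite /sw; case: (partner _) => // i; rewrite ffunE Cc0.
have swK f : sw (sw f) = f.
  rewrite {1}/sw swc; case E: (partner _) => [i|]; last by rewrite /sw E.
  apply/ffunP=> x; rewrite ffunE /sw E ffunE.
  by case: (x \in C); rewrite ?ffunE ?tpermK.
have swP f : stable u f && constant_on C f -> stable u (sw f) && constant_on C (sw f).
  case/andP=> /stableP st /constant_onP cst; rewrite /sw.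
  case: (partner _) => [i|]; last first.
    by apply/andP; split; [apply/stableP | apply/constant_onP].
  apply/andP; split; first by apply/stableP=> k; rewrite !ffunE u_C st.
  by apply/constant_onP=> x y Cx Cy; rewrite !ffunE Cx Cy; apply: cst.
set S := LHS; suff : (S = - S)%R.
  by move/eqP; rewrite -addr_eq0 -mulr2n mulrn_eq0 => /eqP.
rewrite {1}/S (reindex_onto sw sw) /= => [|f _]; last exact: swK.
rewrite /S -sumrN; apply: eq_big => [f|f /andP[Pf _]].
  rewrite swK eqxx andbT; apply/idP/idP; last exact: swP.
  by move/swP; rewrite swK.
have {Pf} := swP _ Pf; rewrite swK => /andP[_ /constant_onP cst].
set j := f c0; have fC x : x \in C -> f x = j by move=> Cx; apply: cst.
have C_fiber : C \subset [set k | f k == j].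
  by apply/subsetP=> x Cx; rewrite inE fC.
rewrite /sw /partner -/j; case: pickP => [i /eqP bij|no]; last first.
  rewrite (@alt_gt _ j) ?oppr0 //.
  apply: leq_trans (_ : t <= _); last by rewrite -cardC /content subset_leq_card.
  rewrite ltnNge; apply/negP=> tj.
  have /forallP/(_ j) := a_core; rewrite tj => /existsP[i].
  by rewrite no.
have nij : i != j.
  apply: contra_eq_neq bij => ->.
  by rewrite -[X in _ != X]addn0 eqn_add2l -lt0n.
apply: (alt_swap (i := i) (j := j)) => //.
- rewrite /content -(cardsID C) addnC -cardC; congr (_ + _).
    apply: eq_card => k; rewrite !inE ffunE.
    have [Ck|Ck] /= := boolP (k \in C).
      by rewrite fC // eq_sym (negPf nij).
    by rewrite (can2_eq (tpermK i j) (tpermK i j)) tpermR.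
  by apply: eq_card => k; rewrite !inE ffunE; case: (boolP (k \in C)) => [Ck|];
    rewrite ?andbF // fC // eqxx.
- rewrite /content -[in RHS](cardsID C) addnC -cardC; congr (_ + _).
    apply: eq_card => k; rewrite !inE; case: (boolP (k \in C)) => [Ck|];
    by rewrite ?andbF // fC // eqxx.
  apply: eq_card => k; rewrite !inE ffunE.
  have [Ck|Ck] /= := boolP (k \in C).
    by rewrite fC // eq_sym (negPf nij).
  by rewrite (can2_eq (tpermK i j) (tpermK i j)) tpermL.
move=> k ni nj; apply: eq_card => x; rewrite !inE ffunE.
case: (boolP (x \in C)) => // _.
by rewrite (can2_eq (tpermK i j) (tpermK i j)) tpermD // eq_sym.
Qed.

End Vanishing.

(** On [S], [rho] is a permutation of p-power order, so every orbit with more than one point has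
    size divisible by [p], and [F] is constant on it. *)
Lemma sum_fixed_mod (T : finType) (S : {pred T}) (rho : T -> T) (F : T -> int) p k :
    prime p -> {in S, forall x, rho x \in S} ->
    {in S, forall x, iter (p ^ k) rho x = x} -> {in S, forall x, F (rho x) = F x} ->
  (p %| (\sum_(x in S) F x - \sum_(x in S | rho x == x) F x)%R)%Z.
Proof.
move=> pr_p stabS perS FS.
pose r x := if x \in S then rho x else x.
have rS x : (r x \in S) = (x \in S).
  by rewrite /r; case: ifP => // Sx; apply: stabS.
have r_iter m x : x \in S -> iter m r x = iter m rho x /\ iter m r x \in S.
  move=> Sx; elim: m => [|m [IH1 IH2]] //=; rewrite rS IH2; split=> //.
  by rewrite -IH1 /r IH2.
have r_per x : iter (p ^ k) r x = x.
  have [Sx|nSx] := boolP (x \in S); first by rewrite (r_iter _ _ Sx).1 perS.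
  by elim: (p ^ k) => //= m ->; rewrite /r (negPf nSx).
have pk_gt0 : 0 < p ^ k by rewrite expn_gt0 prime_gt0.
have r_inj : injective r.
  move=> x y eq_r; rewrite -[x]r_per -[y]r_per -(prednK pk_gt0) !iterSr eq_r //.
have it_inj i : injective (iter i r).
  by elim: i => [|i IHi] x y //= /r_inj/IHi.
pose s := perm r_inj.
have s_iter m x : (s ^+ m)%g x = iter m r x.
  by rewrite permX; apply: eq_iter => y; rewrite permE.
have ord_s : (#[s] %| p ^ k)%g.
  by rewrite order_dvdn; apply/eqP/permP=> x; rewrite s_iter r_per perm1.
rewrite (bigID (fun x => rho x == x)) /= addrAC subrr add0r.
rewrite (partition_big (porbit s) xpredT) //=; apply: rpred_sum => O _.
have [/existsP[x0]|] := boolP [exists x, [&& x \in S, rho x != x & porbit s x == O]];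
  last first.
  rewrite negb_exists => /forallP none; rewrite big_pred0 ?rpred0 // => x.
  by rewrite -andbA; apply/negbTE.
case/and3P=> Sx0 mx0 /eqP defO.
have OE x : (x \in S) && (rho x != x) && (porbit s x == O) = (x \in porbit s x0).
  apply/andP/idP => [[_]|]; first by rewrite -defO eq_porbit_mem.
  rewrite -defO eq_porbit_mem => xO; split=> //.
  have /porbitP[i ->] := xO; rewrite s_iter; have [eqi Si] := r_iter i x0 Sx0.
  rewrite Si /=; apply: contra mx0 => /eqP fixi.
  have : r (iter i r x0) = iter i r x0 by rewrite {1}/r Si.
  rewrite -iterS iterSr => /it_inj.
  by rewrite {1}/r Sx0 => ->.
have FE x : x \in porbit s x0 -> F x = F x0.
  case/porbitP=> i ->; rewrite s_iter; elim: i => //= i IH.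
  by rewrite {1}/r (r_iter i x0 Sx0).2 FS // (r_iter i x0 Sx0).2.
rewrite (eq_bigl _ _ OE) (eq_bigr _ FE) sumr_const -mulr_natr dvdz_mull //.
rewrite natz dvdzE /=.
have dvd_orb : #|porbit s x0| %| p ^ k.
  by apply: dvdn_trans ord_s; rewrite porbitE; apply: dvdn_orbit.
have [[|j] _ cardO] := dvdn_pfactor _ _ pr_p dvd_orb; last first.
  by rewrite cardO expnS dvdn_mulr.
move/eqP: cardO => /cards1P[y eqO].
have: x0 \in porbit s x0 by apply: porbit_id.
have: s x0 \in porbit s x0 by rewrite -{1}[s]expg1 mem_porbit.
rewrite eqO !inE => /eqP <- /eqP/esym; rewrite permE /r Sx0 => eq0.
by rewrite eq0 eqxx in mx0.
Qed.

(** * Congruences modulo p for Frobenius's class function *)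

Section ThetaModP.

Variables (n : nat) (a : nat -> nat) (p : nat).
Hypothesis pr_p : prime p.

Lemma content_comp (s : 'S_n) (f : {ffun 'I_n -> 'I_n}) i :
  content [ffun k => f (s k)] i = content f i.
Proof.
rewrite /content -[LHS](card_imset _ (@perm_inj _ s)).
apply: eq_card => l; rewrite -[l](permKV s) mem_imset ?inE ?ffunE //.
exact: perm_inj.
Qed.

(** [s] acts on the colourings stable under its power, with order dividing [p ^ k]; the fixed points
    are the colourings stable under [s]. *)
Lemma Theta_expg_mod (s : 'S_n) k :
  (p %| (Theta a (s ^+ (p ^ k))%g - Theta a s)%R)%Z.
Proof.
set u := (s ^+ (p ^ k))%g.
pose rho (f : {ffun 'I_n -> 'I_n}) := [ffun x => f (s x)].
have rho_iter m f : iter m rho f = [ffun x => f ((s ^+ m)%g x)].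
  elim: m f => [|m IHm] f; first by apply/ffunP=> x; rewrite ffunE perm1.
  rewrite iterSr IHm; apply/ffunP=> x; rewrite !ffunE expgSr permM.
  by [].
have := @sum_fixed_mod _ (stable u) rho (fun f => alt a (content f)) p k pr_p.
move=> H; have {H} := H _ _ _.
rewrite /Theta.
rewrite [X in (_ - X)%R](eq_bigl (stable s)); last first.
  move=> f; rewrite unfold_in; apply/andP/stableP=> [[_ /eqP fix_f] x|st].
    by rewrite -[in RHS]fix_f ffunE.
  split; last by apply/eqP/ffunP=> x; rewrite ffunE.
  apply/stableP=> x; rewrite /u; elim: (p ^ k) => [|m IHm]; first by rewrite perm1.
  by rewrite expgSr permM st.
apply.
- move=> f /stableP st; apply/stableP=> x; rewrite !ffunE -permM.
  by rewrite -(commuteX (p ^ k) (commute_refl s)) permM st.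
- move=> f /stableP st; rewrite rho_iter; apply/ffunP=> x; rewrite ffunE.
  exact: st.
by move=> f _; apply: eq_alt => i; apply: content_comp.
Qed.

(** The colours of the cycles in [Os] are rotated cyclically; as the cycles have equal length, the
    content is kept. The fixed colourings are constant on the union of these cycles, which has
    [b * p ^ e] points, and [sum_core_eq0] cancels them. *)
Lemma Theta_merge (u : 'S_n) (e b : nat) (Os : seq {set 'I_n}) :
    0 < b -> core n a (b * p ^ e) -> uniq Os -> size Os = p ^ e ->
    {subset Os <= porbits u} -> {in Os, forall O : {set 'I_n}, #|O| = b} ->
  (p %| Theta a u)%Z.
Proof.
move=> b_gt0 cr uOs; set q := p ^ e => szO subO cardO.
have q_gt0 : 0 < q by rewrite expn_gt0 prime_gt0.
(* Outside the cycles of [Os], [index] returns [size Os = q]; thus [pos x < q] says that [x] lies on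
   one of them. *)
pose pos (x : 'I_n) := index (porbit u x) Os.
have pos_u x : pos (u x) = pos x.
  by have := porbit_perm u 1 x; rewrite /pos expg1 => ->.
have [r rP] : exists r : nat -> 'I_n, forall j, j < q -> pos (r j) = j.
  have /fin_all_exists[r rP] : forall j : 'I_q, exists x, pos x = j.
    move=> j; have jO : nth set0 Os j \in Os by rewrite mem_nth ?szO.
    have /imsetP[x _ defO] := subO _ jO; exists x.
    by rewrite /pos -defO index_uniq ?szO.
  exists (fun j => r (Ordinal (ltn_pmod j q_gt0))) => j jq.
  by rewrite rP /= modn_small.
pose C := [set x | pos x < q].
have posE j : j < q -> [set x | pos x == j] = nth set0 Os j.
  move=> jq; have jO : nth set0 Os j \in Os by rewrite mem_nth ?szO.
  have /imsetP[x0 _ defO] := subO _ jO; apply/setP=> x.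
  rewrite inE defO -eq_porbit_mem -defO; apply/eqP/eqP=> ex.
    by rewrite -ex /pos nth_index // -index_mem szO -/(pos x) ex.
  by rewrite /pos ex index_uniq ?szO.
have cardC : #|C| = b * q.
  rewrite -(sum_card_fiber (g := pos) (m := q)); last by move=> x; rewrite inE.
  transitivity (\sum_(j < q) b); last by rewrite sum_nat_const card_ord mulnC.
  apply: eq_bigr => j _; rewrite -(cardO (nth set0 Os j)) ?mem_nth ?szO //.
  rewrite -posE //; apply: eq_card => x; rewrite !inE.
  by case: eqP => [->|]; rewrite ?andbF // ltn_ord.
have st_pos f x y : stable u f -> pos x < q -> pos y = pos x -> f y = f x.
  move=> /stableP st xq eqp; have : porbit u y == porbit u x.
    have xO : porbit u x \in Os by rewrite -index_mem szO.
    have yO : porbit u y \in Os by rewrite -index_mem szO -/(pos y) eqp.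
    by rewrite -(nth_index set0 yO) -(nth_index set0 xO) -/(pos x) -/(pos y) eqp.
  rewrite eq_porbit_mem => /porbitP[i ->]; elim: i => [|i IHi]; first by rewrite perm1.
  by rewrite expgSr permM st.
pose rho (f : {ffun 'I_n -> 'I_n}) :=
  [ffun x => if pos x < q then f (r ((pos x).+1 %% q)) else f x].
have rho_iter m f x : stable u f ->
    iter m rho f x = if pos x < q then f (r ((pos x + m) %% q)) else f x.
  move=> st; elim: m x => [|m IHm] x.
    case: ifP => // xq; rewrite addn0 modn_small //=.
    by apply/esym/st_pos; rewrite ?rP.
  rewrite /= ffunE; case: ifP => xq; last by rewrite IHm xq.
  by rewrite IHm rP ?ltn_mod // q_gt0 modnDml addSnnS.
have := @sum_fixed_mod _ (stable u) rho (fun f => alt a (content f)) p e pr_p.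
move=> H; have {H} := H _ _ _.
rewrite -/(Theta a u) [X in (_ - X)%R](_ : _ = 0%R); last first.
  rewrite -[RHS](sum_core_eq0 (C := C) (u := u) _ cr _ _) ?cardC //; first last.
  - by move=> x; rewrite !inE pos_u.
  - by rewrite muln_gt0 b_gt0.
  apply: eq_bigl => f; rewrite unfold_in; apply: andb_id2l => st.
  apply/eqP/constant_onP => [fixf x y|cst].
    rewrite !inE => xq yq.
    have fix_r j : j < q -> f (r j) = f (r 0).
      elim: j => // j IHj jq; have jq' := ltnW jq; rewrite -(IHj jq').
      by move/ffunP/(_ (r j)): fixf; rewrite ffunE (rP _ jq') jq' modn_small.
    rewrite -(st_pos f x (r (pos x)) st xq); last exact: rP.
    rewrite -(st_pos f y (r (pos y)) st yq); last exact: rP.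
    by rewrite (fix_r _ xq) (fix_r _ yq).
  apply/ffunP=> x; rewrite ffunE; case: ifP => // xq.
  by apply: cst; rewrite inE ?rP ?ltn_mod.
rewrite subr0; apply.
- move=> f st; apply/stableP=> x; rewrite !ffunE pos_u; case: ifP => // _.
  by have /stableP -> := st.
- move=> f st; apply/ffunP=> x; rewrite rho_iter //; case: ifP => // xq.
  by rewrite modnDr modn_small //; apply: st_pos; rewrite ?rP.
move=> f st; apply: eq_alt => v.
pose N := #|[set x in ~: C | f x == v]|.
have split_content (g : {ffun 'I_n -> 'I_n}) (h : 'I_q -> 'I_q) :
    (forall x, x \notin C -> g x = f x) ->
    (forall (j : 'I_q) x, pos x = j -> g x = f (r (h j))) ->
  content g v = \sum_(j < q) (f (r (h j)) == v) * b + N.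
  move=> gN gC; rewrite /content -(cardsID C) addnC [RHS]addnC; congr (_ + _).
    apply: eq_card => x; rewrite !inE; case: (boolP (pos x < q)) => //= nx.
    by rewrite gN // inE.
  rewrite -(sum_card_fiber (g := pos) (m := q)); last first.
    by move=> x; rewrite !inE => /andP[].
  apply: eq_bigr => j _.
  rewrite -(cardO (nth set0 Os j)) ?mem_nth ?szO // -posE //.
  have [fv|nfv] := eqVneq (f (r (h j))) v; rewrite ?mul1n ?mul0n.
    apply: eq_card => x; rewrite !inE; apply/andP/eqP=> [[_ /eqP]//|xj].
    by rewrite xj ltn_ord (gC j) // fv !eqxx.
  apply/eqP; rewrite cards_eq0; apply/eqP/setP=> x; rewrite !inE.
  apply/negbTE/negP=> /andP[/andP[/eqP gv _] /eqP xj].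
  by move/eqP: nfv; rewrite -(gC j x xj).
rewrite (split_content (rho f) (@ordS q)).
- rewrite (split_content f id) //; last by move=> j x xj; apply: st_pos; rewrite ?rP ?xj.
  by congr (_ + _); rewrite [RHS](reindex_inj (@ordS_inj q)).
- by move=> x; rewrite inE ffunE => /negPf->.
by move=> j x xj; rewrite ffunE xj ltn_ord.
Qed.

End ThetaModP.

(** * Cycle types and the removal of p-parts *)

Section CycleTypes.

Lemma expg_fix (T : finType) (s : {perm T}) x i :
  ((s ^+ i)%g x == x) = (#|porbit s x| %| i).
Proof.
set m := #|porbit s x|.
have m_gt0 : 0 < m by rewrite lt0n card_porbit_neq0.
have sm : (s ^+ m)%g x = x by rewrite permX iter_porbit.
have fix_mul j : (s ^+ (j * m))%g x = x.
  elim: j => [|j IHj]; first by rewrite perm1.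
  by rewrite mulSn expgD permM sm.
apply/eqP/idP=> [|/dvdnP[j ->] //].
rewrite {1}(divn_eq i m) expgD permM fix_mul => fix_r.
rewrite /dvdn; apply: contraT => nr.
have ltr := ltn_pmod i m_gt0.
have : nth x (traject s x m) (i %% m) == nth x (traject s x m) 0.
  by rewrite !nth_traject //= -permX fix_r.
by rewrite nth_uniq ?size_traject ?uniq_traject_porbit // (negPf nr).
Qed.

(** A cycle length is at most [n < p ^ n], so its p-part divides [p ^ n]: this one exponent removes
    the p-parts of all cycles at once. *)
Lemma card_porbit_pfactor n (s : 'S_n) p x : prime p ->
  #|porbit (s ^+ (p ^ n))%g x| = (#|porbit s x|`_p^')%N.
Proof.
move=> pr_p; set m := #|porbit s x|.
have m_gt0 : 0 < m by rewrite lt0n card_porbit_neq0.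
have mn : m <= n by rewrite -[leqRHS]card_ord max_card.
have fixE i : (#|porbit (s ^+ (p ^ n))%g x| %| i) = (m`_p^' %| i).
  rewrite -expg_fix -expgM expg_fix -/m.
  apply/idP/idP=> [dv|dv].
    have: m`_p^' %| p ^ n * i by apply: dvdn_trans (dvdn_part _ _) dv.
    rewrite Gauss_dvdr // coprime_sym; apply: (@pnat_coprime p); last exact: part_pnat.
    by rewrite pnatX pnat_id.
  rewrite -(partnC p m_gt0) Gauss_dvd ?coprime_partC //.
  rewrite [X in _ && X]dvdn_mull // andbT dvdn_mulr // p_part dvdn_exp2l //.
  rewrite -(leq_exp2l _ _ (prime_gt1 pr_p)) -p_part.
  apply: leq_trans (dvdn_leq m_gt0 (dvdn_part _ _)) _.
  by apply: leq_trans mn (ltnW (ltn_expl _ (prime_gt1 pr_p))).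
by apply/eqP; rewrite eqn_dvd fixE dvdnn -fixE dvdnn.
Qed.

Lemma sum_porbits (T : finType) (s : {perm T}) (F : nat -> nat) :
  \sum_x F #|porbit s x| = \sum_(O in porbits s) #|O| * F #|O|.
Proof.
rewrite (partition_big (porbit s) (mem (porbits s))) /= => [|x _]; last exact: imset_f.
apply: eq_bigr => O /imsetP[x0 _ ->].
rewrite -sum_nat_const; apply: eq_big => [x|x /eqP -> //].
by rewrite eq_porbit_mem.
Qed.

Lemma sum_cycle_type n (s : 'S_n) (F : nat -> nat) :
  \sum_(O in porbits s) F #|O| = \sum_(m <- cycle_type s) F m.
Proof.
rewrite -big_enum /cycle_type (perm_big _ (permEl (perm_sort _ _))) /=.
by rewrite big_map.
Qed.

Lemma count_pstar p mu b :
  count_mem b (pstar p mu) = \sum_(m <- mu) (m`_p^' == b) * m`_p.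
Proof.
rewrite /pstar (seq.permP (permEl (perm_sort _ _))) count_flatten -map_comp sumnE big_map.
by apply: eq_bigr => m _; rewrite /= count_nseq.
Qed.

(** A cycle splits into as many cycles as the p-part of its length, each as long as the p'-part,
    which is the recipe of [pstar]. Multiplying by [b] replaces the count of cycles by a count of
    points. *)
Lemma card_orbits_pstar n (s : 'S_n) p b : prime p -> 0 < b ->
  #|[set O in porbits (s ^+ (p ^ n))%g | #|O| == b]| = count_mem b (pstar p (cycle_type s)).
Proof.
move=> pr_p b_gt0; set u := (s ^+ (p ^ n))%g.
apply/eqP; rewrite -(eqn_pmul2r b_gt0); apply/eqP.
transitivity (\sum_x (#|porbit u x| == b)).
  rewrite (sum_porbits u (fun m => m == b)) -sum_nat_const.
  rewrite [RHS](bigID (fun O : {set 'I_n} => #|O| == b)) /= [X in _ = _ + X]big1 ?addn0.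
    by apply: eq_big => [O|O]; rewrite ?inE // => /andP[_ /eqP ->]; rewrite eqxx muln1.
  by move=> O /andP[_ /negPf->]; rewrite muln0.
under eq_bigr do rewrite card_porbit_pfactor //.
rewrite (sum_porbits s (fun m => m`_p^' == b)).
rewrite (sum_cycle_type s (fun m => m * (m`_p^' == b))) count_pstar.
rewrite big_distrl /= [LHS]big_seq [RHS]big_seq; apply: eq_bigr => m.
rewrite mem_sort => /mapP[O]; rewrite mem_enum => /imsetP[x _ ->] ->.
set k := #|_|; have k_gt0 : 0 < k by rewrite lt0n card_porbit_neq0.
by case: eqP => [<-|]; rewrite ?muln0 ?mul0n // mul1n muln1 partnC.
Qed.

(** Turning each row of the tableau of shape [mu] cyclically makes the rows the cycles. *)
Lemma perm_of_cycle_type n (mu : intpart n) : exists s : 'S_n, cycle_type s = parts mu.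
Proof.
pose row (k : 'I_n) := reshape_index (parts mu) k.
pose col (k : 'I_n) := reshape_offset (parts mu) k.
have col_lt k : col k < part mu (row k).
  by apply: reshape_offsetP; rewrite parts_sumn.
have cell_onto i c : c < part mu i -> exists k, row k = i /\ col k = c.
  move=> lt; have := flatten_indexP lt; rewrite parts_sumn => ltn.
  by exists (Ordinal ltn); rewrite /row /col /= flatten_indexKl ?flatten_indexKr.
have cell_inj k l : row k = row l -> col k = col l -> k = l.
  move=> eqr eqc; apply: val_inj => /=.
  rewrite -[LHS](reshape_indexK (parts mu)) -[RHS](reshape_indexK (parts mu)).
  by move: eqr eqc; rewrite /row /col => -> ->.
have part_gt0 k : 0 < part mu (row k) by apply: leq_ltn_trans (col_lt k).
have ltq k : (col k).+1 %% part mu (row k) < part mu (row k) by rewrite ltn_mod.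
have [|s sP] := cell_perm cell_onto ltq.
  move=> k l eqr; rewrite eqr => eqm; apply: cell_inj => //.
  have := col_lt l; have := col_lt k; rewrite eqr => lk ll.
  apply/eqP; rewrite -(modn_small lk) -(modn_small ll).
  by rewrite -(eqn_modDr 1) !addn1; apply/eqP.
pose fiber i := [set k | row k == i].
have card_fiber i : #|fiber i| = part mu i by apply: (card_row col_lt).
have s_iter i k : row ((s ^+ i)%g k) = row k /\
    col ((s ^+ i)%g k) = (col k + i) %% part mu (row k).
  elim: i => [|i [IHr IHc]]; first by rewrite perm1 addn0 modn_small.
  rewrite expgSr permM; have [-> ->] := sP ((s ^+ i)%g k).
  by rewrite IHr IHc -addn1 modnDml addn1 addnS.
have porbitE k : porbit s k = fiber (row k).
  apply/setP=> l; rewrite inE; apply/porbitP/eqP=> [[i ->]|rl].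
    by have [] := s_iter i k.
  exists (col l + (part mu (row k) - col k)); have [ri ci] :=
    s_iter (col l + (part mu (row k) - col k)) k.
  apply: cell_inj; first by rewrite ri.
  rewrite ci addnCA subnKC; last exact: ltnW.
  by rewrite modnDr modn_small // -rl.
exists s.
have geq_trans : transitive geq by move=> y x z /= xy yz; apply: leq_trans yz xy.
have geq_anti : antisymmetric geq by move=> x y; rewrite /= andbC; apply: anti_leq.
have geq_total : total geq by move=> x y; apply: leq_total.
apply: (sorted_eq geq_trans geq_anti); rewrite ?parts_sorted ?sort_sorted //.
rewrite (permPl (permEl (perm_sort _ _))).
have -> : parts mu = [seq #|pred_of_set B| | B : {set 'I_n} <- [seq fiber i | i <- iota 0 (size
  (parts mu))]].
  rewrite -map_comp -[LHS](mkseq_nth 0) /mkseq; apply: eq_map => i /=.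
  by rewrite card_fiber.
apply: perm_map; apply: uniq_perm; first exact: enum_uniq.
  rewrite map_inj_in_uniq ?iota_uniq // => i j; rewrite !mem_iota /= => ilt _ eqF.
  have : 0 < part mu i.
    rewrite lt0n; apply: contraNneq (parts_gt0 mu) => <-.
    by rewrite mem_nth.
  case/cell_onto=> k [rk _]; have : k \in fiber i by rewrite inE rk.
  by rewrite eqF inE rk => /eqP.
move=> O; rewrite mem_enum; apply/imsetP/mapP=> [[k _ ->]|[i]].
  exists (row k); last exact: porbitE.
  by rewrite mem_iota /= reshape_indexP // parts_sumn.
rewrite mem_iota /= => ilt ->.
have : 0 < part mu i.
  rewrite lt0n; apply: contraNneq (parts_gt0 mu) => <-.
  by rewrite mem_nth.
by case/cell_onto=> k [rk _]; exists k; rewrite // porbitE rk.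
Qed.

End CycleTypes.

(** * Divisibility of the character values at cores *)

Section CharacterValues.
Local Open Scope ring_scope.

Lemma chi_val_dvd p n (al la mu : intpart n) b e :
    prime p -> mu \in K p la -> b \in parts la ->
    (p ^ e <= count_mem b (parts la))%N -> core n (part al) (b * p ^ e) ->
  (p %| chi_val al mu)%C.
Proof.
move=> pr_p; rewrite inE => /eqP muK b_la le_e cr.
have b_gt0 : (0 < b)%N.
  by rewrite lt0n; apply: contraNneq (parts_gt0 la) => <-.
rewrite /chi_val; case: pickP => [s /eqP cs|none]; last first.
  by have [s cs] := perm_of_cycle_type mu; have := none s; rewrite cs eqxx.
rewrite /= chi_Theta.
set u := (s ^+ (p ^ n))%g.
have dvd_u : (p %| Theta (part al) u)%Z.
  set A := [set O in porbits u | #|O| == b].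
  have cardA : (p ^ e <= #|A|)%N by rewrite card_orbits_pstar // cs muK.
  apply: (Theta_merge pr_p (b := b) (e := e) (Os := take (p ^ e) (enum A))) => //.
  - by apply: take_uniq; apply: enum_uniq.
  - by rewrite size_takel // -cardE.
  - by move=> O /mem_take; rewrite mem_enum inE => /andP[].
  - by move=> O /mem_take; rewrite mem_enum inE => /andP[_ /eqP].
have dvd_s : (p %| Theta (part al) s)%Z.
  have := Theta_expg_mod (part al) pr_p s n; rewrite -/u => dv.
  by rewrite -[X in (_ %| X)%Z](subKr (Theta (part al) u)) rpredB.
have /dvdzP[z ->] := dvd_s.
by apply/dvdCP; exists z%:~R; rewrite ?intr_int // rmorphM.
Qed.

End CharacterValues.

(** * Counting the partitions that are not t-cores *)

(** [r] stands for an injection that is easier to describe as a relation, its values being known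
    only to exist. *)
Lemma leq_card_rel (S T : finType) (A : {set S}) (B : {set T}) (r : S -> T -> Prop) :
    (forall x, x \in A -> exists2 y, y \in B & r x y) ->
    (forall x1 x2 y, x1 \in A -> x2 \in A -> r x1 y -> r x2 y -> x1 = x2) ->
  #|A| <= #|B|.
Proof.
move=> rAB r_inj.
have [->|[x0 Ax0]] := set_0Vmem A; first by rewrite cards0.
have [y0 _ _] := rAB x0 Ax0.
have /fin_all_exists[f fP] : forall x, exists y, x \in A -> y \in B /\ r x y.
  move=> x; have [Ax|_] := boolP (x \in A); last by exists y0.
  by have [y By rxy] := rAB x Ax; exists y.
have f_inj : {in A &, injective f}.
  move=> x1 x2 A1 A2 eqf; have [_ r1] := fP _ A1; have [_ r2] := fP _ A2.
  by apply: r_inj r1 _ => //; rewrite eqf.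
rewrite -(card_in_imset f_inj); apply: subset_leq_card; apply/subsetP=> _ /imsetP[x Ax ->].
by have [] := fP x Ax.
Qed.

Lemma geq_trans : transitive geq.
Proof. by move=> y x z /= xy yz; apply: leq_trans yz xy. Qed.

Lemma geq_anti : antisymmetric geq.
Proof. by move=> x y; rewrite /= andbC; apply: anti_leq. Qed.

Lemma geq_total : total geq.
Proof. by move=> x y; apply: leq_total. Qed.

Lemma parts_inj n : injective (@parts n).
Proof. by move=> al be /(inj_map val_inj) /val_inj /val_inj. Qed.

Lemma intpart_exists m (s : seq nat) : 0 \notin s -> sumn s = m ->
  exists al : intpart m, parts al = sort geq s.
Proof.
move=> s_gt0 sum_s.
have perm_s := permEl (perm_sort geq s).
have le_sum (u : seq nat) x : x \in u -> x <= sumn u.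
  by elim: u => //= y u IH; rewrite inE => /orP[/eqP->|/IH]; lia.
have le_size (u : seq nat) : 0 \notin u -> size u <= sumn u.
  elim: u => //= y u IH; rewrite inE negb_or => /andP[y0 /IH].
  by case: y y0 => //= y _; lia.
have sz : size (map (@inord m) (sort geq s)) <= m.
  by rewrite size_map size_sort -sum_s le_size.
have valE : map val (Bseq sz) = sort geq s :> seq nat.
  rewrite /= -map_comp -[RHS]map_id; apply/eq_in_map => x; rewrite mem_sort => xs.
  by rewrite /= inordK // ltnS -sum_s le_sum.
have part_s : is_partition m (map val (Bseq sz)).
  rewrite valE /is_partition (sort_sorted geq_total) mem_sort s_gt0 /=.
  by rewrite (perm_sumn perm_s) sum_s.
by exists (exist _ (Bseq sz) part_s).
Qed.

Definition pn n := #|{: intpart n}|.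

Lemma pn_gt0 n : 0 < pn n.
Proof.
have [||al _] := @intpart_exists n (nseq n 1); last by apply/card_gt0P; exists al.
- by rewrite mem_nseq andbF.
by rewrite sumn_nseq mul1n.
Qed.

Lemma perm_parts_eq n (al be : intpart n) : perm_eq (parts al) (parts be) -> al = be.
Proof.
move=> eqp; apply: parts_inj; apply: (sorted_eq geq_trans geq_anti) => //;
exact: parts_sorted.
Qed.

Lemma card_count_ge n v k : 0 < v -> k * v <= n ->
  #|[set al : intpart n | k <= count_mem v (parts al)]| = pn (n - k * v).
Proof.
move=> v_gt0 kv; set r := fun (al : intpart n) (be : intpart (n - k * v)) =>
  perm_eq (parts al) (nseq k v ++ parts be).
rewrite /pn -cardsT; apply/eqP; rewrite eqn_leq; apply/andP; split.
  apply: (@leq_card_rel _ _ _ _ r) => [al|al1 al2 be _ _ r1 r2]; last first.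
    by apply: perm_parts_eq; rewrite (permPl r1) perm_sym.
  rewrite inE => kc.
  have perm_al : perm_eq (parts al)
      (nseq k v ++ (nseq (count_mem v (parts al) - k) v ++ filter (predC1 v) (parts al))).
    rewrite catA -nseqD subnKC // perm_sym.
    have /all_pred1P := filter_all (pred1 v) (parts al); rewrite size_filter => <-.
    exact: permEl (perm_filterC (pred1 v) (parts al)).
  have [||be beE] := @intpart_exists (n - k * v)
    (nseq (count_mem v (parts al) - k) v ++ filter (predC1 v) (parts al)).
  - have := parts_gt0 al; rewrite (perm_mem perm_al) mem_cat negb_or => /andP[] //.
  - have := parts_sumn al; rewrite (perm_sumn perm_al) sumn_cat sumn_nseq mulnC.
    by lia.
  exists be; rewrite ?inE // /r beE (permPl perm_al) perm_cat2l perm_sym.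
  exact: permEl (perm_sort _ _).
apply: (@leq_card_rel _ _ _ _ (fun be al => r al be)) => [be _|be1 be2 al _ _ r1 r2].
  have [||al alE] := @intpart_exists n (nseq k v ++ parts be).
  - rewrite mem_cat negb_or parts_gt0 andbT mem_nseq negb_and.
    by rewrite neq_ltn v_gt0 !orbT.
  - by rewrite sumn_cat sumn_nseq parts_sumn mulnC subnKC.
  have perm_al : r al be by rewrite /r alE; apply: permEl (perm_sort _ _).
  exists al => //; rewrite inE; have /seq.permP -> := perm_al.
  by rewrite count_cat count_nseq /= eqxx mul1n leq_addr.
apply: perm_parts_eq; rewrite -(perm_cat2l (nseq k v)) -(permPl r1).
exact: r2.
Qed.

(** In each partition, [n] is the sum of [v] times the multiplicity of [v], and a multiplicity is
    the number of [k >= 1] not exceeding it; exchanging the sums leaves [card_count_ge]. Grouped by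
    [m = k * v], this is the recurrence with the sum of divisors. *)
Lemma pn_rec n : n * pn n =
  \sum_(1 <= v < n.+1) \sum_(1 <= k < n.+1 | k * v <= n) v * pn (n - k * v).
Proof.
transitivity (\sum_(al : intpart n) \sum_(1 <= v < n.+1) v * count_mem v (parts al)).
  transitivity (\sum_(al : intpart n) n).
    by rewrite sum_nat_const mulnC.
  apply: eq_bigr => al _; rewrite -[LHS](parts_sumn al).
  have : all (fun x => 0 < x <= n) (parts al).
    apply/allP=> x xal; rewrite lt0n (contraNneq _ (parts_gt0 al)) => [|<-] //=.
    by have /mapP[y _ ->] := xal; rewrite -ltnS ltn_ord.
  elim: (parts al) => /= [_|x s IHs /andP[xn /IHs ->]].
    by rewrite big1 // => v _; rewrite muln0.
  under [RHS]eq_bigr do rewrite mulnDr.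
  rewrite big_split /=; congr (_ + _).
  rewrite (bigD1_seq x) ?mem_index_iota ?iota_uniq //= eqxx muln1 big1 ?addn0 //.
  by move=> v /negPf nv; rewrite eq_sym nv muln0.
have count_le (al : intpart n) v : 0 < v -> count_mem v (parts al) * v <= n.
  move=> v_gt0; rewrite -[leqRHS](parts_sumn al); elim: (parts al) => //= x s IHs.
  by rewrite mulnDl leq_add //; case: eqP => [->|]; rewrite ?mul1n.
have countE (al : intpart n) v : 0 < v ->
    count_mem v (parts al) = \sum_(1 <= k < n.+1) (k <= count_mem v (parts al)).
  move=> v_gt0; have := count_le al v v_gt0; set c := count_mem _ _ => cn.
  have {}cn : c <= n by apply: leq_trans cn; apply: leq_pmulr.
  rewrite (@big_cat_nat _ _ _ c.+1) //= ?ltnS //= [X in _ = _ + X]big1_seq ?addn0.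
    rewrite [RHS]big_nat (eq_bigr (fun=> 1)) => [|k /andP[_ kc]]; last first.
      by rewrite -ltnS kc.
    by rewrite -big_nat sum_nat_const_nat muln1 subn1.
  move=> k /andP[_]; rewrite mem_index_iota => /andP[ck _].
  by rewrite leqNgt ck.
rewrite exchange_big /= [LHS]big_nat [RHS]big_nat; apply: eq_bigr => v /andP[v_gt0 _].
under eq_bigr do rewrite countE // big_distrr /=.
rewrite exchange_big [RHS]big_mkcond /=; apply: eq_bigr => k _.
rewrite -big_distrr /=; case: ifP => [kv|kv].
  rewrite -(card_count_ge v_gt0 kv) -sum1_card [in RHS]big_mkcond /=.
  by congr (_ * _); apply: eq_bigr => al _; rewrite inE; case: leq.
rewrite big1 ?muln0 // => al _; apply/eqP; rewrite eqb0; apply/negP=> kc.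
by move/negP: kv; apply; apply: leq_trans (count_le al v v_gt0); rewrite leq_mul2r kc orbT.
Qed.

Lemma nth_filter_pos (s : seq nat) i : sorted geq s ->
  nth 0 (filter (leq 1) s) i = nth 0 s i.
Proof.
elim: s i => //= x s IHs i srt; case: ifP => [x0|]; last first.
  case: x srt => // srt _.
  have s0 : all (pred1 0) s.
    by apply: sub_all (order_path_min geq_trans srt) => y /=; rewrite leqn0.
  have -> : filter (leq 1) s = [::].
    apply/eqP; rewrite -[_ == _]negbK -has_filter; apply/hasPn=> y /(allP s0)/eqP->.
    by [].
  case: i => [|i] //=; have [lt|ge] := ltnP i (size s).
    by apply/esym/eqP; apply: (allP s0); apply: mem_nth.
  by rewrite nth_default.
by case: i => //= i; apply: IHs; apply: path_sorted srt.
Qed.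

(** * Bead sets and rim hooks of length t *)

Section BeadCounting.

Variable n : nat.

Definition beads (a : nat -> nat) : seq nat := [seq bead a i | i <- enum 'I_n].

Lemma part_sum_ge m (al : intpart m) : m <= n -> \sum_(i < n) part al i = m.
Proof.
move=> mn; rewrite -[RHS](part_sum al) (big_ord_widen n (part al) mn).
rewrite [RHS]big_mkcond; apply: eq_bigr => i _; case: ltnP => // mi.
exact: part_supp.
Qed.

Lemma bead_lt (a : nat -> nat) (i j : 'I_n) : (forall i j, i <= j -> a j <= a i) ->
  i < j -> bead a j < bead a i.
Proof.
by move=> mono ij; have := mono _ _ (ltnW ij); have := ltn_ord j; rewrite /bead /=; lia.
Qed.

Lemma bead_inj (a : nat -> nat) : (forall i j, i <= j -> a j <= a i) ->
  injective (@bead n a).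
Proof.
move=> mono i j eqb; apply: val_inj; case: (ltngtP i j) => // /(bead_lt mono);
by rewrite eqb ltnn.
Qed.

Lemma beads_uniq (a : nat -> nat) : (forall i j, i <= j -> a j <= a i) -> uniq (beads a).
Proof. by move=> /bead_inj inj; rewrite map_inj_uniq ?enum_uniq. Qed.

Lemma beads_sorted (a : nat -> nat) : (forall i j, i <= j -> a j <= a i) ->
  sorted geq (beads a).
Proof.
move=> mono.
have -> : beads a = [seq a i + (n - i.+1) | i <- map val (enum 'I_n)].
  by rewrite -map_comp.
rewrite val_enum_ord; apply: (homo_sorted (e := leq)) (iota_sorted 0 n) => i j ij /=.
by have := mono _ _ ij; lia.
Qed.

Lemma size_beads a : size (beads a) = n.
Proof. by rewrite size_map size_enum_ord. Qed.

Lemma sumn_beads a : sumn (beads a) = \sum_(i < n) a i + \sum_(i < n) rev_ord i.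
Proof. by rewrite sumnE big_map big_enum /= big_split. Qed.

Lemma beads_inj m (al be : intpart m) : m <= n ->
  perm_eq (beads (part al)) (beads (part be)) -> al = be.
Proof.
move=> mn eqp; have eqb : beads (part al) = beads (part be).
  by apply: (sorted_eq geq_trans geq_anti) => //; apply: beads_sorted; apply: part_mono.
have eqn (i : nat) : part al i = part be i.
  have [lt|ge] := ltnP i n; last by rewrite !part_supp ?(leq_trans mn).
  have := congr1 (fun s => nth 0 s i) eqb.
  rewrite !(nth_map (Ordinal lt)) -?enumT ?size_enum_ord //.
  by rewrite /bead nth_enum_ord // => /addIn.
apply: parts_inj; apply: (@eq_from_nth _ 0) => [|i _]; last exact: eqn.
have size_le (u v : intpart m) : (forall i, part u i = part v i) ->
    size (parts u) <= size (parts v).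
  move=> equv; rewrite leqNgt; apply/negP=> lt; have := parts_gt0 u.
  by rewrite -(nth_default 0 (leqnn (size (parts v)))) -[nth _ _ _]equv mem_nth.
by apply/eqP; rewrite eqn_leq !size_le.
Qed.

(** Sorted decreasingly and reduced by the staircase [n - 1, ..., 0], the list [L] becomes weakly
    decreasing; without its zeros it is the partition. *)
Lemma beads_exist m (L : seq nat) : m <= n -> uniq L -> size L = n ->
    sumn L = m + \sum_(i < n) rev_ord i ->
  exists al : intpart m, perm_eq (beads (part al)) L.
Proof.
move=> mn uL szL sumL; set s := sort geq L.
have perm_s : perm_eq s L := permEl (perm_sort geq L).
have sz : size s = n by rewrite size_sort.
have srt : sorted gtn s.
  have := sort_sorted geq_total L; rewrite -/s.
  have := uL; rewrite -(perm_uniq perm_s).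
  elim: (s) => //= x [|y u] IH //= /andP[nx nu] /andP[xy yu].
  apply/andP; split; last exact: IH.
  rewrite ltn_neqAle xy andbT.
  by apply: contraNneq nx => ->; rewrite mem_head.
have s_step i j : i <= j -> j < n -> nth 0 s j + (j - i) <= nth 0 s i.
  elim: j => [|j IHj]; first by rewrite leqn0 => /eqP-> _; rewrite subnn addn0.
  rewrite leq_eqVlt => /orP[/eqP<- _|ij jn]; first by rewrite subnn addn0.
  have := IHj ij (ltnW jn).
  have : nth 0 s j.+1 < nth 0 s j.
    have gtn_trans : transitive gtn by move=> y x z /= xy yz; apply: ltn_trans yz xy.
    by apply: (sorted_ltn_nth gtn_trans 0 srt); rewrite ?inE ?sz ?(ltnW jn) //.
  by lia.
pose a i := nth 0 s i - (n - i.+1).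
have s_ge i : i < n -> n - i.+1 <= nth 0 s i.
  move=> lt; have := s_step i n.-1; have := lt; lia.
pose P := mkseq a n.
have P_sorted : sorted geq P.
  apply: (homo_sorted_in (e := leq) (P := mem (iota 0 n))) (allss _) (iota_sorted 0 n) => i j.
  rewrite !mem_iota /= !add0n => lti ltj ij /=; rewrite /a.
  by have := s_step i j ij ltj; have := s_ge i lti; have := s_ge j ltj; lia.
have sumP : sumn (filter (leq 1) P) = m.
  have -> : sumn (filter (leq 1) P) = sumn P.
    by elim: P {P_sorted} => //= x u IH; case: x => //= x; rewrite IH.
  apply: (@addIn (\sum_(i < n) rev_ord i)); rewrite -sumL -(perm_sumn perm_s).
  have -> : sumn P = \sum_(i < n) a i.
    by rewrite sumnE big_map -{1}[n]subn0 -/(index_iota 0 n) big_mkord.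
  rewrite -big_split /= sumnE (big_nth 0) big_mkord sz.
  by apply: eq_bigr => i _; rewrite /a subnK // s_ge.
have [||al alE] := @intpart_exists m (filter (leq 1) P) => //.
  by rewrite mem_filter.
exists al; rewrite -(permPr perm_s).
have -> : beads (part al) = s; last exact: perm_refl.
apply: (@eq_from_nth _ 0) => [|i]; rewrite size_beads ?sz // => lt.
rewrite (nth_map (Ordinal lt)) ?size_enum_ord //.
have -> : nth (Ordinal lt) (enum 'I_n) i = Ordinal lt.
  by apply: val_inj; rewrite /= nth_enum_ord.
rewrite /bead /part alE (sorted_sort geq_trans); last exact: (sorted_filter geq_trans).
by rewrite nth_filter_pos // nth_mkseq // /a subnK // s_ge.
Qed.

(** Beads whose move up by [t] ends on a free position; such a move adds a rim hook of length [t],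
    and a move of a [removable] bead takes one away. *)
Definition movable (a : nat -> nat) t : {set 'I_n} :=
  [set i : 'I_n | [forall k : 'I_n, bead a k != bead a i + t]].

Definition removable (a : nat -> nat) t : {set 'I_n} :=
  [set i : 'I_n | (t <= bead a i) && [forall k : 'I_n, bead a k + t != bead a i]].

Section FixedBeads.

Variables (a : nat -> nat) (t : nat).
Hypothesis a_mono : forall i j, i <= j -> a j <= a i.

(** A bead with another one [t] below it makes the latter immovable. The remaining beads are
    removable or stand below position [t], and at most [t] do so. *)
Lemma card_movable : #|movable a t| <= t + #|removable a t|.
Proof.
pose E := [set k : 'I_n | (t <= bead a k) && [exists i : 'I_n, bead a i + t == bead a k]].
pose L := [set k : 'I_n | bead a k < t].
have cardE_le : #|E| <= #|~: movable a t|.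
  apply: (@leq_card_rel _ _ _ _ (fun k i => bead a i + t = bead a k)) => [k|k1 k2 i].
    rewrite inE => /andP[_ /existsP[i /eqP eqk]]; exists i => //.
    by rewrite !inE negb_forall; apply/existsP; exists k; rewrite negbK eqk.
  by move=> _ _ e1 e2; apply: (bead_inj a_mono); rewrite -e1 -e2.
have cardL : #|L| <= t.
  by apply: (leq_card_bounded (f := bead a)) => [i j _ _ /(bead_inj a_mono)|i]; rewrite ?inE.
have : n <= #|L| + #|removable a t| + #|E|.
  have cov : [set: 'I_n] \subset L :|: removable a t :|: E.
    apply/subsetP=> k _; rewrite !inE; case: ltnP => //= tk.
    by rewrite -negb_exists orNb.
  rewrite -[leqLHS]card_ord -cardsT (leq_trans (subset_leq_card cov)) //.
  rewrite (leq_trans (leq_card_setU _ _)) // leq_add2r.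
  exact: (leq_card_setU _ _).
have := cardsC (movable a t); rewrite card_ord; lia.
Qed.

(** The free positions [bead a j - t], for removable [j >= i], and the positions of the [n - i - 1]
    beads after [i] are distinct and all below [bead a i = a i + (n - i - 1)]. *)
Lemma removable_part i : i \in removable a t ->
  #|[set j in removable a t | i <= j]| <= a i.
Proof.
move=> iR; set A := [set j in removable a t | i <= j].
have t_gt0 : 0 < t.
  rewrite lt0n; apply: contraTneq iR => t0; rewrite inE negb_and; apply/orP; right.
  by rewrite negb_forall; apply/existsP; exists i; rewrite t0 addn0 negbK.
pose G := [set j : 'I_n | i < j].
have cardG : n - i.+1 <= #|G|.
  apply: (leq_card_onto (f := fun j : 'I_n => rev_ord j)) => c ltc.
  have cn : c < n by lia.
  exists (rev_ord (Ordinal cn)); last by rewrite rev_ordK.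
  by rewrite inE /=; lia.
suff le_ai : #|A| + #|G| <= bead a i.
  by rewrite -(leq_add2r (n - i.+1)) (leq_trans _ le_ai) // leq_add2l.
have AP j : j \in A -> [/\ t <= bead a j, forall k : 'I_n, bead a k + t <> bead a j & i <= j].
  rewrite !inE => /andP[/andP[tj /forallP nj] ij]; split=> // k; apply/eqP/nj.
pose s := [seq bead a j - t | j <- enum A] ++ [seq bead a j | j <- enum G].
have -> : #|A| + #|G| = size s by rewrite size_cat !size_map -!cardE.
rewrite -[leqRHS](size_iota 0); apply: uniq_leq_size.
  rewrite cat_uniq; apply/and3P; split.
  - rewrite map_inj_in_uniq ?enum_uniq // => j k; rewrite !mem_enum.
    move=> /AP[tj _ _] /AP[tk _ _] eqb; apply: (bead_inj a_mono); lia.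
  - apply/hasPn=> x /mapP[k _ ->]; apply/mapP=> -[j]; rewrite mem_enum => /AP[tj nj _].
    by move=> eqb; apply: (nj k); rewrite eqb subnK.
  by rewrite map_inj_uniq ?enum_uniq //; apply: bead_inj.
move=> x; rewrite mem_cat mem_iota add0n => /orP[] /mapP[j]; rewrite mem_enum.
  case/AP=> tj _ ij ->.
  have : bead a j <= bead a i.
    move: ij; rewrite leq_eqVlt => /orP[/eqP/val_inj->//|/(bead_lt a_mono)].
    exact: ltnW.
  by lia.
by rewrite inE => /(bead_lt a_mono) lt ->.
Qed.

(** Summed over the removable beads, [removable_part] bounds a triangular number by the size of the
    partition. *)
Lemma card_removable : #|removable a t| ^ 2 <= (\sum_(i < n) a i).*2.
Proof.
set Rm := removable a t.
have le_sum : \sum_(i in Rm) #|[set j in Rm | i <= j]| <= \sum_(i < n) a i.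
  rewrite [leqRHS](bigID (mem Rm)) /= (leq_trans _ (leq_addr _ _)) //.
  by apply: leq_sum => i iR; apply: removable_part.
have cardE (P : rel 'I_n) :
    \sum_(i in Rm) #|[set j in Rm | P i j]| = \sum_(i in Rm) \sum_(j in Rm) P i j.
  apply: eq_bigr => i _; rewrite -sum1_card big_mkcond [RHS]big_mkcond /=.
  by apply: eq_bigr => j _; rewrite inE; case: (j \in Rm); case: (P i j).
have: \sum_(i in Rm) #|[set j in Rm | i <= j]| + \sum_(i in Rm) #|[set j in Rm | j <= i]|
       >= #|Rm| ^ 2.
  rewrite -big_split /= expnS expn1 -sum_nat_const; apply: leq_sum => i iR.
  rewrite -(cardsID [set j : 'I_n | i <= j] Rm) leq_add //; apply: subset_leq_card;
  apply/subsetP=> j; rewrite !inE => /andP[].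
    by move=> -> ->.
  by rewrite -ltnNge => /ltnW-> ->.
suff -> : \sum_(i in Rm) #|[set j in Rm | j <= i]| = \sum_(i in Rm) #|[set j in Rm | i <= j]|.
  by rewrite addnn => h; apply: leq_trans h _; rewrite leq_double.
rewrite (cardE (fun i j : 'I_n => i <= j)) (cardE (fun i j : 'I_n => j <= i)).
by rewrite exchange_big.
Qed.

End FixedBeads.

(** Outside the cores some bead can move down by [t]; the partition is recovered from the resulting
    partition of [n - t] and the bead to move back up. *)
Lemma card_noncore t : 0 < t -> t <= n -> n < t ^ 2 ->
  #|[set al : intpart n | ~~ core n (part al) t]| <= 3 * t * pn (n - t).
Proof.
move=> t_gt0 tn nt2; set m := n - t; have mn : m <= n by apply: leq_subr.
pose B := [set y : intpart m * 'I_n | y.2 \in movable (part y.1) t].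
apply: (@leq_trans #|B|).
  pose r (al : intpart n) (y : intpart m * 'I_n) := perm_eq (beads (part al))
    ((bead (part y.1) y.2 + t) :: rem (bead (part y.1) y.2) (beads (part y.1))).
  apply: (@leq_card_rel _ _ _ _ r) => [al|al1 al2 y _ _ r1 r2]; last first.
    by apply: (beads_inj (leqnn n)); rewrite (permPl r1) perm_sym.
  rewrite inE negb_forall => /existsP[j]; rewrite negb_imply negb_exists.
  case/andP=> tj /forallP nj; set b := bead (part al) j in tj nj.
  have mono := @part_mono _ al; have uB := beads_uniq mono.
  have jB : b \in beads (part al) by apply: map_f; rewrite mem_enum.
  pose L := (b - t) :: rem b (beads (part al)).
  have notL : b - t \notin beads (part al).
    apply/mapP=> -[i _ eqb]; have := nj i.
    by rewrite -eqb subnK // eqxx.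
  have uL : uniq L.
    rewrite /= rem_uniq // andbT; apply: contra notL; exact: mem_rem.
  have szL : size L = n.
    by rewrite /= size_rem // size_beads prednK // (leq_ltn_trans _ (ltn_ord j)).
  have perm_b := perm_to_rem jB.
  have sumL : sumn L = m + \sum_(i < n) rev_ord i.
    have := sumn_beads (part al); rewrite (perm_sumn perm_b) (part_sum_ge _ (leqnn n)) /=.
    by rewrite /m; lia.
  have [be permL] := beads_exist mn uL szL sumL.
  have : b - t \in beads (part be) by rewrite (perm_mem permL) mem_head.
  case/mapP=> i _ eqi; exists (be, i).
    rewrite !inE /=; apply/forallP=> k; rewrite -eqi subnK //.
    have kB : bead (part be) k \in beads (part be) by apply: map_f; rewrite mem_enum.
    apply: contraTneq kB => ->; rewrite (perm_mem permL) inE negb_or.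
    rewrite mem_rem_uniq // !inE eqxx andbT.
    by rewrite neq_ltn; apply/orP; right; lia.
  rewrite /r /= -eqi subnK // (permPl perm_b) perm_cons perm_sym.
  rewrite -(perm_cons (b - t)) -(permPr permL) perm_sym.
  by apply: perm_to_rem; rewrite (perm_mem permL) mem_head.
rewrite -sum1_card (partition_big fst xpredT) //= mulnC /pn -sum_nat_const.
apply: leq_sum => be _.
apply: (@leq_trans #|movable (part be) t|).
  rewrite -sum1_card.
  rewrite (reindex_onto (fun i => (be, i)) snd) /=; last by case=> ? ? /andP[_ /eqP <-].
  by apply: eq_leq; apply: eq_bigl => i; rewrite inE /= !eqxx !andbT.
have mono := @part_mono _ be.
apply: leq_trans (card_movable t mono) _.
have := card_removable t mono; rewrite (part_sum_ge be mn).
(* [k ^ 2 <= 2 (n - t) < 2 t ^ 2] forces [k <= 2 t], whence [t + k <= 3 t]. *)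
set k := #|_| => k2; suff : k <= 2 * t by lia.
rewrite leqNgt; apply/negP=> lt; have : (2 * t) ^ 2 < k ^ 2 by rewrite ltn_exp2r.
by rewrite expnMn; lia.
Qed.

End BeadCounting.

(** * Asymptotics of the partition function *)

Module Asymptotics.

Import boolp classical_sets functions interval_inference topology.
Import normedtype derive realfun sequences.
Import Order.TTheory numFieldNormedType.Exports.
Local Open Scope ring_scope.

(** * Inequalities for hyperbolic functions *)

Section Calculus.
Variable R : realType.
Implicit Types (f df : R -> R) (x y : R).

Lemma mean_value f df x y : x < y -> (forall z, x <= z <= y -> is_derive z 1 f (df z)) ->
  exists2 z, x < z < y & f y - f x = df z * (y - x).
Proof.
move=> xy fd; have [||z] := @MVT R f df x y xy.
- by move=> z; rewrite in_itv /= => /andP[xz zy]; apply: fd; rewrite !ltW.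
- apply: derivable_within_continuous => z; rewrite in_itv /= => /fd dz.
  exact: ex_derive.
by rewrite in_itv /= => zi ->; exists z.
Qed.

Lemma ge0_of_derive f df : (forall x, is_derive x 1 f (df x)) -> f 0 = 0 ->
  (forall x, 0 <= x -> 0 <= df x) -> forall x, 0 <= x -> 0 <= f x.
Proof.
move=> fd f0 dge x; rewrite le_eqVlt => /orP[/eqP<-|x0]; first by rewrite f0.
have [z /andP[z0 _] /eqP] := mean_value x0 (fun z _ => fd z).
rewrite f0 !subr0 => /eqP->; apply: mulr_ge0; last exact: ltW.
exact/dge/ltW.
Qed.

Definition sh (x : R) := (expR x - expR (- x)) / 2.
Definition ch (x : R) := (expR x + expR (- x)) / 2.

Global Instance is_derive_sh x : is_derive x 1 sh (ch x).
Proof.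
by apply: is_derive_eq; rewrite /ch /GRing.scale /=; field.
Qed.

Global Instance is_derive_ch x : is_derive x 1 ch (sh x).
Proof.
by apply: is_derive_eq; rewrite /sh /GRing.scale /=; field.
Qed.

Lemma sh0 : sh 0 = 0.
Proof. by rewrite /sh oppr0 subrr mul0r. Qed.

Lemma ch0 : ch 0 = 1.
Proof. by rewrite /ch oppr0 expR0; field. Qed.

Lemma ch_ge1 x : 1 <= ch x.
Proof.
have E : expR x * expR (- x) = 1 by rewrite expRxMexpNx_1.
rewrite /ch; move: E (expR_gt0 x) (expR_gt0 (- x)).
move: (expR x) (expR (- x)) => u v uv u0 v0.
rewrite ler_pdivlMr // mul1r leNgt; apply/negP=> lt2.
have : 0 < (2 - (u + v)) * (2 + (u + v)) by apply: mulr_gt0; lra.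
have := sqr_ge0 (u - v); nra.
Qed.

Lemma sh_ge x : 0 <= x -> x <= sh x.
Proof.
move=> x0; rewrite -subr_ge0; move: x x0.
apply: (@ge0_of_derive (fun x => sh x - x) (fun x => ch x - 1)).
- by rewrite sh0 subr0.
by move=> y _; rewrite subr_ge0 ch_ge1.
Qed.

Lemma ch_ge x : 0 <= x -> 1 + x ^+ 2 / 2 <= ch x.
Proof.
move=> x0; rewrite -subr_ge0; move: x x0.
apply: (@ge0_of_derive (fun x => ch x - (1 + x ^+ 2 / 2)) (fun x => sh x - x)).
- by move=> y; apply: is_derive_eq; rewrite /GRing.scale /=; field.
- by rewrite ch0; field.
by move=> y y0; rewrite subr_ge0 sh_ge.
Qed.

Lemma sh_ge3 x : 0 <= x -> x + x ^+ 3 / 6 <= sh x.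
Proof.
move=> x0; rewrite -subr_ge0; move: x x0.
apply: (@ge0_of_derive (fun x => sh x - (x + x ^+ 3 / 6))
  (fun x => ch x - (1 + x ^+ 2 / 2))).
- by move=> y; apply: is_derive_eq; rewrite /GRing.scale /=; field.
- by rewrite sh0; field.
by move=> y y0; rewrite subr_ge0 ch_ge.
Qed.

Lemma sh_le x : 0 <= x -> sh x <= x * ch x.
Proof.
move=> x0; rewrite -subr_ge0; move: x x0.
apply: (@ge0_of_derive (fun x => x * ch x - sh x) (fun x => x * sh x)).
- by move=> y; apply: is_derive_eq; rewrite /GRing.scale /=; ring.
- by rewrite sh0 mul0r subr0.
by move=> y y0; rewrite mulr_ge0 // (le_trans y0) ?sh_ge.
Qed.

(* The derivative 3 ch (sh^2 - x^2) - x^3 sh is nonnegative because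
   sh^2 - x^2 >= x^4 / 3 and sh <= x ch. *)
Lemma sh3_ge x : 0 <= x -> x ^+ 3 * ch x <= sh x ^+ 3.
Proof.
move=> x0; rewrite -subr_ge0; move: x x0.
apply: (@ge0_of_derive (fun x => sh x ^+ 3 - x ^+ 3 * ch x)
  (fun x => 3 * ch x * (sh x ^+ 2 - x ^+ 2) - x ^+ 3 * sh x)).
- by move=> y; apply: is_derive_eq; rewrite /GRing.scale /=; ring.
- by rewrite sh0; ring.
move=> y y0; have s1 := sh_ge3 y0; have s2 := sh_le y0; have c1 := ch_ge1 y.
have e1 : y ^+ 4 / 3 <= sh y ^+ 2 - y ^+ 2.
  have h : (y + y ^+ 3 / 6) ^+ 2 <= sh y ^+ 2.
    have p0 : 0 <= y + y ^+ 3 / 6 by rewrite addr_ge0 // divr_ge0 // exprn_ge0.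
    by rewrite ler_sqr ?nnegrE // (le_trans p0).
  have : 0 <= y ^+ 6 by rewrite exprn_ge0.
  rewrite (_ : (y + y ^+ 3 / 6) ^+ 2 = y ^+ 2 + y ^+ 4 / 3 + y ^+ 6 / 36) in h;
    last by field.
  lra.
have y3 : 0 <= y ^+ 3 by rewrite exprn_ge0.
have e2 : y ^+ 3 * sh y <= y ^+ 4 * ch y.
  by rewrite (_ : y ^+ 4 * ch y = y ^+ 3 * (y * ch y)) ?ler_wpM2l //; ring.
have e3 : 3 * ch y * (y ^+ 4 / 3) <= 3 * ch y * (sh y ^+ 2 - y ^+ 2).
  by rewrite ler_wpM2l // mulr_ge0 // (le_trans ler01).
have e4 : 3 * ch y * (y ^+ 4 / 3) = y ^+ 4 * ch y by field.
lra.
Qed.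

Lemma cosh_lower x : 0 <= x -> x ^+ 2 <= expR x + expR (- x) - 2.
Proof. by move=> x0; have := ch_ge x0; rewrite /ch; lra. Qed.

Lemma ch2E x : ch x ^+ 2 = 1 + sh x ^+ 2.
Proof.
have E := expRxMexpNx_1 x; rewrite /ch /sh.
move: (expR x) (expR (- x)) E => u v E.
by transitivity (u * v + ((u - v) / 2) ^+ 2); [field | rewrite E].
Qed.

(* With y = x / 2 the left side is 4 sh(y)^2, and sh y <= y ch y is used twice. *)
Lemma cosh_upper x : 0 <= x -> expR x + expR (- x) - 2 <= x ^+ 2 + x ^+ 4 * expR x.
Proof.
move=> x0; pose y := x / 2; have y0 : 0 <= y by rewrite divr_ge0.
have E := expRxMexpNx_1 y; have v1 : expR (- y) <= expR y by rewrite ler_expR; lra.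
have e1 : expR x = expR y ^+ 2 by rewrite expr2 -expRD; congr expR; rewrite /y; field.
have e2 : expR (- x) = expR (- y) ^+ 2.
  by rewrite expr2 -expRD; congr expR; rewrite /y; field.
have s0 : 0 <= sh y by apply: le_trans (sh_ge y0).
have c0 : 0 <= ch y by apply: le_trans ler01 (ch_ge1 y).
have hs : sh y ^+ 2 <= (y * ch y) ^+ 2.
  by rewrite ler_sqr ?nnegrE ?sh_le //; apply: mulr_ge0.
have hc : ch y ^+ 2 <= expR x.
  by rewrite e1 ler_sqr ?nnegrE ?expR_ge0 // /ch; lra.
have -> : expR x + expR (- x) - 2 = 4 * sh y ^+ 2.
  by rewrite e1 e2 /sh -[X in _ - X](mulr1 2) -[X in 2 * X]E; field.
have h1 : 4 * (y * ch y) ^+ 2 = x ^+ 2 + x ^+ 2 * sh y ^+ 2.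
  by rewrite !(exprMn _ y) ch2E /y; field.
have h2 : x ^+ 2 * sh y ^+ 2 <= x ^+ 2 * (y * ch y) ^+ 2 by rewrite ler_wpM2l ?sqr_ge0.
have h3 : x ^+ 2 * (y * ch y) ^+ 2 = x ^+ 4 / 4 * ch y ^+ 2 by rewrite /y; field.
have h4 : x ^+ 4 / 4 * ch y ^+ 2 <= x ^+ 4 / 4 * expR x.
  by rewrite ler_wpM2l // divr_ge0 // exprn_ge0.
have h5 : 0 <= x ^+ 4 * expR x by rewrite mulr_ge0 ?exprn_ge0 ?expR_ge0.
clear -hs h1 h2 h3 h4 h5; lra.
Qed.

Lemma expRN_le x : 0 <= x -> expR (- x) <= 1 - x + x ^+ 2 / 2.
Proof.
move=> x0; rewrite -subr_ge0; move: x x0.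
apply: (@ge0_of_derive (fun x => 1 - x + x ^+ 2 / 2 - expR (- x))
  (fun x => expR (- x) - (1 - x))).
- by move=> y; apply: is_derive_eq; rewrite /GRing.scale /=; field.
- by rewrite oppr0 expR0; field.
by move=> y _; rewrite subr_ge0 expR_ge1Dx.
Qed.

End Calculus.

(** * The sum of the inverse squares, with an explicit error *)

Section Basel.
Variable R : realType.
Local Notation pi := (@pi R).

Lemma sin_le (x : R) : 0 <= x -> sin x <= x.
Proof.
move=> x0; rewrite -subr_ge0; move: x x0.
apply: (@ge0_of_derive _ (fun x => x - sin x) (fun x => 1 - cos x)).
- by rewrite sin0 subr0.
by move=> y _; rewrite subr_ge0 cos_le1.
Qed.

Lemma mul_cos_le (x : R) : 0 < x < pi / 2 -> x * cos x <= sin x.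
Proof.
move=> /andP[x0 xpi]; rewrite -subr_ge0.
have d (z : R) : is_derive z 1 (fun x : R => sin x - x * cos x) (z * sin z).
  by apply: is_derive_eq; rewrite /GRing.scale /=; ring.
have [z /andP[z0 zx] /eqP] := mean_value x0 (fun z _ => d z).
rewrite sin0 mul0r !subr0 => /eqP ->; rewrite !mulr_ge0 ?(ltW x0) ?(ltW z0) //.
by rewrite sin_ge0_pi // ltW //=; have := pi_gt0 R; lra.
Qed.

Lemma sinV2_bounds (x : R) : 0 < x < pi / 2 ->
  x ^- 2 <= (sin x) ^- 2 <= 1 + x ^- 2.
Proof.
move=> xi; have /andP[x0 xpi] := xi.
have s0 : 0 < sin x by apply: sin_gt0_pihalf.
have c0 : 0 < cos x by apply: cos_gt0_pihalf; rewrite xpi andbT; have := pi_gt0 R; lra.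
have s1 := sin_le (ltW x0); have s2 := mul_cos_le xi.
have sc := cos2Dsin2 x.
have x20 : 0 < x ^+ 2 by rewrite exprn_gt0.
have s20 : 0 < sin x ^+ 2 by rewrite exprn_gt0.
apply/andP; split; first by rewrite lef_pV2 ?posrE // ler_sqr ?nnegrE // ltW.
have -> : (sin x) ^- 2 = 1 + (cos x / sin x) ^+ 2.
  transitivity ((cos x ^+ 2 + sin x ^+ 2) / sin x ^+ 2); first by rewrite sc mul1r.
  by field; rewrite gt_eqF.
have q0 : 0 <= cos x / sin x by rewrite divr_ge0 // ltW.
have i0 : 0 <= x^-1 by rewrite invr_ge0 ltW.
rewrite lerD2l -exprVn ler_sqr ?nnegrE //.
by rewrite ler_pdivrMr // mulrC ler_pdivlMr // mulrC.
Qed.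

(** The odd multiples of [pi / 2 ^ (N + 2)] below [pi / 2]. Their halves and the complements of
    these halves are the angles of level [N + 1]. *)
Definition angle N (k : nat) : R := (2 * k%:R + 1) * pi / 2 ^+ N.+2.

Lemma angle_itv N k : (k < 2 ^ N)%N -> 0 < angle N k < pi / 2.
Proof.
move=> kN; have p0 := pi_gt0 R; have t0 : 0 < 2 ^+ N.+2 :> R by rewrite exprn_gt0.
have k0 : 0 <= k%:R :> R by [].
apply/andP; split; first by rewrite /angle divr_gt0 // mulr_gt0 //; lra.
rewrite /angle ltr_pdivrMr // mulrAC ltr_pdivlMr // mulrAC [pi * _]mulrC ltr_pM2r //.
have : k%:R + 1 <= 2 ^+ N :> R by rewrite natr1 -natrX ler_nat.
by rewrite !exprS; lra.
Qed.

(** Induction through [1 / sin^2 x + 1 / cos^2 x = 4 / sin^2 (2 x)], each angle being paired with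
    its complement. *)
Lemma sum_sinV2 N : \sum_(k < 2 ^ N) (sin (angle N k)) ^- 2 = 2 * 4 ^+ N.
Proof.
elim: N => [|N IHN].
  rewrite expn0 big_ord1 expr0 mulr1 /=; set x := angle 0 0.
  have e : x *+ 2 = pi / 2 by rewrite -mulr_natr /x /angle; field.
  have s2c2 := cos2Dsin2 x; have c2 := cos_mulr2n x.
  rewrite e cos_pihalf -mulr_natr in c2.
  have -> : sin x ^+ 2 = 2^-1 by lra.
  by rewrite invrK.
have -> : (2 ^ N.+1 = 2 ^ N + 2 ^ N)%N by rewrite expnS mul2n addnn.
rewrite big_split_ord /= [X in _ + X](reindex_inj rev_ord_inj) -big_split /=.
have -> : 2 * 4 ^+ N.+1 = 4 * (2 * 4 ^+ N) :> R by rewrite exprS; ring.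
rewrite -IHN mulr_sumr; apply: eq_bigr => k _.
have /andP[x0 xpi] := angle_itv (ltn_ord k); have := pi_gt0 R => p0.
set x := angle N.+1 k.
have e2 : angle N k = x *+ 2.
  by rewrite -mulr_natr /x /angle [2 ^+ N.+3]exprS; field; rewrite ?expf_neq0.
have xi : 0 < x < pi / 2 by move: x0 xpi; rewrite e2 mulr2n => ? ?; apply/andP; lra.
have -> : angle N.+1 (2 ^ N + (2 ^ N - k.+1))%N = pi / 2 - x.
  rewrite /x /angle natrD natrB ?ltn_ord // natrX -natr1 !exprS; field.
  by rewrite expf_neq0.
have -> : sin (pi / 2 - x) = cos x.
  by rewrite sinB sin_pihalf cos_pihalf mul1r mul0r subr0.
have s0 : 0 < sin x by apply: sin_gt0_pihalf.
have c0 : 0 < cos x.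
  by apply: cos_gt0_pihalf; move/andP: xi => [? ->]; rewrite andbT; lra.
have e3 : sin (x *+ 2) = 2 * cos x * sin x by rewrite sin_mulr2n mulr2n; ring.
have sc := cos2Dsin2 x; rewrite e2 e3.
transitivity ((cos x ^+ 2 + sin x ^+ 2) * (cos x * sin x) ^- 2).
  by field; rewrite !gt_eqF.
by rewrite sc; field; rewrite !gt_eqF.
Qed.

Definition odd_sum M : R := \sum_(k < M) (2 * k%:R + 1) ^- 2.
Definition zeta_sum M : R := \sum_(k < M) (k.+1%:R) ^- 2.

Lemma angleV2 N k : (angle N k) ^- 2 = 16 * 4 ^+ N / pi ^+ 2 * (2 * k%:R + 1) ^- 2.
Proof.
have p0 := pi_gt0 R; have k0 : 0 <= k%:R :> R by rewrite ler0n.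
have t0 : 2 * k%:R + 1 != 0 :> R by rewrite gt_eqF //; lra.
rewrite /angle; have -> : 4 ^+ N = 2 ^+ N * 2 ^+ N :> R.
  by rewrite -exprMn -natrM.
move: p0; move: pi => q q0; rewrite !exprS; field.
by rewrite t0 gt_eqF // expf_neq0.
Qed.

(** Replacing [1 / sin^2] by [1 / x^2] costs at most 1 in each of the [2 ^ N] terms, against a total
    of [2 * 4 ^ N]. *)
Lemma odd_sum_bounds N :
  pi ^+ 2 / 8 - pi ^+ 2 / 16 / 2 ^+ N <= odd_sum (2 ^ N) <= pi ^+ 2 / 8.
Proof.
have p0 : 0 < pi ^+ 2 by rewrite exprn_gt0 ?pi_gt0.
have f0 : 0 < 4 ^+ N :> R by rewrite exprn_gt0.
set c := 16 * 4 ^+ N / pi ^+ 2; have c0 : 0 < c by rewrite divr_gt0 // mulr_gt0.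
have cE : c * odd_sum (2 ^ N) = \sum_(k < 2 ^ N) (angle N k) ^- 2.
  by rewrite /odd_sum mulr_sumr; apply: eq_bigr => k _; rewrite angleV2.
apply/andP; split.
  rewrite -(ler_pM2l c0) cE.
  have : 2 * 4 ^+ N <= \sum_(k < 2 ^ N) (1 + (angle N k) ^- 2).
    rewrite -sum_sinV2; apply: ler_sum => k _.
    by have /sinV2_bounds/andP[] := angle_itv (ltn_ord k).
  rewrite big_split /= sumr_const card_ord natrX.
  have -> : c * (pi ^+ 2 / 8 - pi ^+ 2 / 16 / 2 ^+ N) = 2 * 4 ^+ N - 2 ^+ N.
    rewrite /c; have -> : 4 ^+ N = 2 ^+ N * 2 ^+ N :> R by rewrite -exprMn -natrM.
    have q0 := pi_gt0 R; move: q0; move: pi => q q0; field.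
    by rewrite ?expf_neq0 ?gt_eqF ?exprn_gt0.
  by lra.
rewrite -(ler_pM2l c0) cE.
have -> : c * (pi ^+ 2 / 8) = 2 * 4 ^+ N.
  by rewrite /c; have := pi_gt0 R; move: pi => q q0; field; rewrite gt_eqF.
rewrite -sum_sinV2; apply: ler_sum => k _.
by have /sinV2_bounds/andP[] := angle_itv (ltn_ord k).
Qed.

Lemma zeta_sumS M : zeta_sum M.+1 = zeta_sum M + (M.+1%:R) ^- 2.
Proof. exact: big_ord_recr. Qed.

Lemma odd_sumS M : odd_sum M.+1 = odd_sum M + (2 * M%:R + 1) ^- 2.
Proof. exact: big_ord_recr. Qed.

Lemma zeta_sum_double M : zeta_sum M.*2 = odd_sum M + zeta_sum M / 4.
Proof.
elim: M => [|M IHM].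
  by rewrite /zeta_sum /odd_sum !big_ord0 mul0r addr0.
rewrite doubleS !zeta_sumS odd_sumS IHM.
have -> : M.*2.+1%:R = 2 * M%:R + 1 :> R by rewrite -natr1 -mul2n natrM.
have -> : M.*2.+2%:R = 2 * M.+1%:R :> R by rewrite -natrM mul2n doubleS.
have k0 : 0 <= M%:R :> R by rewrite ler0n.
have t0 : 2 * M%:R + 1 != 0 :> R by rewrite gt_eqF //; lra.
have t1 : M.+1%:R != 0 :> R by rewrite pnatr_eq0.
by move: M.+1%:R t1 => m t1; field; rewrite t0 t1.
Qed.

Lemma zeta_sum_homo M M' : (M <= M')%N -> zeta_sum M <= zeta_sum M'.
Proof.
move=> le; rewrite /zeta_sum -!(big_mkord xpredT (fun k => k.+1%:R ^- 2)).
rewrite [leRHS](big_cat_nat_idem _ _ (n := M)) //= ?addr0 //.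
by rewrite lerDl sumr_ge0 // => k _; rewrite invr_ge0 exprn_ge0.
Qed.

Lemma zeta_sum_le M : zeta_sum M <= pi ^+ 2 / 6.
Proof.
have h N : zeta_sum (2 ^ N) <= pi ^+ 2 / 6.
  have := zeta_sum_double (2 ^ N); have /andP[_ o] := odd_sum_bounds N.
  have := zeta_sum_homo (leq_addr (2 ^ N) (2 ^ N)); rewrite addnn; lra.
by apply: le_trans (h M); apply: zeta_sum_homo; apply/ltnW/ltn_expl.
Qed.

Lemma zeta_sum_ge N : pi ^+ 2 / 6 - pi ^+ 2 / 4 / 2 ^+ N <= zeta_sum (2 ^ N).
Proof.
elim: N => [|N IHN].
  rewrite /zeta_sum expn0 big_ord1 expr1n invr1 ?expr0.
  by have q0 : 0 <= pi ^+ 2; [rewrite sqr_ge0 | lra].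
rewrite expnS mul2n zeta_sum_double; have /andP[o _] := odd_sum_bounds N.
have -> : pi ^+ 2 / 4 / 2 ^+ N.+1 = pi ^+ 2 / 16 / 2 ^+ N + pi ^+ 2 / 4 / 2 ^+ N / 4.
  have : 2 ^+ N != 0 :> R by rewrite expf_neq0.
  by rewrite (exprS 2 N); move: (2 ^+ N) (pi ^+ 2) => u v u0; field.
lra.
Qed.

End Basel.

(** * The sum of [1 / sinh^2] by comparison with an integral *)

Section LambertSeries.
Variable R : realType.
Implicit Types (x y s d : R).
Local Notation pi := (@pi R).

(** [1 / sinh^2] without its pole at 0; its antiderivative [mcoth] is [1 / y - coth y]. As [csch2]
    is increasing, [d] times the sum of [csch2 (d k)] is close to its integral, which is [-1] and
    yields the term [- 1 / d]; the pole itself contributes the Basel sum. *)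
Definition csch2 y : R := (sh y) ^- 2 - y ^- 2.
Definition mcoth y : R := y^-1 - ch y / sh y.

Lemma sh_gt0 y : 0 < y -> 0 < sh y.
Proof. by move=> y0; apply: lt_le_trans y0 (sh_ge (ltW y0)). Qed.

Lemma mean_value_pos (f df : R -> R) x y : 0 < x -> x < y ->
    (forall z : R, 0 < z -> is_derive z 1 f (df z)) ->
  exists2 z, x < z < y & f y - f x = df z * (y - x).
Proof.
move=> x0 xy fd; apply: mean_value => // z /andP[xz _]; apply: fd.
exact: lt_le_trans xz.
Qed.

Lemma is_derive_csch2 y : 0 < y ->
  is_derive y 1 csch2 (2 * (y ^- 3 - ch y * (sh y) ^- 3)).
Proof.
move=> y0; have s0 := sh_gt0 y0.
rewrite /csch2.
have s1 : sh y ^+ 2 != 0 by rewrite expf_neq0 // gt_eqF.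
have y1 : y ^+ 2 != 0 by rewrite expf_neq0 // gt_eqF.
have h1 := @is_deriveV R (fun y => sh y ^+ 2) y 1 _ s1 _.
have h2 := @is_deriveV R (fun y => y ^+ 2) y 1 _ y1 _.
apply: is_derive_eq; rewrite /GRing.scale /=.
by field; rewrite ?gt_eqF.
Qed.

Lemma is_derive_mcoth y : 0 < y -> is_derive y 1 mcoth (csch2 y).
Proof.
move=> y0; have s0 := sh_gt0 y0.
rewrite /mcoth.
have s1 : sh y != 0 by rewrite gt_eqF.
have y1 : y != 0 by rewrite gt_eqF.
have h1 := @is_deriveV R (@sh R) y 1 _ s1 _.
have h2 := @is_deriveV R id y 1 _ y1 _.
apply: is_derive_eq; rewrite /GRing.scale /= /csch2.
transitivity ((ch y ^+ 2 - sh y ^+ 2) / sh y ^+ 2 - y ^- 2); first by field; rewrite s1 y1.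
by rewrite ch2E addrK mul1r.
Qed.

Lemma csch2_homo x y : 0 < x -> x < y -> csch2 x <= csch2 y.
Proof.
move=> x0 xy; have [z /andP[xz _] e] := mean_value_pos x0 xy is_derive_csch2.
have z0 := lt_trans x0 xz; have s0 := sh_gt0 z0.
rewrite -subr_ge0 e mulr_ge0 ?subr_ge0 ?(ltW xy) // mulr_ge0 // subr_ge0.
by rewrite ler_pdivrMr ?exprn_gt0 // mulrC ler_pdivlMr ?exprn_gt0 // mulrC sh3_ge // ltW.
Qed.

Lemma mcoth_step x y : 0 < x -> x < y ->
  (y - x) * csch2 x <= mcoth y - mcoth x <= (y - x) * csch2 y.
Proof.
move=> x0 xy; have [z /andP[xz zy] ->] := mean_value_pos x0 xy is_derive_mcoth.
have d0 : 0 < y - x by rewrite subr_gt0.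
by rewrite (mulrC (csch2 z)) !(ler_pM2l d0) !csch2_homo // (lt_trans x0).
Qed.

Lemma csch2_geN1 y : 0 < y -> -1 <= csch2 y.
Proof.
move=> y0; have s0 := sh_gt0 y0; rewrite /csch2 -subr_ge0.
have -> : sh y ^- 2 - y ^- 2 - -1 =
  ((y * ch y) ^+ 2 - sh y ^+ 2) / (y * sh y) ^+ 2.
  by rewrite !(exprMn _ y) ch2E; field; rewrite !gt_eqF.
apply: divr_ge0; last by rewrite exprn_ge0 // mulr_ge0 // ltW.
have c0 : 0 <= ch y by rewrite (le_trans ler01) ?ch_ge1.
have s2 := ltW s0; have y2 := ltW y0.
by rewrite subr_ge0 ler_sqr ?nnegrE ?sh_le // mulr_ge0.
Qed.

Lemma mcoth_le0 y : 0 < y -> mcoth y <= 0.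
Proof.
move=> y0; have s0 := sh_gt0 y0; rewrite /mcoth subr_le0 ler_pdivlMr //.
by rewrite mulrC ler_pdivrMr // mulrC sh_le // ltW.
Qed.

Lemma mcoth_geN1 y : 0 < y -> -1 <= mcoth y.
Proof.
move=> y0; have s0 := sh_gt0 y0; rewrite /mcoth -subr_ge0.
have -> : y^-1 - ch y / sh y - -1 = (sh y - y * (ch y - sh y)) / (y * sh y).
  by field; rewrite !gt_eqF.
apply: divr_ge0; last by rewrite mulr_ge0 // ltW.
have -> : ch y - sh y = expR (- y) by rewrite /ch /sh; field.
have E := expRxMexpNx_1 y; have e0 := expR_gt0 (- y).
have y1 := expR_ge1Dx (2 * y); have e2 : expR (2 * y) = expR y ^+ 2.
  by rewrite expr2 -expRD; congr expR; ring.
rewrite e2 in y1; rewrite /sh.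
move: (expR y) (expR (- y)) E e0 y1 => u v E v0 uu.
have : v * (1 + 2 * y) <= v * u ^+ 2 by rewrite ler_pM2l.
have -> : v * u ^+ 2 = u by rewrite expr2 mulrA [v * u]mulrC E mul1r.
lra.
Qed.

Lemma mcoth_le y : 0 < y -> mcoth y <= -1 + y^-1.
Proof.
move=> y0; have s0 := sh_gt0 y0; rewrite /mcoth addrC lerD2r lerN2.
rewrite ler_pdivlMr // mul1r /ch /sh; have := expR_gt0 (- y); lra.
Qed.

Lemma mcoth_geN y : 0 < y -> - y <= mcoth y.
Proof.
move=> y0; have s0 := sh_gt0 y0; rewrite /mcoth -subr_ge0.
have -> : y^-1 - ch y / sh y - - y = ((1 + y ^+ 2) * sh y - y * ch y) / (y * sh y).
  by field; rewrite !gt_eqF.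
apply: divr_ge0; last by rewrite mulr_ge0 // ltW.
rewrite subr_ge0.
have c0 : 0 <= ch y by rewrite (le_trans ler01) ?ch_ge1.
have p0 : 0 <= 1 + y ^+ 2 by rewrite addr_ge0 ?exprn_ge0 ?(ltW y0).
have s2 := ltW s0; have y2 := ltW y0.
rewrite -ler_sqr ?nnegrE; try by apply: mulr_ge0.
rewrite !(exprMn _ y) (exprMn _ (1 + y ^+ 2)) ch2E.
have : y ^+ 2 <= sh y ^+ 2 by rewrite ler_sqr ?nnegrE ?sh_ge ?ltW.
have : 0 <= y ^+ 2 by rewrite exprn_ge0 ?ltW.
have : 0 <= sh y ^+ 2 by rewrite exprn_ge0 ?ltW.
move: (y ^+ 2) (sh y ^+ 2) => u v *; nra.
Qed.

Lemma mcoth_stepn d M : 0 < d -> d * csch2 (d * M.+1%:R)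
  <= mcoth (d * M.+2%:R) - mcoth (d * M.+1%:R) <= d * csch2 (d * M.+2%:R).
Proof.
move=> d0; have := @mcoth_step (d * M.+1%:R) (d * M.+2%:R).
rewrite -mulrBr -(natr1 M.+1) [_ - M.+1%:R]addrC addKr mulr1.
by apply; rewrite ?mulr_gt0 // ltr_pM2l // ltrDl.
Qed.

Definition csch2_sum d M : R := \sum_(k < M) csch2 (d * k.+1%:R).

Lemma csch2_sum_le d M : 0 < d -> d * csch2_sum d M <= mcoth (d * M.+1%:R) - mcoth d.
Proof.
move=> d0; rewrite /csch2_sum; elim: M => [|M IHM].
  by rewrite big_ord0 mulr0 mulr1 subrr.
rewrite big_ord_recr mulrDr /=.
have /andP[h _] := mcoth_stepn M d0; lra.
Qed.

Lemma csch2_sum_ge d M : 0 < d ->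
  d * csch2 d + mcoth (d * M.+1%:R) - mcoth d <= d * csch2_sum d M.+1.
Proof.
move=> d0; rewrite /csch2_sum; elim: M => [|M IHM].
  by rewrite big_ord1 mulr1 addrK.
rewrite big_ord_recr [leRHS]mulrDr /=.
have /andP[_ h] := mcoth_stepn M d0; lra.
Qed.

Definition sh_sum d M : R := \sum_(k < M) (sh (d * k.+1%:R)) ^- 2.

Lemma sh_sumE d M : 0 < d -> sh_sum d M = csch2_sum d M + d ^- 2 * zeta_sum R M.
Proof.
move=> d0; rewrite /zeta_sum mulr_sumr -big_split /=; apply: eq_bigr => k _.
by rewrite /csch2 (exprMn _ d) (invfM (d ^+ 2)) subrK.
Qed.

Lemma sh_sum_le d M : 0 < d ->
  sh_sum d M <= pi ^+ 2 / 6 / d ^+ 2 - d^-1 + 1 + d ^- 2 / M.+1%:R.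
Proof.
move=> d0; rewrite sh_sumE // -subr_ge0 -(pmulr_rge0 _ d0).
have h1 := csch2_sum_le M d0; have m0 : 0 < d * M.+1%:R by rewrite mulr_gt0.
have h2 := mcoth_le m0; have h3 := mcoth_geN d0.
have h4 : d * (d ^- 2 * zeta_sum R M) <= d * (pi ^+ 2 / 6 / d ^+ 2).
  by rewrite ler_pM2l // mulrC ler_pM2r ?zeta_sum_le // invr_gt0 exprn_gt0.
have e1 : d * d^-1 = 1 by rewrite divff // gt_eqF.
have e2 : d * (d ^- 2 / M.+1%:R) = (d * M.+1%:R)^-1.
  have m1 : M.+1%:R != 0 :> R by rewrite pnatr_eq0.
  by move: M.+1%:R m1 => m m1; field; rewrite m1 gt_eqF.
move: (d ^- 2 * _) (_ / d ^+ 2) (d ^- 2 / _) h4 e2 => u v w h4 e2.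
by rewrite !(mulrDr, mulrN, mulr1) e1 e2; move: (csch2_sum d M) (mcoth d) (mcoth _) ((d *
  _)^-1) h1 h2 h3 h4 => a1 a2 a3 a4 h1 h2 h3 h4; clear -h1 h2 h3 h4; lra.
Qed.

Lemma sh_sum_ge d N : 0 < d ->
  pi ^+ 2 / 6 / d ^+ 2 - d^-1 - 1 - pi ^+ 2 / 4 / d ^+ 2 / 2 ^+ N <= sh_sum d (2 ^ N).
Proof.
move=> d0; rewrite sh_sumE // -subr_ge0 -(pmulr_rge0 _ d0).
have [M eM] : exists M, (2 ^ N)%N = M.+1 by exists (2 ^ N).-1; rewrite prednK // expn_gt0.
have h1 := csch2_sum_ge M d0; have m0 : 0 < d * M.+1%:R by rewrite mulr_gt0.
have h2 := mcoth_geN1 m0; have h3 := mcoth_le0 d0; have h5 := csch2_geN1 d0.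
have h4 : d * (d ^- 2 * (pi ^+ 2 / 6 - pi ^+ 2 / 4 / 2 ^+ N)) <= d * (d ^- 2 * zeta_sum R (2 ^ N)).
  by rewrite !ler_pM2l ?zeta_sum_ge // invr_gt0 exprn_gt0.
have e1 : d * d^-1 = 1 by rewrite divff // gt_eqF.
have e2 : d ^- 2 * (pi ^+ 2 / 6 - pi ^+ 2 / 4 / 2 ^+ N) =
  pi ^+ 2 / 6 / d ^+ 2 - pi ^+ 2 / 4 / d ^+ 2 / 2 ^+ N.
  have : 2 ^+ N != 0 :> R by rewrite expf_neq0.
  by move: (2 ^+ N) (pi ^+ 2) => u v u0; field; rewrite u0 gt_eqF.
rewrite e2 in h4; rewrite eM; rewrite eM in h4.
move: (_ / d ^+ 2) (_ / 2 ^+ N) (d ^- 2 * _) h4 => u v w h4.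
have h6 : d * -1 <= d * csch2 d by rewrite ler_pM2l.
by rewrite !(mulrDr, mulrN, mulr1) e1; lra.
Qed.

End LambertSeries.

(** Statements about all large truncations take the place of statements about infinite series. *)
Definition ultimately (P : nat -> Prop) := exists N, forall M, (N <= M)%N -> P M.

Lemma ultimately_and (P Q : nat -> Prop) : ultimately P -> ultimately Q -> ultimately (fun M =>
  P M /\ Q M).
Proof.
move=> [N1 h1] [N2 h2]; exists (maxn N1 N2) => M; rewrite geq_max => /andP[l1 l2].
by split; [apply: h1 | apply: h2].
Qed.

Lemma ultimately_imp (P Q : nat -> Prop) : (forall M, P M -> Q M) -> ultimately P -> ultimately Q.
Proof. by move=> PQ [N h]; exists N => M /h/PQ. Qed.

(** * The Lambert series of the sum of divisors and its moments *)

Section Moments.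
Variable R : realType.
Implicit Types (x y s d q : R) (F G : R -> R).
Local Notation pi := (@pi R).

(* Square truncation of the sum over m of sigma(m) F(m), sigma the sum of divisors. *)
Definition sigma_sum M F : R := \sum_(k < M) \sum_(v < M) v.+1%:R * F (k.+1 * v.+1)%N%:R.

Lemma sigma_sum_le M F G : (forall u, 0 < u -> F u <= G u) -> sigma_sum M F <= sigma_sum M G.
Proof.
move=> FG; apply: ler_sum => k _; apply: ler_sum => v _; rewrite ler_pM2l //.
by apply: FG; rewrite ltr0n muln_gt0.
Qed.

Lemma sigma_sum_eq M F G : F =1 G -> sigma_sum M F = sigma_sum M G.
Proof. by move=> FG; apply: eq_bigr => k _; apply: eq_bigr => v _; rewrite FG. Qed.

Lemma sigma_sumD M F G : sigma_sum M (fun u => F u + G u) = sigma_sum M F + sigma_sum M G.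
Proof.
rewrite /sigma_sum -big_split; apply: eq_bigr => k _; rewrite -big_split; apply: eq_bigr => v _.
exact: mulrDr.
Qed.

Lemma sigma_sumZ M x F : sigma_sum M (fun u => x * F u) = x * sigma_sum M F.
Proof.
rewrite /sigma_sum mulr_sumr; apply: eq_bigr => k _; rewrite mulr_sumr; apply: eq_bigr => v _.
exact: mulrCA.
Qed.

Lemma sigma_sumB M F G : sigma_sum M (fun u => F u - G u) = sigma_sum M F - sigma_sum M G.
Proof.
rewrite -mulN1r -sigma_sumZ -sigma_sumD; apply: sigma_sum_eq => u; by rewrite mulN1r.
Qed.

Lemma sigma_sum_homo M M' F : (M <= M')%N -> (forall u, 0 <= F u) ->
  sigma_sum M F <= sigma_sum M' F.
Proof.
move=> le F0; rewrite /sigma_sum (big_ord_widen _ (fun k =>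
  \sum_(v < M) v.+1%:R * F (k.+1 * v.+1)%N%:R) le).
rewrite big_mkcond; apply: ler_sum => k _; case: ifP => _; last first.
  by apply: sumr_ge0 => v _; rewrite mulr_ge0.
rewrite (big_ord_widen _ (fun v => v.+1%:R * F (k.+1 * v.+1)%N%:R) le).
by rewrite big_mkcond; apply: ler_sum => v _; case: ifP => // _; rewrite mulr_ge0.
Qed.

(** The inequality [y / j <= expR (y / j)], raised to the power [j]. *)
Lemma exprM_expRN_le j y : (0 < j)%N -> 0 <= y -> y ^+ j * expR (- y) <= j%:R ^+ j.
Proof.
move=> j0 y0; have j1 : 0 < j%:R :> R by rewrite ltr0n.
rewrite expRN ler_pdivrMr ?expR_gt0 //.
have -> : expR y = expR (y / j%:R) ^+ j.
  by rewrite -expRM_natl mulrCA divff ?mulr1 // gt_eqF.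
rewrite -exprMn lerXn2r ?nnegrE ?mulr_ge0 ?expR_ge0 //.
rewrite mulrC -ler_pdivrMr //; apply: le_trans (expR_ge1Dx _); lra.
Qed.

Lemma archi_div x e : 0 <= x -> 0 < e -> exists N, forall M, (N <= M)%N -> x / M.+1%:R <= e.
Proof.
move=> x0 e0; exists (Num.bound (x / e)) => M le.
have h : x / e < M.+1%:R.
  by apply: lt_le_trans (archi_boundP _) _; rewrite ?divr_ge0 ?(ltW e0) // ler_nat ltnW.
by rewrite ler_pdivrMr // mulrC -ler_pdivrMr // ltW.
Qed.

Lemma arith_geom q M :
  (1 - q) ^+ 2 * (\sum_(v < M) v.+1%:R * q ^+ v.+1) =
  q - M.+1%:R * q ^+ M.+1 + M%:R * q ^+ M.+2.
Proof.
elim: M => [|M IHM]; first by rewrite big_ord0; ring.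
rewrite big_ord_recr mulrDr IHM /= -!(natr1 _) !exprS; ring.
Qed.

(** With [q = expR (- 2 y)], the left side is the value of the series of [v q^v]: the inner sums of
    the Lambert series become multiples of [1 / sinh^2]. *)
Lemma geom_sh y : 0 < y -> expR (- (2 * y)) / (1 - expR (- (2 * y))) ^+ 2 = (sh y) ^- 2 / 4.
Proof.
move=> y0; have s0 := sh_gt0 y0.
have -> : expR (- (2 * y)) = expR (- y) ^+ 2 by rewrite expr2 -expRD; congr expR; ring.
move: s0; have := expRxMexpNx_1 y; rewrite /sh; move: (expR y) (expR (- y)) => u v E s0.
have v0 : v != 0 by apply/eqP => v0; move: E; rewrite v0 mulr0 => /eqP; rewrite eq_sym oner_eq0.
have -> : u = v^-1 by apply: (mulIf v0); rewrite E mulVf.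
have h : 1 - v ^+ 2 != 0.
  have -> : 1 - v ^+ 2 = v * (u - v) by rewrite mulrBr mulrC E expr2.
  by rewrite mulf_neq0 // gt_eqF; lra.
by field; rewrite v0 mulNr -expr2.
Qed.

Definition lambert s M := sigma_sum M (fun u => expR (- (s * u))).

Lemma lambertE s M : lambert s M = \sum_(k < M) \sum_(v < M) v.+1%:R * expR (- (s *
  k.+1%:R)) ^+ v.+1.
Proof.
apply: eq_bigr => k _; apply: eq_bigr => v _; rewrite -expRM_natl natrM.
by congr (_ * expR _); ring.
Qed.

Lemma q_lt1 y : 0 < y -> expR (- y) < 1.
Proof. by move=> y0; rewrite expR_lt1 oppr_lt0. Qed.

Lemma lambert_le_sh s M : 0 < s -> lambert s M <= sh_sum (s / 2) M / 4.
Proof.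
move=> s0; rewrite lambertE mulr_suml; apply: ler_sum => k _.
have k0 : 0 < s / 2 * k.+1%:R by rewrite mulr_gt0 // divr_gt0.
rewrite -geom_sh //; have -> : 2 * (s / 2 * k.+1%:R) = s * k.+1%:R by field.
have sk0 : 0 < s * k.+1%:R by rewrite mulr_gt0.
have := q_lt1 sk0; have := expR_gt0 (- (s * k.+1%:R)).
move: (expR _) => q q0 q1; rewrite ler_pdivlMr ?exprn_gt0 ?subr_gt0 // mulrC arith_geom.
have : M%:R * q ^+ M.+2 <= M.+1%:R * q ^+ M.+1.
  rewrite (exprS _ M.+1) mulrA ler_pM2r ?exprn_gt0 //.
  by rewrite -[leRHS]mulr1 ler_pM ?ler_nat ?(ltW q0) ?(ltW q1).
lra.
Qed.

(** Cutting an inner series at [M] loses at most [(M + 1) q^(M + 1) / (1 - q)^2], which is O(1 /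
    M^2) because the exponential beats a cube; over [M] rows this is O(1 / M). The constant 27 is
    [3 ^ 3] from [exprM_expRN_le]. *)
Lemma lambert_ge_sh s M : 0 < s ->
  sh_sum (s / 2) M / 4 - 27 / s ^+ 3 / (1 - expR (- s)) ^+ 2 / M.+1%:R <= lambert s M.
Proof.
move=> s0; set T := _ / M.+1%:R.
have m0 : 0 < M.+1%:R :> R by [].
have key : \sum_(k < M) ((sh (s / 2 * k.+1%:R)) ^- 2 / 4 - T / M.+1%:R) <= lambert s M.
  rewrite lambertE; apply: ler_sum => k _.
  have k0 : 0 < s / 2 * k.+1%:R by rewrite mulr_gt0 // divr_gt0.
  rewrite -geom_sh //; have -> : 2 * (s / 2 * k.+1%:R) = s * k.+1%:R by field.
  have sk0 : 0 < s * k.+1%:R by rewrite mulr_gt0.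
  have qq : expR (- (s * k.+1%:R)) <= expR (- s).
    by rewrite ler_expR lerN2 ler_peMr ?(ltW s0) // ler1n.
  have := q_lt1 sk0; have := expR_gt0 (- (s * k.+1%:R)); have q11 := q_lt1 s0.
  move: (expR (- (s * k.+1%:R))) qq => q qq q0 q1.
  have d0 : 0 < (1 - q) ^+ 2 by rewrite exprn_gt0 ?subr_gt0.
  have d1 : 0 < (1 - expR (- s)) ^+ 2 by rewrite exprn_gt0 ?subr_gt0.
  have dd : (1 - expR (- s)) ^+ 2 <= (1 - q) ^+ 2.
    by rewrite ler_sqr ?nnegrE ?subr_ge0 ?(ltW q1) ?(ltW q11) // lerD2l lerN2.
  have h1 : q / (1 - q) ^+ 2 - M.+1%:R * q ^+ M.+1 / (1 - q) ^+ 2 <=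
      \sum_(v < M) v.+1%:R * q ^+ v.+1.
    rewrite -mulrBl ler_pdivrMr // mulrC mulrC [leRHS]mulrC arith_geom lerDl.
    by rewrite mulr_ge0 // exprn_ge0 // ltW.
  apply: le_trans h1; rewrite lerD2l lerN2 /T.
  have h2 : q ^+ M.+1 <= 27 / s ^+ 3 / M.+1%:R ^+ 3.
    apply: (@le_trans _ _ (expR (- (s * M.+1%:R)))).
      have -> : - (s * M.+1%:R) = M.+1%:R * - s by ring.
      by rewrite expRM_natl lerXn2r ?nnegrE ?expR_ge0 // ltW.
    have sm : 0 < s * M.+1%:R by rewrite mulr_gt0.
    have := @exprM_expRN_le 3 _ isT (ltW sm); rewrite mulrC -ler_pdivlMr ?exprn_gt0 //.
    move/le_trans; apply; rewrite exprMn invfM mulrA -natrX; exact: lexx.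
  have -> : 27 / s ^+ 3 / (1 - expR (- s)) ^+ 2 / M.+1%:R / M.+1%:R =
    (M.+1%:R * (27 / s ^+ 3 / M.+1%:R ^+ 3)) / (1 - expR (- s)) ^+ 2.
    have w1 : 1 - expR (- s) != 0 by rewrite gt_eqF ?subr_gt0.
    move: (1 - _) w1 (M.+1%:R) m0 => w w0 m m0; field.
    by rewrite w0 !gt_eqF.
  apply: ler_pM.
  - by rewrite mulr_ge0 // exprn_ge0 // ltW.
  - by rewrite invr_ge0 ltW.
  - by rewrite ler_pM2l.
  - by rewrite lef_pV2 ?posrE.
apply: le_trans key; rewrite big_split /= sumr_const card_ord /sh_sum mulr_suml lerD2l.
rewrite mulNrn lerN2 -(mulr_natr (T / M.+1%:R)) -mulrA ler_piMr //.
  rewrite /T !divr_ge0 // exprn_ge0 ?(ltW s0) // subr_ge0 ltW ?q_lt1 //.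
by rewrite mulrC ler_pdivrMr // mul1r ler_nat.
Qed.

Definition lambert_main s : R := pi ^+ 2 / 6 / s ^+ 2 - (2 * s)^-1.

Lemma lambert_bounds s : 0 < s -> ultimately (fun M =>
  lambert_main s - 1 <= lambert s M <= lambert_main s + 1).
Proof.
move=> s0; have d0 : 0 < s / 2 by rewrite divr_gt0.
have e1 : pi ^+ 2 / 6 / (s / 2) ^+ 2 / 4 - (s / 2)^-1 / 4 = lambert_main s.
  by rewrite /lambert_main; move: pi => p; field; rewrite gt_eqF.
apply: ultimately_imp (fun M h => introT andP h) _; apply: ultimately_and; last first.
  have [N hN] := @archi_div ((s / 2) ^- 2) 1 (ltac:(by rewrite invr_ge0 exprn_ge0 // ltW)) ltr01.
  exists N => M le; apply: le_trans (lambert_le_sh M s0) _.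
  move: e1 (sh_sum_le M d0) (hN M le).
  move: (_ / (s / 2) ^+ 2) ((s / 2)^-1) (_ / M.+1%:R) (lambert_main s) (sh_sum _ _) =>
    a b c l S *; lra.
have T0 : 0 <= 27 / s ^+ 3 / (1 - expR (- s)) ^+ 2.
  by rewrite !divr_ge0 // exprn_ge0 ?(ltW s0) // subr_ge0 ltW ?q_lt1.
have q4 : (0 : R) < 1 / 4 by [].
have P0 : 0 <= pi ^+ 2 / 4 / (s / 2) ^+ 2 by rewrite !divr_ge0 ?sqr_ge0.
have [N1 h1] := archi_div T0 q4; have [N2 h2] := archi_div P0 q4.
have [N [lN1 lN2]] : exists N, (N1 <= N)%N /\ (N2 <= N)%N.
  by exists (maxn N1 N2); rewrite leq_maxl leq_maxr.
have lN : (N < 2 ^ N)%N by apply: ltn_expl.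
have le1 : (N1 <= 2 ^ N)%N by apply: leq_trans lN1 (ltnW lN).
have le2 : (N2 <= (2 ^ N).-1)%N by rewrite -ltnS prednK ?expn_gt0 // (leq_ltn_trans lN2).
have {}h1 := h1 _ le1; have {}h2 := h2 _ le2.
rewrite prednK ?expn_gt0 // natrX in h2.
(* The truncations increase with [M], so the lower bound is needed only at a power of 2, where
   [zeta_sum_ge] applies. *)
exists (2 ^ N)%N => M le.
have hm : lambert s (2 ^ N) <= lambert s M by apply: sigma_sum_homo => // u; exact: expR_ge0.
apply: le_trans hm; apply: le_trans (lambert_ge_sh (2 ^ N) s0).
move: e1 (sh_sum_ge N d0) h1 h2.
move: (_ / 2 ^+ N) (_ / (2 ^ N).+1%:R) => t1 t2.
move: (_ / (s / 2) ^+ 2) ((s / 2)^-1) (lambert_main s) (sh_sum _ _) => a b l S *; lra.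
Qed.

Definition lambert_moment j s M := sigma_sum M (fun u => u ^+ j * expR (- (s * u))).

Lemma lambert_main_le s : 0 < s -> lambert_main s <= pi ^+ 2 / 6 / s ^+ 2.
Proof. by move=> s0; rewrite /lambert_main gerBl invr_ge0 mulr_ge0 // ltW. Qed.

(** One half of the exponential absorbs [u ^ j] at the cost of [s ^ (- j)]; the other half leaves
    the series at [s / 2], of order [s ^ (- 2)]. *)
Lemma lambert_moment_le j : (0 < j)%N -> exists C, 0 < C /\ forall s, 0 < s -> s <= 1 ->
  ultimately (fun M => lambert_moment j s M <= C / s ^+ (j + 2)).
Proof.
move=> j0; pose D : R := (2 * j%:R) ^+ j; have D0 : 0 < D by rewrite exprn_gt0 ?mulr_gt0 ?ltr0n.
have p0 : 0 <= pi ^+ 2 by rewrite sqr_ge0.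
exists (D * (4 * (pi ^+ 2 / 6) + 1)); split; first by rewrite mulr_gt0 //; lra.
move=> s s0 s1; have d0 : 0 < s / 2 by rewrite divr_gt0.
apply: ultimately_imp (lambert_bounds d0) => M /andP[_ h].
apply: (@le_trans _ _ (D / s ^+ j * lambert (s / 2) M)).
  rewrite /lambert -sigma_sumZ; apply: sigma_sum_le => u u0.
  have su0 : 0 < s / 2 * u by rewrite mulr_gt0.
  have h2 := exprM_expRN_le j0 (ltW su0).
  have -> : expR (- (s * u)) = expR (- (s / 2 * u)) * expR (- (s / 2 * u)).
    by rewrite -expRD; congr expR; field.
  rewrite mulrA ler_pM2r ?expR_gt0 //.
  have -> : u ^+ j = (s / 2 * u) ^+ j * (2 ^+ j / s ^+ j).
    rewrite !exprMn exprVn; have : 2 ^+ j != 0 :> R by rewrite expf_neq0.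
    have : s ^+ j != 0 by rewrite expf_neq0 ?gt_eqF.
    by move: (2 ^+ j) (s ^+ j) (u ^+ j) => a b c b0 a0; field; rewrite a0 b0.
  have -> : D / s ^+ j = j%:R ^+ j * (2 ^+ j / s ^+ j).
    by rewrite /D (exprMn _ 2) mulrAC mulrC.
  rewrite mulrAC ler_pM2r //.
  by rewrite divr_gt0 // exprn_gt0.
have h2 : lambert (s / 2) M <= (4 * (pi ^+ 2 / 6) + 1) / s ^+ 2.
  have := lambert_main_le d0; have -> : pi ^+ 2 / 6 / (s / 2) ^+ 2 = 4 * (pi ^+ 2 / 6) / s ^+ 2.
    by move: pi => p; field; rewrite gt_eqF.
  have : 1 <= s ^- 2 by rewrite invf_ge1 ?exprn_gt0 // exprn_ile1 // ltW.
  rewrite (mulrDl _ 1) mul1r; move: h; set v := 4 * _ / _.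
  move: v (s ^- 2) (lambert _ _) (lambert_main _) => v w l l' *; lra.
rewrite exprD invfM mulrACA ler_pM2l //.
by rewrite divr_gt0 // exprn_gt0.
Qed.

Lemma lambert_moment1_le_diff s h M : 0 < h -> h * lambert_moment 1 s M <=
  lambert (s - h) M - lambert s M.
Proof.
move=> h0; rewrite -sigma_sumZ -sigma_sumB; apply: sigma_sum_le => u u0.
have -> : expR (- ((s - h) * u)) = expR (h * u) * expR (- (s * u)).
  by rewrite -expRD; congr expR; ring.
have := expR_ge1Dx (h * u); have := expR_gt0 (- (s * u)).
move: (expR (- (s * u))) => e e0.
move/(ler_wpM2l (ltW e0)); lra.
Qed.

Lemma lambert_moment1_ge_diff s h M : 0 < h -> lambert s M - lambert (s + h) M <=
  h * lambert_moment 1 s M.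
Proof.
move=> h0; rewrite -sigma_sumZ -sigma_sumB; apply: sigma_sum_le => u u0.
have -> : expR (- ((s + h) * u)) = expR (- (h * u)) * expR (- (s * u)).
  by rewrite -expRD; congr expR; ring.
have := expR_ge1Dx (- (h * u)); have := expR_gt0 (- (s * u)).
move: (expR (- (s * u))) => e e0.
move/(ler_wpM2l (ltW e0)); lra.
Qed.

Lemma lambert_moment2_le_diff s h M : 0 < h ->
  h ^+ 2 * lambert_moment 2 s M <= lambert (s + h) M + lambert (s - h) M - 2 * lambert s M.
Proof.
move=> h0; rewrite -!sigma_sumZ -sigma_sumD -sigma_sumB; apply: sigma_sum_le => u u0.
have -> : expR (- ((s - h) * u)) = expR (h * u) * expR (- (s * u)).
  by rewrite -expRD; congr expR; ring.
have -> : expR (- ((s + h) * u)) = expR (- (h * u)) * expR (- (s * u)).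
  by rewrite -expRD; congr expR; ring.
have hu0 : 0 <= h * u by rewrite mulr_ge0 // ltW.
have := cosh_lower hu0; have := expR_gt0 (- (s * u)); rewrite exprMn.
move: (expR (- (s * u))) (expR (h * u)) (expR (- (h * u))) (h ^+ 2) (u ^+ 2) => e f g x y e0 f0.
have : e * (x * y) <= e * (f + g - 2) by rewrite ler_pM2l.
lra.
Qed.

Lemma lambert_moment2_ge_diff s h M : 0 < h -> lambert (s + h) M + lambert (s - h) M - 2 *
  lambert s M <=
  h ^+ 2 * lambert_moment 2 s M + h ^+ 4 * lambert_moment 4 (s - h) M.
Proof.
move=> h0; rewrite -!sigma_sumZ -!sigma_sumD -sigma_sumB; apply: sigma_sum_le => u u0.
have -> : expR (- ((s - h) * u)) = expR (h * u) * expR (- (s * u)).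
  by rewrite -expRD; congr expR; ring.
have -> : expR (- ((s + h) * u)) = expR (- (h * u)) * expR (- (s * u)).
  by rewrite -expRD; congr expR; ring.
have hu0 : 0 <= h * u by rewrite mulr_ge0 // ltW.
have := cosh_upper hu0; have := expR_gt0 (- (s * u)); rewrite !exprMn.
move: (expR (- (s * u))) (expR (h * u)) (expR (- (h * u))) (h ^+ 2) (u ^+ 2) (h ^+ 4) (u ^+ 4) =>
  e f g x y z w e0 f0.
have : e * (f + g - 2) <= e * (x * y + z * w * f) by rewrite ler_pM2l.
lra.
Qed.

(** Difference quotients with step [h = s ^ 2]: the bounded error of [lambert_bounds] divided by [h]
    and the second-order term [h / s ^ 4] are then both of order [1 / s ^ 2]. *)
Lemma lambert_moment1_bounds : exists C, 0 < C /\ forall s, 0 < s -> s <= 1 / 4 ->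
  ultimately (fun M => 2 * (pi ^+ 2 / 6) / s ^+ 3 - C / s ^+ 2 <= lambert_moment 1 s M
               <= 2 * (pi ^+ 2 / 6) / s ^+ 3 + C / s ^+ 2).
Proof.
have p0 : 0 <= pi ^+ 2 / 6 by rewrite divr_ge0 ?sqr_ge0.
exists (6 * (pi ^+ 2 / 6) + 3); split; first by lra.
move=> s s0 s1; have h0 : 0 < s ^+ 2 by rewrite exprn_gt0.
have sm : 0 < s - s ^+ 2 by nra.
have sp : 0 < s + s ^+ 2 by lra.
apply: ultimately_imp (ultimately_and (lambert_bounds s0) (ultimately_and (lambert_bounds sm)
  (lambert_bounds sp))) => M.
move=> [/andP[l1 l2] [/andP[_ l3] /andP[_ l4]]].
have d1 := lambert_moment1_le_diff s M h0; have d2 := lambert_moment1_ge_diff s M h0.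
have sN : s != 0 by rewrite gt_eqF.
have i1 : (s - s ^+ 2) ^- 2 <= s ^- 2 + 2 / s + 6.
  have -> : s ^- 2 + 2 / s + 6 = (1 + 2 * s + 6 * s ^+ 2) / s ^+ 2 by field.
  rewrite ler_pdivlMr // mulrC ler_pdivrMr ?exprn_gt0 // -subr_ge0.
  have -> : (1 + 2 * s + 6 * s ^+ 2) * (s - s ^+ 2) ^+ 2 - s ^+ 2 =
    s ^+ 4 * (3 - 10 * s + 6 * s ^+ 2) by ring.
  by rewrite mulr_ge0 ?exprn_ge0 ?(ltW s0) //; lra.
have i2 : (s + s ^+ 2) ^- 2 <= s ^- 2 - 2 / s + 3.
  have -> : s ^- 2 - 2 / s + 3 = (1 - 2 * s + 3 * s ^+ 2) / s ^+ 2 by field.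
  rewrite ler_pdivlMr // mulrC ler_pdivrMr ?exprn_gt0 // -subr_ge0.
  have -> : (1 - 2 * s + 3 * s ^+ 2) * (s + s ^+ 2) ^+ 2 - s ^+ 2 =
    s ^+ 5 * (4 + 3 * s) by ring.
  by rewrite mulr_ge0 ?exprn_ge0 ?(ltW s0) //; lra.
have i3 : (2 * s)^-1 <= (2 * (s - s ^+ 2))^-1.
  by rewrite lef_pV2 ?posrE ?mulr_gt0 // ler_pM2l // gerBl ltW.
have i4 : (2 * s)^-1 - 1 / 2 <= (2 * (s + s ^+ 2))^-1.
  have -> : (2 * s)^-1 - 1 / 2 = (1 - s) / (2 * s) by field.
  rewrite ler_pdivrMr ?mulr_gt0 // mulrC ler_pdivlMr ?mulr_gt0 //.
  have : 0 <= s ^+ 3 by rewrite exprn_ge0 // ltW.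
  lra.
have j1 := ler_wpM2l p0 i1; have j2 := ler_wpM2l p0 i2.
rewrite -(ler_pM2l h0) -[(lambert_moment 1 s M <= _)](ler_pM2l h0).
have -> : s ^+ 2 * (2 * (pi ^+ 2 / 6) / s ^+ 3 - (6 * (pi ^+ 2 / 6) + 3) / s ^+ 2) =
  pi ^+ 2 / 6 * (2 / s) - 6 * (pi ^+ 2 / 6) - 3 by move: pi => p; field.
have -> : s ^+ 2 * (2 * (pi ^+ 2 / 6) / s ^+ 3 + (6 * (pi ^+ 2 / 6) + 3) / s ^+ 2) =
  pi ^+ 2 / 6 * (2 / s) + 6 * (pi ^+ 2 / 6) + 3 by move: pi => p; field.
move: d1 d2 j1 j2 i3 i4 l1 l2 l3 l4; rewrite /lambert_main.
move: (s ^+ 2 * lambert_moment 1 s M) (lambert _ M) (lambert _ M) (lambert _ M) => u v w z.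
move: (pi ^+ 2 / 6) p0 => A A0; rewrite !(mulrDr A) !(mulrN A).
move: (2 * s)^-1 (2 * (s - s ^+ 2))^-1 (2 * (s + s ^+ 2))^-1 => a1 a2 a3.
move: (A / _) (A / _) (A / _) (A * (2 / s)) => b1 b2 b3 b4 *.
by apply/andP; split; lra.
Qed.

(** Second differences at [s = q ^ 2] with step [h = q ^ 3]: the bounded error over [h ^ 2] and the
    fourth-order term [h ^ 2 / s ^ 6] are both of order [1 / q ^ 6]. The parameter [q] avoids the
    exponent 3/2. *)
Lemma lambert_moment2_bounds : exists C, 0 < C /\ forall q, 0 < q -> q <= 1 / 4 ->
  ultimately (fun M => 6 * (pi ^+ 2 / 6) / q ^+ 8 - C / q ^+ 6 <= lambert_moment 2 (q ^+ 2) M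
               <= 6 * (pi ^+ 2 / 6) / q ^+ 8 + C / q ^+ 6).
Proof.
have p0 : 0 <= pi ^+ 2 / 6 by rewrite divr_ge0 ?sqr_ge0.
have [C4 [C40 hC4]] := lambert_moment_le (isT : 0 < 4)%N.
exists (12 * (pi ^+ 2 / 6) + 6 + 64 * C4); split; first by lra.
move=> q q0 q1; have s0 : 0 < q ^+ 2 by rewrite exprn_gt0.
have h0 : 0 < q ^+ 3 by rewrite exprn_gt0.
have q2 : q ^+ 2 <= 1 / 16 by nra.
have h1 : q ^+ 3 <= q ^+ 2 / 4 by rewrite exprS; nra.
have sm : 0 < q ^+ 2 - q ^+ 3 by lra.
have sm1 : q ^+ 2 - q ^+ 3 <= 1 by lra.
have sp : 0 < q ^+ 2 + q ^+ 3 by lra.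
have w0 : 0 < 1 - q ^+ 2 by lra.
apply: ultimately_imp (ultimately_and (ultimately_and (lambert_bounds s0) (hC4 _ sm sm1))
  (ultimately_and (lambert_bounds sm) (lambert_bounds sp))) => M.
move=> [[/andP[l1 l2] f4] [/andP[l3 l4] /andP[l5 l6]]].
have d1 := lambert_moment2_le_diff (q ^+ 2) M h0; have d2 := lambert_moment2_ge_diff (q ^+ 2) M h0.
have qN : q != 0 by rewrite gt_eqF.
have zN : 1 - q ^+ 2 != 0 by rewrite gt_eqF.
have n1 : 1 + q != 0 by rewrite gt_eqF // addr_gt0.
have n2 : 1 - q != 0 by rewrite gt_eqF // subr_gt0 (le_lt_trans q1) //; lra.
have e1 : (q ^+ 2 + q ^+ 3) ^- 2 + (q ^+ 2 - q ^+ 3) ^- 2 - 2 / q ^+ 4 =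
  (6 - 2 * q ^+ 2) / (1 - q ^+ 2) ^+ 2 / q ^+ 2.
  have -> : 1 - q ^+ 2 = (1 + q) * (1 - q) by ring.
  have -> : q ^+ 2 + q ^+ 3 = q ^+ 2 * (1 + q) by ring.
  have -> : q ^+ 2 - q ^+ 3 = q ^+ 2 * (1 - q) by ring.
  by field; rewrite n1 n2 qN.
have e2 : (2 * (q ^+ 2 + q ^+ 3))^-1 + (2 * (q ^+ 2 - q ^+ 3))^-1 - 2 * (2 * q ^+ 2)^-1 =
  (1 - q ^+ 2)^-1.
  have -> : 1 - q ^+ 2 = (1 + q) * (1 - q) by ring.
  have -> : q ^+ 2 + q ^+ 3 = q ^+ 2 * (1 + q) by ring.
  have -> : q ^+ 2 - q ^+ 3 = q ^+ 2 * (1 - q) by ring.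
  by field; rewrite n1 n2 qN.
have i2 : (1 - q ^+ 2)^-1 <= 2 by rewrite invf_ple ?posrE //; clear -q2; lra.
have i20 : 0 < (1 - q ^+ 2)^-1 by rewrite invr_gt0.
have i1 : (6 - 2 * q ^+ 2) / (1 - q ^+ 2) ^+ 2 <= 6 + 12 * q ^+ 2.
  rewrite ler_pdivrMr ?exprn_gt0 //; move: (q ^+ 2) s0 q2; clear => z z0 z1.
  rewrite -subr_ge0 (_ : _ - _ = 2 * z * (1 - 9 * z + 6 * z ^+ 2)); last by ring.
  rewrite mulr_ge0 //; first by lra.
  have : 0 <= z ^+ 2 by rewrite exprn_ge0 // ltW.
  lra.
have i3 : 6 <= (6 - 2 * q ^+ 2) / (1 - q ^+ 2) ^+ 2.
  rewrite ler_pdivlMr ?exprn_gt0 //; move: (q ^+ 2) s0 q2; clear => z z0 z1; nra.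
have j1 : (6 - 2 * q ^+ 2) / (1 - q ^+ 2) ^+ 2 / q ^+ 2 <= 6 / q ^+ 2 + 12.
  have -> : 6 / q ^+ 2 + 12 = (6 + 12 * q ^+ 2) / q ^+ 2 by field.
  by rewrite ler_pM2r // invr_gt0.
have j2 : 6 / q ^+ 2 <= (6 - 2 * q ^+ 2) / (1 - q ^+ 2) ^+ 2 / q ^+ 2.
  by rewrite ler_pM2r // invr_gt0.
have j3 : (q ^+ 3) ^+ 4 * lambert_moment 4 (q ^+ 2 - q ^+ 3) M <= 64 * C4.
  have hq : (q ^+ 2 / 2) ^+ 6 <= (q ^+ 2 - q ^+ 3) ^+ 6.
    have q20 : 0 <= q ^+ 2 / 2 by rewrite divr_ge0 // ltW.
    by rewrite lerXn2r ?nnegrE ?(ltW sm) //; clear -h1 s0; lra.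
  have -> : (q ^+ 3) ^+ 4 = 64 * (q ^+ 2 / 2) ^+ 6 by field.
  rewrite -mulrA ler_pM2l //; move: f4; rewrite ler_pdivlMr ?exprn_gt0 // mulrC.
  have : 0 <= lambert_moment 4 (q ^+ 2 - q ^+ 3) M.
    apply: sumr_ge0 => k _; apply: sumr_ge0 => v _.
    by rewrite !mulr_ge0 ?expR_ge0 ?exprn_ge0.
  move: hq; move: (_ ^+ 6) (_ ^+ 6) (lambert_moment _ _ _) => a b l ab l0.
  exact: le_trans (ler_wpM2r l0 ab).
have k0 : 0 < (q ^+ 3) ^+ 2 by rewrite exprn_gt0.
rewrite -(ler_pM2l k0) -[(lambert_moment 2 _ M <= _)](ler_pM2l k0).
have -> : (q ^+ 3) ^+ 2 * (6 * (pi ^+ 2 / 6) / q ^+ 8 - (12 * (pi ^+ 2 / 6) + 6 + 64 *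
  C4) / q ^+ 6) =
  pi ^+ 2 / 6 * (6 / q ^+ 2) - 12 * (pi ^+ 2 / 6) - 6 - 64 * C4 by move: pi => p; field.
have -> : (q ^+ 3) ^+ 2 * (6 * (pi ^+ 2 / 6) / q ^+ 8 + (12 * (pi ^+ 2 / 6) + 6 + 64 *
  C4) / q ^+ 6) =
  pi ^+ 2 / 6 * (6 / q ^+ 2) + 12 * (pi ^+ 2 / 6) + 6 + 64 * C4 by move: pi => p; field.
rewrite -e1 in j1 j2.
have j1' := ler_wpM2l p0 j1; have j2' := ler_wpM2l p0 j2.
rewrite -e2 in i2 i20.
move: d1 d2 j1' j2' j3 i2 i20 l1 l2 l3 l4 l5 l6; rewrite /lambert_main.
have -> : (q ^+ 2) ^+ 2 = q ^+ 4 by ring.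
move: ((q ^+ 3) ^+ 2 * lambert_moment 2 _ M) ((q ^+ 3) ^+ 4 *
  _) (lambert _ M) (lambert _ M) (lambert _ M) => u t v w z.
clear -p0 C40.
move: (pi ^+ 2 / 6) p0 => A A0; rewrite !(mulrDr A) !(mulrN A) (mulrCA A 2).
move: (2 * _)^-1 (2 * (q ^+ 2 - _))^-1 (2 * (q ^+ 2 + _))^-1 => a1 a2 a3.
move: (A / _) (A / _) (A / _) (A * (6 / _)) => b1 b2 b3 b4 *.
by apply/andP; split; lra.
Qed.

End Moments.

(** * Pointwise expansion of the super- and subsolutions *)

Section Barriers.
Variables (R : realType) (a : R).
Hypothesis a0 : 0 < a.
Implicit Types (r w x K C : R).

(* Written in r = sqrt (n + 1), these solve n g(n) = sum_m sigma(m) g(n - m) up to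
   one-sided errors: the factors (1 + K/r)^(-1) and 1 + K/r create a surplus
   proportional to K that absorbs all the bounded error terms. *)
Definition upper_barrier K r := expR (a * r) / (r * (r + K)).
Definition lower_barrier K r := expR (a * r) * (r + K) / r ^+ 3.

(* Expansion of g(n - u) / g(n), divided by exp(- a u / (2 r)), in x = u / (n + 1). *)
Definition upper_factor C K r x :=
  1 + (1 - K / (r + K) / 2) * x - a * r * x ^+ 2 / 8 + C * (x ^+ 2 + r ^+ 2 * x ^+ 4).
Definition lower_factor C K r x :=
  1 + (1 + K / (r + K) / 2) * x - a * r * x ^+ 2 / 8 - C * (x ^+ 2 + r * x ^+ 3).

(** The negative term is completed to a square with [C r ^ 2 x ^ 4], whence the condition on [C].
    Positivity for all [x >= 0] lets the terms with [u > n], absent from the recurrence, be added to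
    an upper bound. *)
Lemma upper_factor_ge C K r x : a ^+ 2 / 16 <= C -> 0 < r -> 0 <= K -> 0 <= x ->
  15 / 16 + C * x ^+ 2 <= upper_factor C K r x.
Proof.
move=> hC r0 K0 x0; rewrite /upper_factor; have rK : 0 < r + K by lra.
have k1 : K / (r + K) <= 1 by rewrite ler_pdivrMr //; lra.
have h1 : 0 <= (1 - K / (r + K) / 2) * x by rewrite mulr_ge0 // subr_ge0; lra.
have h2 : a ^+ 2 / 16 * (r ^+ 2 * x ^+ 4) <= C * (r ^+ 2 * x ^+ 4).
  by rewrite ler_wpM2r // mulr_ge0 ?exprn_ge0 // ltW.
have := sqr_ge0 (a * r * x ^+ 2 / 4 - 1 / 4).
have -> : (a * r * x ^+ 2 / 4 - 1 / 4) ^+ 2 =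
  a ^+ 2 / 16 * (r ^+ 2 * x ^+ 4) - a * r * x ^+ 2 / 8 + 1 / 16 by field.
move: (_ * x) h1 => u h1; lra.
Qed.

Lemma exp_split r w : expR (a * (r * w)) =
  expR (a * r) * expR (- (a * r * (1 - w ^+ 2) / 2)) * expR (- (a * r * (1 - w) ^+ 2 / 2)).
Proof. by rewrite -!expRD; congr expR; field. Qed.

(** With [de = 1 - w] and [k = K / (r + K)], the left side is the ratio of the factors
    [1 / (r (r + K))] at [r w] and at [r]. The constant 11 collects [de ^ 2] and [5/2 e ^ 2], where
    [e <= 2 de]. *)
Lemma inv_quad_le (k de x : R) : 0 <= k -> k <= 1 -> 0 < de -> de <= 3 / 10 ->
    x = 2 * de - de ^+ 2 ->
  ((1 - de) * (1 - (1 - k) * de))^-1 <= 1 + (1 - k / 2) * x + 11 * x ^+ 2.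
Proof.
move=> k0 k1 de0 de3 xE.
have dx : de <= x.
  rewrite -subr_ge0 (_ : _ - _ = de * (1 - de)); last by rewrite xE; ring.
  by rewrite mulr_ge0 ?(ltW de0) //; lra.
have d2 : de ^+ 2 <= x ^+ 2 by rewrite ler_sqr ?nnegrE ?(ltW de0) ?(le_trans (ltW de0)).
pose l := 1 - k; have l0 : 0 <= l by rewrite subr_ge0.
have l1 : l <= 1 by rewrite /l; lra.
pose e := (1 + l) * de; have e4 : e <= 2 * de by rewrite ler_pM2r //; lra.
have e0 : 0 < e by rewrite mulr_gt0 // ltr_pwDl.
have e6 : e <= 6 / 10 by lra.
have e2 : e ^+ 2 <= 4 * de ^+ 2.
  rewrite (_ : 4 * de ^+ 2 = (2 * de) ^+ 2); last by ring.
  by rewrite ler_sqr ?nnegrE ?(ltW e0) // mulr_ge0 // ltW.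
have p1 : 1 - e <= (1 - de) * (1 - (1 - k) * de).
  rewrite -/l /e -subr_ge0 (_ : _ - _ = l * de ^+ 2); last by ring.
  by rewrite mulr_ge0 // sqr_ge0.
have e1 : 0 < 1 - e by lra.
have f1 : ((1 - de) * (1 - (1 - k) * de))^-1 <= (1 - e)^-1.
  by rewrite lef_pV2 ?posrE // (lt_le_trans e1).
have f2 : (1 - e)^-1 <= 1 + e + 5 / 2 * e ^+ 2.
  rewrite -div1r ler_pdivrMr // -subr_ge0.
  rewrite (_ : _ - _ = e ^+ 2 * (3 / 2 - 5 / 2 * e)); last by field.
  by rewrite mulr_ge0 ?sqr_ge0 //; lra.
have f3 : e <= (1 - k / 2) * x + de ^+ 2.
  have -> : (1 - k / 2) * x + de ^+ 2 = e + k / 2 * de ^+ 2 by rewrite xE /e /l; field.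
  by rewrite lerDl mulr_ge0 ?sqr_ge0 // divr_ge0.
apply: (le_trans f1); apply: (le_trans f2).
move: ((1 - k / 2) * x) (x ^+ 2) (de ^+ 2) (e ^+ 2) f3 e2 d2; clear => u v w t *; lra.
Qed.

Lemma upper_combine (F x y e : R) : 0 <= F -> F <= x -> x <= 1 / 2 -> 0 <= y -> 0 <= e ->
  (1 + (F + 11 * x ^+ 2)) * (1 - y + y ^+ 2 / 2) <=
  1 + F - y + (11 * x ^+ 2 + 4 * y ^+ 2 + e).
Proof.
move=> F0 F1 x2 y0 e0; have x2e : x ^+ 2 <= 1 / 4.
  rewrite -subr_ge0 (_ : _ - _ = (1 / 2 - x) * (1 / 2 + x)); last by field.
  by apply: mulr_ge0; lra.
have x20 := sqr_ge0 x.
have : (F + 11 * x ^+ 2) * y ^+ 2 <= 7 * y ^+ 2 by rewrite ler_wpM2r ?sqr_ge0 //; lra.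
have : 0 <= (F + 11 * x ^+ 2) * y by rewrite mulr_ge0 //; lra.
clear -e0; lra.
Qed.

Lemma upper_pt : exists C r0 : R, [/\ 0 < C, a ^+ 2 / 16 <= C, 1 <= r0 &
  forall r K w, r0 <= r -> 0 <= K -> 1 / r <= w -> w < 1 ->
    upper_barrier K (r * w) <= upper_barrier K r * (expR (- (a * r * (1 - w ^+ 2) / 2)) *
      upper_factor C K r (1 - w ^+ 2))].
Proof.
(* For [x > 1/2] the exponential [expR (- (a * r / 32))] has to beat the ratio [f <= r ^ 2]; by
   [exprM_expRN_le] with exponent 3 it does so from this [r0] on. *)
pose r0 := 1 + 27 * (32 / a) ^+ 3.
have a3 : 0 < (32 / a) ^+ 3 by rewrite exprn_gt0 ?divr_gt0.
have a2 : 0 < a ^+ 2 by rewrite exprn_gt0.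
exists (11 + a ^+ 2 / 16), r0; rewrite /r0; split; [lra|lra|lra|].
set C := 11 + _ => r K w hr K0 hw w1.
have r1 : 1 <= r by lra.
have rp : 0 < r by lra.
have w0 : 0 < w by apply: lt_le_trans hw; rewrite divr_gt0.
set x := 1 - w ^+ 2; set y := a * r * x ^+ 2 / 8.
have x0 : 0 < x by rewrite subr_gt0 expr_lt1 // ltW.
have ar : 0 < a * r by rewrite mulr_gt0.
have y0 : 0 <= y by rewrite /y divr_ge0 // mulr_ge0 ?sqr_ge0 // ltW.
have zy : expR (- (a * r * (1 - w) ^+ 2 / 2)) <= expR (- y).
  rewrite ler_expR lerN2 /y; have : (x / 2) ^+ 2 <= (1 - w) ^+ 2.
    have xh : 0 <= x / 2 by lra.
    have wh : 0 <= 1 - w by lra.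
    by rewrite ler_sqr ?nnegrE // /x; have := sqr_ge0 (1 - w); lra.
  by move/(ler_wpM2l (ltW ar)); lra.
pose f := (r + K) / (w * (r * w + K)).
have rwK : 0 < r * w + K by rewrite ltr_wpDr ?mulr_gt0.
have rK : 0 < r + K by lra.
have gE : upper_barrier K (r * w) = upper_barrier K r * (expR (- (a * r * x / 2)) * (f *
  expR (- (a * r * (1 - w) ^+ 2 / 2)))).
  rewrite /upper_barrier exp_split -/x /f; move: (expR _) (expR _) (expR _) => e1 e2 e3.
  by field; rewrite !gt_eqF.
have f0 : 0 < f by rewrite divr_gt0 ?mulr_gt0.
rewrite gE; apply: ler_wpM2l.
  by rewrite /upper_barrier divr_ge0 ?expR_ge0 // mulr_ge0 // ltW.
apply: ler_wpM2l; first exact: expR_ge0.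
apply: (@le_trans _ _ (f * expR (- y))); first by rewrite ler_pM2l.
have [x2|x2] := lerP x (1 / 2); last first.
  have xx : 1 / 4 <= x ^+ 2.
    rewrite -subr_ge0 (_ : _ - _ = (x - 1 / 2) * (x + 1 / 2)); last by field.
    by apply: mulr_ge0; clear -x2; lra.
  have h1 : f <= r ^+ 2.
    rewrite /f ler_pdivrMr ?mulr_gt0 //.
    have rw : 1 <= r * w by rewrite mulrC -ler_pdivrMr.
    have -> : r ^+ 2 * (w * (r * w + K)) = (r * w) * ((r * w) * r + r * K) by ring.
    apply: (@le_trans _ _ ((r * w) * (r + K))); first by rewrite ler_peMl // ltW.
    rewrite ler_pM2l ?mulr_gt0 //; apply: lerD; rewrite ler_peMl //; exact: ltW.
  have h2 : expR (- y) <= expR (- (a * r / 32)).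
    by rewrite ler_expR lerN2 /y; move: xx => /(ler_wpM2l (ltW ar)); lra.
  have h3 : r ^+ 2 * expR (- (a * r / 32)) <= 1.
    have ar32 : 0 < a * r / 32 by rewrite divr_gt0.
    have := exprM_expRN_le (isT : (0 < 3)%N) (ltW ar32); move: (expR _) => e.
    have -> : (a * r / 32) ^+ 3 * e = r * (r ^+ 2 * e) / (32 / a) ^+ 3.
      by field; rewrite gt_eqF.
    rewrite ler_pdivrMr // => h; rewrite -(ler_pM2l rp) mulr1; apply: le_trans h _.
    by rewrite -natrX; clear -hr; lra.
  apply: (@le_trans _ _ 1).
    by apply: le_trans h3; apply: ler_pM => //; exact: ltW.
  have hC : a ^+ 2 / 16 <= C by rewrite lerDr.
  apply: le_trans (upper_factor_ge hC rp K0 (ltW x0)).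
  have : 11 * x ^+ 2 <= C * x ^+ 2 by rewrite ler_wpM2r ?sqr_ge0 // lerDl divr_ge0 // ltW.
  clear -xx; lra.
set k := K / (r + K); have k1 : k <= 1 by rewrite ler_pdivrMr //; lra.
have k0 : 0 <= k by rewrite divr_ge0 // ltW.
pose de := 1 - w; have wE : 1 - de = w by rewrite /de; ring.
have de0 : 0 < de by rewrite subr_gt0.
have de1 : de < 1 by rewrite gtrBl.
have xE : x = 2 * de - de ^+ 2 by rewrite /x /de; ring.
have de3 : de <= 3 / 10.
  rewrite leNgt; apply/negP => d; move: x2; rewrite xE; clear -d de1.
  have : 0 < (de - 3 / 10) * (17 / 10 - de) by rewrite mulr_gt0 //; lra.
  lra.
have fE : f = ((1 - de) * (1 - (1 - k) * de))^-1.
  rewrite /f (_ : 1 - (1 - k) * de = (r * w + K) / (r + K)).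
    by rewrite wE; field; rewrite !gt_eqF.
  by rewrite /de /k; field; rewrite gt_eqF.
have h1 : f <= 1 + (1 - k / 2) * x + 11 * x ^+ 2.
  by rewrite fE; apply: inv_quad_le.
have h2 := expRN_le y0.
rewrite /upper_factor -/k -/y.
have F0 : 0 <= (1 - k / 2) * x.
  by apply: mulr_ge0; [clear -k1; lra | exact: ltW].
have F1 : (1 - k / 2) * x <= x.
  by rewrite ler_piMl ?(ltW x0) // gerBl divr_ge0.
apply: (@le_trans _ _ ((1 + ((1 - k / 2) * x + 11 * x ^+ 2)) * (1 - y + y ^+ 2 / 2))).
  by apply: ler_pM; rewrite ?(ltW f0) ?expR_ge0 // addrA.
have -> : C * (x ^+ 2 + r ^+ 2 * x ^+ 4) =
   11 * x ^+ 2 + 4 * y ^+ 2 + (11 * (r * x ^+ 2) ^+ 2 + a ^+ 2 / 16 * x ^+ 2).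
  by rewrite /C /y; field.
have rest : 0 <= 11 * (r * x ^+ 2) ^+ 2 + a ^+ 2 / 16 * x ^+ 2.
  by apply: addr_ge0; apply: mulr_ge0; rewrite ?sqr_ge0 // divr_ge0 ?sqr_ge0.
exact: upper_combine.
Qed.

(** This makes the lower bound trivial for [x >= 1/2], in particular for the terms with [u > n]. The
    14 comes from [1 + 3/2 x <= 14 x ^ 3], an equality at [x = 1/2]. *)
Lemma lower_factor_le0 r K x : 1 <= r -> 0 <= K -> 1 / 2 <= x ->
  lower_factor (14 + 2 * a) K r x <= 0.
Proof.
move=> r1 K0 x2; have rK : 0 < r + K by lra.
have k1 : K / (r + K) <= 1 by rewrite ler_pdivrMr //; lra.
have x0 : 0 < x by lra.
have h1 : (1 + K / (r + K) / 2) * x <= 3 / 2 * x by rewrite ler_pM2r // ; lra.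
have h2 : 0 <= a * r * x ^+ 2 / 8.
  by rewrite divr_ge0 // mulr_ge0 ?sqr_ge0 // mulr_ge0 ?(ltW a0) //; lra.
have x3 : 0 <= x ^+ 3 by rewrite exprn_ge0 // ltW.
have h3 : x ^+ 3 <= r * x ^+ 3 by rewrite ler_peMl.
have h4 : 0 <= a * (r * x ^+ 3) by rewrite mulr_ge0 ?(ltW a0) // mulr_ge0 //; lra.
have h5 : 0 <= a * x ^+ 2 by rewrite mulr_ge0 ?sqr_ge0 // ltW.
have h6 : 0 <= x ^+ 2 by rewrite sqr_ge0.
have h7 : 1 + 3 / 2 * x <= 14 * x ^+ 3.
  rewrite -subr_ge0 (_ : _ - _ = (x - 1 / 2) * (14 * x ^+ 2 + 7 * x + 2)); last by field.
  by apply: mulr_ge0; lra.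
rewrite /lower_factor; move: (_ * x) h1 => u h1; lra.
Qed.

Lemma inv_cube_ge (k de x : R) : 0 <= k -> k <= 1 -> 0 < de -> de < 1 ->
    x = 2 * de - de ^+ 2 ->
  1 + (1 + k / 2) * x - 3 * x ^+ 2 <= (1 - (1 - k) * de) / (1 - de) ^+ 3.
Proof.
move=> k0 k1 de0 de1 xE; have dd0 := sqr_ge0 de.
have dx : de <= x.
  rewrite -subr_ge0 (_ : _ - _ = de * (1 - de)); last by rewrite xE; ring.
  by rewrite mulr_ge0 ?(ltW de0) // subr_ge0 ltW.
have d2 : de ^+ 2 <= x ^+ 2 by rewrite ler_sqr ?nnegrE ?(ltW de0) ?(le_trans (ltW de0)).
pose l := 1 - k; have l0 : 0 <= l by rewrite subr_ge0.
have l1 : l <= 1 by rewrite gerBl.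
have c1 : 1 + 3 * de <= ((1 - de) ^+ 3)^-1.
  rewrite -div1r ler_pdivlMr ?exprn_gt0 ?subr_gt0 // -subr_ge0.
  rewrite (_ : _ - _ = de ^+ 2 * (3 * (1 - de) ^+ 2 + 2 * (1 - de) + 1)); last by ring.
  rewrite mulr_ge0 //; have := sqr_ge0 (1 - de); lra.
have c0 : l * de <= de by rewrite ler_piMl // ltW.
have c2 : (1 - l * de) * (1 + 3 * de) <= (1 - l * de) / (1 - de) ^+ 3.
  by rewrite ler_wpM2l // subr_ge0 (le_trans c0) // ltW.
apply: le_trans c2.
have c3 : l * de ^+ 2 <= de ^+ 2 by rewrite ler_piMl ?sqr_ge0.
have c4 : (1 + k / 2) * x <= (3 - l) * de.
  have -> : (1 + k / 2) * x = (3 - l) * (x / 2) by rewrite /l; field.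
  by rewrite ler_wpM2l //; lra.
rewrite (_ : (1 - l * de) * _ = 1 + (3 - l) * de - 3 * (l * de ^+ 2)); last by ring.
move: ((1 + k / 2) * x) ((3 - l) * de) (l * de ^+ 2) (x ^+ 2) (de ^+ 2) c3 c4 d2.
by clear => u v t w z *; lra.
Qed.

Lemma lower_combine (F x z : R) : 0 < x -> x <= 1 / 2 -> 0 <= z -> x <= F -> F <= 3 / 2 * x ->
  0 <= 1 + F - 3 * x ^+ 2 /\
  1 + F - 3 * x ^+ 2 - z - 3 / 2 * (x * z) <= (1 + F - 3 * x ^+ 2) * (1 - z).
Proof.
move=> x0 x2 z0 F0 F1; have xx : x ^+ 2 <= 1 / 2 * x by rewrite expr2 ler_pM2r.
have x20 := sqr_ge0 x; split; first by lra.
have p1 : 1 + F - 3 * x ^+ 2 <= 1 + 3 / 2 * x by lra.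
have := ler_wpM2r z0 p1; clear; lra.
Qed.

Lemma lower_pt r K w : 1 <= r -> 0 <= K -> 0 < w -> w < 1 ->
  lower_barrier K r * (expR (- (a * r * (1 - w ^+ 2) / 2)) * lower_factor (14 + 2 *
    a) K r (1 - w ^+ 2))
  <= lower_barrier K (r * w).
Proof.
move=> r1 K0 w0 w1; set C := 14 + _.
have rp : 0 < r by lra.
set x := 1 - w ^+ 2; set y := a * r * x ^+ 2 / 8.
have x0 : 0 < x by rewrite subr_gt0 expr_lt1 // ltW.
pose f := (r * w + K) / (r + K) / w ^+ 3.
have rwK : 0 < r * w + K by rewrite ltr_wpDr ?mulr_gt0.
have rK : 0 < r + K by lra.
have gE : lower_barrier K (r * w) = lower_barrier K r * (expR (- (a * r * x / 2)) * (f *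
  expR (- (a * r * (1 - w) ^+ 2 / 2)))).
  rewrite /lower_barrier exp_split -/x /f; move: (expR _) (expR _) (expR _) => e1 e2 e3.
  by field; rewrite !gt_eqF.
have f0 : 0 < f by rewrite !divr_gt0 ?exprn_gt0.
rewrite gE; apply: ler_wpM2l.
  by rewrite /lower_barrier divr_ge0 ?exprn_ge0 ?(ltW rp) // mulr_ge0 ?expR_ge0 // ltW.
apply: ler_wpM2l; first exact: expR_ge0.
have [x2|x2] := lerP (1 / 2) x.
  by apply: le_trans (lower_factor_le0 r1 K0 x2) _; rewrite mulr_ge0 ?expR_ge0 // ltW.
set k := K / (r + K); have k1 : k <= 1 by rewrite ler_pdivrMr //; lra.
have k0 : 0 <= k by rewrite divr_ge0 // ltW.
pose de := 1 - w; have wE : 1 - de = w by rewrite /de; ring.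
have de0 : 0 < de by rewrite subr_gt0.
have de1 : de < 1 by rewrite gtrBl.
have xE : x = 2 * de - de ^+ 2 by rewrite /x /de; ring.
have dd0 := sqr_ge0 de.
have dx : de <= x.
  rewrite -subr_ge0 xE (_ : _ - _ = de * (1 - de)); last by ring.
  by rewrite mulr_ge0 // ?subr_ge0 ltW.
have dx2 : x / 2 <= de by lra.
have d2 : de ^+ 2 <= x ^+ 2 by rewrite ler_sqr ?nnegrE ?(ltW de0) ?(ltW x0).
have fE : f = (1 - (1 - k) * de) / (1 - de) ^+ 3.
  rewrite /f (_ : 1 - (1 - k) * de = (r * w + K) / (r + K)).
    by rewrite wE.
  by rewrite /de /k; field; rewrite gt_eqF.
have h1 : 1 + (1 + k / 2) * x - 3 * x ^+ 2 <= f.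
  by rewrite fE; apply: inv_cube_ge.
set z := a * r * (1 - w) ^+ 2 / 2.
have ar : 0 < a * r by rewrite mulr_gt0.
have x3 : 0 <= x ^+ 3 by rewrite exprn_ge0 // ltW.
(* This cubic term and the one from [x * z] are absorbed by the part [2 * a] of [C]. *)
have zy : z <= y + a * r * x ^+ 3 / 2.
  have dd : de ^+ 2 <= x ^+ 2 / 4 + x ^+ 3.
    have c1 : de <= x / 2 + x ^+ 2 / 2 by clear -xE d2; lra.
    have c2 : de ^+ 2 <= (x / 2 + x ^+ 2 / 2) ^+ 2.
      by rewrite ler_sqr ?nnegrE ?(ltW de0) // addr_ge0 // divr_ge0 ?sqr_ge0 // ltW.
    apply: le_trans c2 _.
    rewrite (_ : (x / 2 + x ^+ 2 / 2) ^+ 2 = x ^+ 2 / 4 + x ^+ 3 / 2 + x * x ^+ 3 / 4);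
      last by field.
    have : x * x ^+ 3 <= x ^+ 3 by rewrite ler_piMl //; clear -x2; lra.
    move: (x * x ^+ 3) (x ^+ 3) x3; clear => u v; lra.
  by have := ler_wpM2l (ltW ar) dd; rewrite /z -/de /y; clear; lra.
have z2 : z <= a * r * x ^+ 2 / 2.
  have := ler_wpM2l (ltW ar) d2; rewrite /z -/de; clear; lra.
have z0 : 0 <= z by rewrite /z divr_ge0 // mulr_ge0 ?sqr_ge0 // ltW.
have x20 := sqr_ge0 x.
have F0 : x <= (1 + k / 2) * x by rewrite ler_peMl ?(ltW x0) // lerDl divr_ge0.
have F1 : (1 + k / 2) * x <= 3 / 2 * x by rewrite ler_pM2r //; clear -k1; lra.
have e1 : 1 - z <= expR (- z) by exact: expR_ge1Dx.
have [p0 c5] := @lower_combine ((1 + k / 2) * x) x z x0 (ltW x2) z0 F0 F1.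
apply: (@le_trans _ _ ((1 + (1 + k / 2) * x - 3 * x ^+ 2) * expR (- z))); last first.
  by rewrite ler_wpM2r ?expR_ge0.
apply: (@le_trans _ _ ((1 + (1 + k / 2) * x - 3 * x ^+ 2) * (1 - z))); last by rewrite ler_wpM2l.
have c6 : x * z <= a * r * x ^+ 3 / 2.
  apply: le_trans (ler_wpM2l (ltW x0) z2) _.
  by rewrite (_ : x * _ = a * r * x ^+ 3 / 2) //; field.
have c7 : 0 <= a * x ^+ 2 by rewrite mulr_ge0 // ltW.
have c8 : 0 <= r * x ^+ 3 by rewrite mulr_ge0 // ltW.
have c9 : 0 <= a * r * x ^+ 3 by rewrite mulr_ge0 // ltW.
rewrite /lower_factor -/k -/y; apply: le_trans c5.
have -> : C * (x ^+ 2 + r * x ^+ 3) =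
  14 * x ^+ 2 + 2 * (a * x ^+ 2) + 14 * (r * x ^+ 3) + 2 * (a * r * x ^+ 3).
  by rewrite /C; ring.
move: c6 c7 c8 c9 zy x20; move: ((1 + k / 2) * x) (x * z) (a * r * x ^+ 3) (a * x ^+ 2).
by move: (r * x ^+ 3) (x ^+ 2) (y) (z); clear => t1 t2 t3 t4 t5 t6 t7 t8 *; lra.
Qed.

End Barriers.

(** * The moments at the point attached to n *)

Section PartitionBounds.
Variable R : realType.
Implicit Types (r w x y d e K C : R).
Local Notation pi := (@pi R).

Definition partition_rate : R := pi * Num.sqrt (2 / 3).
Local Notation a := partition_rate.

Lemma partition_rate_gt0 : 0 < a.
Proof. by rewrite mulr_gt0 ?pi_gt0 // sqrtr_gt0 divr_gt0. Qed.

Lemma partition_rate_sqr : pi ^+ 2 / 6 = a ^+ 2 / 4.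
Proof. by rewrite /a exprMn sqr_sqrtr ?divr_ge0 //; move: pi => p; field. Qed.

Lemma ultimately_ge N (P : nat -> Prop) : ultimately P -> ultimately (fun M => (N <= M)%N /\ P M).
Proof. by move=> h; apply: ultimately_and h; exists N. Qed.

Lemma widen_bounds x y e d : x - e <= y <= x + e -> e <= d -> x - d <= y <= x + d.
Proof. by move=> /andP[h1 h2] ed; apply/andP; split; lra. Qed.

(** [s = a / (2 r)] is the derivative of [a sqrt x] at [x = r ^ 2], and [a] is the rate for which
    the main term [pi ^ 2 / (6 s ^ 2)] equals [r ^ 2]. *)
Lemma moments : exists D r1 : R, [/\ 0 < D, 1 <= r1 & forall r, r1 <= r ->
  let s := a / (2 * r) in ultimately (fun M => [/\ r ^+ 2 - r / a - D <= lambert s M <=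
    r ^+ 2 - r / a + D,
     4 / a * r ^+ 3 - D * r ^+ 2 <= lambert_moment 1 s M <= 4 / a * r ^+ 3 + D * r ^+ 2,
     24 / a ^+ 2 * r ^+ 4 - D * r ^+ 3 <= lambert_moment 2 s M <= 24 / a ^+ 2 * r ^+ 4 + D * r ^+ 3,
     lambert_moment 3 s M <= D * r ^+ 5 & lambert_moment 4 s M <= D * r ^+ 6])].
Proof.
have [C1 [C10 h1]] := @lambert_moment1_bounds R; have [C2 [C20 h2]] := @lambert_moment2_bounds R.
have [C3 [C30 h3]] := @lambert_moment_le R 3 isT; have [C4 [C40 h4]] := @lambert_moment_le R 4 isT.
have a0 := partition_rate_gt0.
pose D1 := 4 / a ^+ 2 * C1; have D10 : 0 < D1 by rewrite !mulr_gt0 ?invr_gt0 ?exprn_gt0.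
pose D2 := 8 / a ^+ 3 * C2; have D20 : 0 < D2 by rewrite !mulr_gt0 ?invr_gt0 ?exprn_gt0.
pose D3 := 32 / a ^+ 5 * C3; have D30 : 0 < D3 by rewrite !mulr_gt0 ?invr_gt0 ?exprn_gt0.
pose D4 := 64 / a ^+ 6 * C4; have D40 : 0 < D4 by rewrite !mulr_gt0 ?invr_gt0 ?exprn_gt0.
have [D [DD0 DD1 DD2 DD3 DD4]] : exists D, [/\ 1 <= D, D1 <= D, D2 <= D, D3 <= D & D4 <= D].
  exists (1 + D1 + D2 + D3 + D4); move: D1 D2 D3 D4 D10 D20 D30 D40 => d1 d2 d3 d4 *.
  by split; lra.
exists D, (1 + 8 * a); split; [exact: lt_le_trans ltr01 DD0 | by rewrite lerDl mulr_ge0 // ltW |].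
move=> r hr s.
have r0 : 0 < r by lra.
have s0 : 0 < s by rewrite divr_gt0 // mulr_gt0.
have s16 : s <= 1 / 16 by rewrite /s ler_pdivrMr ?mulr_gt0 //; lra.
have s4 : s <= 1 / 4 by lra.
have s1 : s <= 1 by lra.
pose q := Num.sqrt s; have q2 : q ^+ 2 = s by rewrite sqr_sqrtr // ltW.
have q0 : 0 < q by rewrite sqrtr_gt0.
have q4 : q <= 1 / 4.
  by rewrite -(@ler_pXn2r _ 2) ?nnegrE ?(ltW q0) // q2; lra.
have r2 : 0 < r ^+ 2 by rewrite exprn_gt0.
have r3 : 0 < r ^+ 3 by rewrite exprn_gt0.
have r5 : 0 < r ^+ 5 by rewrite exprn_gt0.
have r6 : 0 < r ^+ 6 by rewrite exprn_gt0.
apply: ultimately_imp (ultimately_and (ultimately_and (lambert_bounds s0) (h1 _ s0 s4))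
  (ultimately_and (h2 _ q0 q4) (ultimately_and (h3 _ s0 s1) (h4 _ s0 s1)))).
move=> M [[b0 b1] [b2 [b3 b4]]].
have rN : r != 0 by rewrite gt_eqF.
have aN : a != 0 by rewrite gt_eqF.
rewrite /lambert_main partition_rate_sqr in b0; rewrite partition_rate_sqr in b1 b2.
have q8 : q ^+ 8 = s ^+ 4 by rewrite -q2; ring.
have q6 : q ^+ 6 = s ^+ 3 by rewrite -q2; ring.
rewrite q2 q8 q6 in b2.
have e0 : a ^+ 2 / 4 / s ^+ 2 = r ^+ 2 by rewrite /s; field; rewrite rN aN.
have e0' : (2 * s)^-1 = r / a by rewrite /s; field; rewrite rN aN.
have e1 : 2 * (a ^+ 2 / 4) / s ^+ 3 = 4 / a * r ^+ 3 by rewrite /s; field; rewrite rN aN.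
have e1' : C1 / s ^+ 2 = D1 * r ^+ 2 by rewrite /s /D1; field; rewrite rN aN.
have e2 : 6 * (a ^+ 2 / 4) / s ^+ 4 = 24 / a ^+ 2 * r ^+ 4 by rewrite /s; field; rewrite rN aN.
have e2' : C2 / s ^+ 3 = D2 * r ^+ 3 by rewrite /s /D2; field; rewrite rN aN.
have e3 : C3 / s ^+ (3 + 2) = D3 * r ^+ 5 by rewrite /s /D3; field; rewrite rN aN.
have e4 : C4 / s ^+ (4 + 2) = D4 * r ^+ 6 by rewrite /s /D4; field; rewrite rN aN.
rewrite e0 e0' in b0; rewrite e1 e1' in b1; rewrite e2 e2' in b2; rewrite e3 in b3;
  rewrite e4 in b4.
split.
- exact: widen_bounds b0 DD0.
- by apply: widen_bounds b1 _; rewrite ler_pM2r.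
- by apply: widen_bounds b2 _; rewrite ler_pM2r.
- by apply: le_trans b3 _; rewrite ler_pM2r.
- by apply: le_trans b4 _; rewrite ler_pM2r.
Qed.

End PartitionBounds.

(** * Super- and subsolutions of the recurrence *)

Section PartitionSteps.
Variable R : realType.
Implicit Types (r w x K C : R).
Local Notation pi := (@pi R).

Local Notation a := (partition_rate R).

(** The shift by 1 keeps the barriers finite and positive at [n = 0]. *)
Definition sqrtS n : R := Num.sqrt n.+1%:R.

Lemma sqrtS_sqr n : sqrtS n ^+ 2 = n.+1%:R.
Proof. by rewrite sqr_sqrtr. Qed.

Lemma sqrtS_ge1 n : 1 <= sqrtS n.
Proof. by rewrite -[leLHS]sqrtr1 ler_sqrt // ler1n. Qed.

Lemma sqrtS_large x : exists n0, forall n, (n0 <= n)%N -> x <= sqrtS n.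
Proof.
exists (Num.bound (x ^+ 2)) => n le.
have h : x ^+ 2 <= sqrtS n ^+ 2.
  rewrite sqrtS_sqr (le_trans (ltW (archi_boundP (sqr_ge0 x)))) // ler_nat; exact: leqW.
have [x0|x0] := lerP 0 x; last by rewrite (le_trans (ltW x0)) // (le_trans ler01) ?sqrtS_ge1.
by rewrite -ler_sqr ?nnegrE // (le_trans ler01) ?sqrtS_ge1.
Qed.

Lemma sqrtS_sub n u : (0 < u <= n)%N -> exists w, [/\ 1 / sqrtS n <= w, w < 1,
  sqrtS n * w = sqrtS (n - u) & 1 - w ^+ 2 = u%:R / sqrtS n ^+ 2].
Proof.
move=> /andP[u0 un]; have r0 : 0 < sqrtS n by rewrite (lt_le_trans ltr01) ?sqrtS_ge1.
exists (sqrtS (n - u) / sqrtS n); split.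
- by rewrite ler_pM2r ?invr_gt0 ?sqrtS_ge1.
- rewrite ltr_pdivrMr // mul1r ltr_sqrt ?ltr0n // ltr_nat ltnS; lia.
- by rewrite mulrC divfK // gt_eqF.
rewrite expr_div_n !sqrtS_sqr -subSn // natrB; last exact: ltnW.
by have : n.+1%:R != 0 :> R by []; move: n.+1%:R => N N0; field.
Qed.

Definition sigma_conv M n (F : nat -> R) := \sum_(k < M) \sum_(v < M)
  v.+1%:R * (if (k.+1 * v.+1 <= n)%N then F (n - k.+1 * v.+1)%N else 0).

Lemma sigma_conv_le M n (F G : nat -> R) c :
  (forall m, (m < n)%N -> F m <= c * G m) -> sigma_conv M n F <= c * sigma_conv M n G.
Proof.
move=> FG; rewrite /sigma_conv mulr_sumr; apply: ler_sum => k _; rewrite mulr_sumr.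
apply: ler_sum => v _; rewrite mulrCA ler_pM2l //; case: ifP => le; last by rewrite mulr0.
by apply: FG; rewrite ltn_subrL (leq_trans _ le) ?muln_gt0.
Qed.

Lemma sigma_sum_upper_factor C K r s M : r != 0 ->
  sigma_sum M (fun u => expR (- (s * u)) * upper_factor a C K r (u / r ^+ 2)) =
  lambert s M + (1 - K / (r + K) / 2) / r ^+ 2 * lambert_moment 1 s M
  + (C / r ^+ 4 - a / r ^+ 3 / 8) * lambert_moment 2 s M + C / r ^+ 6 * lambert_moment 4 s M.
Proof.
move=> r0; rewrite -!sigma_sumZ -!sigma_sumD; apply: sigma_sum_eq => u; rewrite /upper_factor.
by move: (K / _) (expR _) a => k e b; field.
Qed.

Lemma sigma_sum_lower_factor C K r s M : r != 0 ->
  sigma_sum M (fun u => expR (- (s * u)) * lower_factor a C K r (u / r ^+ 2)) =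
  lambert s M + (1 + K / (r + K) / 2) / r ^+ 2 * lambert_moment 1 s M
  - (C / r ^+ 4 + a / r ^+ 3 / 8) * lambert_moment 2 s M - C / r ^+ 5 * lambert_moment 3 s M.
Proof.
move=> r0; rewrite -!sigma_sumZ -sigma_sumD -!sigma_sumB; apply: sigma_sum_eq => u;
  rewrite /lower_factor.
by move: (K / _) (expR _) a => k e b; field.
Qed.

Lemma damping_bounds K r : 0 <= K -> K <= r -> 0 < r ->
  [/\ 0 <= K / (r + K), K / (r + K) <= 1 & K / 2 <= K / (r + K) * r].
Proof.
move=> K0 Kr r0; have rK : 0 < r + K by lra.
split; first by rewrite divr_ge0 // ltW.
  by rewrite ler_pdivrMr //; lra.
rewrite (mulrAC K (r + K)^-1) ler_pdivlMr //.
have : 0 <= K * (r - K) by rewrite mulr_ge0 // subr_ge0.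
lra.
Qed.

(** After division by the barrier at [n], the terms in [r / a] from [lambert] and from the first two
    moments cancel, [-1 + 4 - 3 = 0]; this dictates the power [r ^ (- 2)] in the barrier. The
    damping leaves [- 2 k r / a <= - K / a = - (E + 1)], where [E] covers the errors and 1 covers
    [n = r ^ 2 - 1]. *)
Lemma upper_step : exists (K : R) n0, 0 <= K /\ forall n, (n0 <= n)%N -> exists2 M, (n <= M)%N &
  sigma_conv M n (fun m => upper_barrier a K (sqrtS m)) <= n%:R * upper_barrier a K (sqrtS n).
Proof.
have a0 := (@partition_rate_gt0 R); have [C [r0 [C0 Ca r01 pt]]] := upper_pt a0.
have [D [r1 [D0 r11 hD]]] := moments R.
pose E := D + D + D + C * (24 / a ^+ 2 + D) + C * D + a / 8 * D.
have E0 : 0 < E.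
  have : 0 < a / 8 * D by rewrite mulr_gt0 // divr_gt0.
  have : 0 <= 24 / a ^+ 2 by rewrite divr_ge0 ?exprn_ge0 ?(ltW a0).
  by move=> h1 h2; have : 0 <= C * (24 / a ^+ 2 + D) + C * D;
    [rewrite addr_ge0 // mulr_ge0 ?(ltW C0) //; lra | rewrite /E; lra].
pose K := a * (E + 1); have K0 : 0 < K by rewrite mulr_gt0 //; lra.
have [n0 hn0] := sqrtS_large (r0 + r1 + K).
exists K, n0; split; first exact: ltW.
move=> n /hn0; set r := sqrtS n => rl.
have rp : 0 < r by lra.
have rN : r != 0 by rewrite gt_eqF.
have rge0 : r0 <= r by lra.
have /hD : r1 <= r by lra.
set s := a / (2 * r) => /(ultimately_ge n)[M /(_ M (leqnn M))[nM [m0 m1 m2 _ m4]]].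
exists M => //.
apply: (@le_trans _ _ (upper_barrier a K r * sigma_sum M (fun u =>
  expR (- (s * u)) * upper_factor a C K r (u / r ^+ 2)))).
  rewrite /sigma_conv /sigma_sum mulr_sumr; apply: ler_sum => k _; rewrite mulr_sumr;
    apply: ler_sum => v _.
  rewrite mulrCA ler_pM2l //; set u := (k.+1 * v.+1)%N.
  have su : s * u%:R = a * r * (u%:R / r ^+ 2) / 2 by rewrite /s; field.
  case: ifP => [un|_]; last first.
    apply: mulr_ge0; first by rewrite /upper_barrier divr_ge0 ?expR_ge0 // mulr_ge0 ?addr_ge0 //
      ltW.
    apply: mulr_ge0; first exact: expR_ge0.
    have x0 : 0 <= u%:R / r ^+ 2 by rewrite divr_ge0 ?exprn_ge0 // ltW.
    apply: le_trans (upper_factor_ge Ca rp (ltW K0) x0).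
    by rewrite addr_ge0 // mulr_ge0 ?sqr_ge0 // ltW.
  have [|w [w0 w1 <- wE]] := @sqrtS_sub n u; first by rewrite un andbT muln_gt0.
  by rewrite su -wE; apply: pt => //; apply: ltW.
rewrite mulrC ler_pM2r; last by rewrite /upper_barrier divr_gt0 ?expR_gt0 // mulr_gt0 // addr_gt0.
rewrite sigma_sum_upper_factor //; have Kr : K <= r by lra.
have [] := damping_bounds (ltW K0) Kr rp; set k := K / (r + K) => k0 k1 kr.
have nE : n%:R = r ^+ 2 - 1 by rewrite sqrtS_sqr -natr1 addrK.
rewrite nE.
have r1' : 1 <= r by apply: sqrtS_ge1.
have p i : 0 < r ^+ i by rewrite exprn_gt0.
have aN : a != 0 by rewrite gt_eqF.
move/andP: m0 => [_ m0]; move/andP: m1 => [_ m1]; move/andP: m2 => [m2 m2'].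
have c1 : (1 - k / 2) / r ^+ 2 * lambert_moment 1 s M <= (1 - k / 2) * (4 * r / a) + D.
  have h0 : 0 <= (1 - k / 2) / r ^+ 2 by rewrite divr_ge0 ?(ltW (p _)) //; clear -k0 k1; lra.
  apply: le_trans (ler_wpM2l h0 m1) _.
  have -> : (1 - k / 2) / r ^+ 2 * (4 / a * r ^+ 3 + D * r ^+ 2) =
     (1 - k / 2) * (4 * r / a) + (1 - k / 2) * D by field; rewrite rN aN.
  by rewrite lerD2l ler_piMl ?(ltW D0) // gerBl divr_ge0.
have c2 : C / r ^+ 4 * lambert_moment 2 s M <= C * (24 / a ^+ 2 + D).
  have h0 : 0 <= C / r ^+ 4 by rewrite divr_ge0 ?(ltW (p _)) // ltW.
  apply: le_trans (ler_wpM2l h0 m2') _.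
  have -> : C / r ^+ 4 * (24 / a ^+ 2 * r ^+ 4 + D * r ^+ 3) =
     C * (24 / a ^+ 2 + D / r) by field; rewrite rN aN.
  by rewrite ler_pM2l // lerD2l ler_pdivrMr // ler_peMr // ltW.
have c3 : 3 * r / a - a / 8 * D <= a / r ^+ 3 / 8 * lambert_moment 2 s M.
  have h0 : 0 <= a / r ^+ 3 / 8 by rewrite !divr_ge0 ?(ltW (p _)) // ltW.
  apply: le_trans (ler_wpM2l h0 m2); rewrite le_eqVlt; apply/orP; left; apply/eqP.
  by field; rewrite rN aN.
have c4 : C / r ^+ 6 * lambert_moment 4 s M <= C * D.
  have h0 : 0 <= C / r ^+ 6 by rewrite divr_ge0 ?(ltW (p _)) // ltW.
  by apply: le_trans (ler_wpM2l h0 m4) _; rewrite le_eqVlt; apply/orP; left; apply/eqP; field.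
have c5 : E + 1 <= 2 * (k * r) / a.
  by rewrite ler_pdivlMr // mulrC; move: kr; rewrite /K; clear; lra.
have c6 : (1 - k / 2) * (4 * r / a) = 4 * (r / a) - 2 * (k * r) / a by field.
rewrite c6 in c1; rewrite (mulrBl (lambert_moment 2 s M)).
have c7 : 3 * r / a = 3 * (r / a) by rewrite mulrA.
rewrite c7 in c3; rewrite /E in c5.
move: (C * (24 / _ + D)) (C * D) (a / 8 * D) (r / a) (2 * (k * r) / a) m0 c1 c2 c3 c4 c5.
move: ((1 - k / 2) / r ^+ 2 * lambert_moment 1 s M) (C / r ^+ 4 *
  lambert_moment 2 s M) (a / r ^+ 3 / 8 * lambert_moment 2 s M).
move: (C / r ^+ 6 * lambert_moment 4 s M) (lambert s M) (r ^+ 2).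
clear -D0 => x1 x2 x3 x4 x5 x6 y1 y2 y3 y4 y5 *; lra.
Qed.

(** The same cancellation, with a damping of the opposite sign. Here [n <= r ^ 2] is in the right
    direction, so [K = a E] suffices. *)
Lemma lower_step : exists (K : R) n0, 0 <= K /\ forall n, (n0 <= n)%N -> exists2 M, (n <= M)%N &
  n%:R * lower_barrier a K (sqrtS n) <= sigma_conv M n (fun m => lower_barrier a K (sqrtS m)).
Proof.
have a0 := (@partition_rate_gt0 R); have [C CE] : exists C, C = 14 + 2 * a by exists (14 + 2 * a).
have C0 : 0 < C by rewrite CE; lra.
have [D [r1 [D0 r11 hD]]] := moments R.
pose E := D + 2 * D + C * (24 / a ^+ 2 + D) + C * D + a / 8 * D.
have E0 : 0 < E.
  have : 0 < a / 8 * D by rewrite mulr_gt0 // divr_gt0.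
  have : 0 <= 24 / a ^+ 2 by rewrite divr_ge0 ?exprn_ge0 ?(ltW a0).
  by move=> h1 h2; have : 0 <= C * (24 / a ^+ 2 + D) + C * D;
    [rewrite addr_ge0 // mulr_ge0 ?(ltW C0) //; lra | rewrite /E; lra].
pose K := a * E; have K0 : 0 < K by rewrite mulr_gt0 //; lra.
have [n0 hn0] := sqrtS_large (r1 + K).
exists K, n0; split; first exact: ltW.
move=> n /hn0; set r := sqrtS n => rl.
have rp : 0 < r by lra.
have rN : r != 0 by rewrite gt_eqF.
have r1' : 1 <= r by apply: sqrtS_ge1.
have /hD : r1 <= r by lra.
set s := a / (2 * r) => /(ultimately_ge n)[M /(_ M (leqnn M))[nM [m0 m1 m2 m3 _]]].
exists M => //.
have g0 : 0 < lower_barrier a K r by rewrite /lower_barrier divr_gt0 ?exprn_gt0 // mulr_gt0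
  ?expR_gt0 // addr_gt0.
apply: (@le_trans _ _ (lower_barrier a K r * sigma_sum M (fun u =>
  expR (- (s * u)) * lower_factor a C K r (u / r ^+ 2)))); last first.
  rewrite /sigma_conv /sigma_sum mulr_sumr; apply: ler_sum => k _; rewrite mulr_sumr;
    apply: ler_sum => v _.
  rewrite mulrCA ler_pM2l //; set u := (k.+1 * v.+1)%N.
  have su : s * u%:R = a * r * (u%:R / r ^+ 2) / 2 by rewrite /s; field.
  case: ifP => [un|/negbT]; last first.
    rewrite -ltnNge => nu; rewrite pmulr_rle0 // pmulr_rle0 ?expR_gt0 //.
    rewrite CE; apply: lower_factor_le0 => //; first exact: ltW.
    rewrite sqrtS_sqr ler_pdivlMr //; apply: (@le_trans _ _ n.+1%:R); last by rewrite ler_nat.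
    by rewrite ler_piMl //; clear; lra.
  have [|w [w0 w1 <- wE]] := @sqrtS_sub n u; first by rewrite un andbT muln_gt0.
  rewrite su -wE CE; apply: lower_pt => //; first exact: ltW.
  by apply: lt_le_trans w0; rewrite divr_gt0.
rewrite mulrC ler_pM2l //.
rewrite sigma_sum_lower_factor //; have Kr : K <= r by lra.
have [] := damping_bounds (ltW K0) Kr rp; set k := K / (r + K) => k0 k1 kr.
have nE : n%:R = r ^+ 2 - 1 by rewrite sqrtS_sqr -natr1 addrK.
rewrite nE.
have p i : 0 < r ^+ i by rewrite exprn_gt0.
have aN : a != 0 by rewrite gt_eqF.
move/andP: m0 => [m0 _]; move/andP: m1 => [m1 _]; move/andP: m2 => [_ m2].
have c1 : (1 + k / 2) * (4 * r / a) - 2 * D <= (1 + k / 2) / r ^+ 2 * lambert_moment 1 s M.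
  have h0 : 0 <= (1 + k / 2) / r ^+ 2 by rewrite divr_ge0 ?(ltW (p _)) //; clear -k0 k1; lra.
  apply: le_trans (ler_wpM2l h0 m1).
  have -> : (1 + k / 2) / r ^+ 2 * (4 / a * r ^+ 3 - D * r ^+ 2) =
     (1 + k / 2) * (4 * r / a) - (1 + k / 2) * D by field; rewrite rN aN.
  by rewrite lerD2l lerN2 ler_pM2r //; clear -k1; lra.
have c2 : C / r ^+ 4 * lambert_moment 2 s M <= C * (24 / a ^+ 2 + D).
  have h0 : 0 <= C / r ^+ 4 by rewrite divr_ge0 ?(ltW (p _)) // ltW.
  apply: le_trans (ler_wpM2l h0 m2) _.
  have -> : C / r ^+ 4 * (24 / a ^+ 2 * r ^+ 4 + D * r ^+ 3) =
     C * (24 / a ^+ 2 + D / r) by field; rewrite rN aN.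
  by rewrite ler_pM2l // lerD2l ler_pdivrMr // ler_peMr // ltW.
have c3 : a / r ^+ 3 / 8 * lambert_moment 2 s M <= 3 * r / a + a / 8 * D.
  have h0 : 0 <= a / r ^+ 3 / 8 by rewrite !divr_ge0 ?(ltW (p _)) // ltW.
  apply: le_trans (ler_wpM2l h0 m2) _; rewrite le_eqVlt; apply/orP; left; apply/eqP.
  by field; rewrite rN aN.
have c4 : C / r ^+ 5 * lambert_moment 3 s M <= C * D.
  have h0 : 0 <= C / r ^+ 5 by rewrite divr_ge0 ?(ltW (p _)) // ltW.
  apply: le_trans (ler_wpM2l h0 m3) _; rewrite le_eqVlt; apply/orP; left; apply/eqP.
  by field.
have c5 : E <= 2 * (k * r) / a.
  by rewrite ler_pdivlMr // mulrC; move: kr; rewrite /K; clear; lra.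
have c6 : (1 + k / 2) * (4 * r / a) = 4 * (r / a) + 2 * (k * r) / a by field.
rewrite c6 in c1; rewrite (mulrDl _ _ (lambert_moment 2 s M)).
have c7 : 3 * r / a = 3 * (r / a) by rewrite mulrA.
rewrite c7 in c3; rewrite /E in c5.
move: (C * (24 / _ + D)) (C * D) (a / 8 * D) (r / a) (2 * (k * r) / a) m0 c1 c2 c3 c4 c5.
move: ((1 + k / 2) / r ^+ 2 * lambert_moment 1 s M) (C / r ^+ 4 *
  lambert_moment 2 s M) (a / r ^+ 3 / 8 * lambert_moment 2 s M).
move: (C / r ^+ 5 * lambert_moment 3 s M) (lambert s M) (r ^+ 2).
clear -D0 => x1 x2 x3 x4 x5 x6 y1 y2 y3 y4 y5 *; lra.
Qed.

End PartitionSteps.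

(** * Comparison with the partition function *)

Section Comparison.
Variable R : realType.
Implicit Types (F G P : nat -> R) (K c : R).

Lemma dominate_upto F G n0 : (forall n, 0 < F n) -> (forall n, 0 < G n) ->
  exists2 c, 0 < c & forall n, (n < n0)%N -> F n <= c * G n.
Proof.
move=> F0 G0; elim: n0 => [|n0 [c c0 IH]]; first by exists 1.
have q0 : 0 < F n0 / G n0 by rewrite divr_gt0.
exists (c + F n0 / G n0); first by rewrite addr_gt0.
move=> n; rewrite ltnS leq_eqVlt => /orP[/eqP->|/IH h].
  by rewrite mulrDl divfK ?gt_eqF // lerDr mulr_ge0 // ltW.
by apply: le_trans h _; rewrite ler_pM2r // lerDl ltW.
Qed.

(** A constant fitted to the initial values propagates by strong induction, since the recurrence has
    nonnegative coefficients. *)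
Lemma dominate_sigma_conv F G n0 : (forall n, 0 < F n) -> (forall n, 0 < G n) ->
  (forall n, (n0 <= n)%N -> exists2 M, (n <= M)%N &
     n%:R * F n <= sigma_conv M n F /\ sigma_conv M n G <= n%:R * G n) ->
  exists2 c, 0 < c & forall n, F n <= c * G n.
Proof.
(* Covering [n0] as well ensures [n > 0] in the inductive step, where [n] is divided out. *)
move=> F0 G0 step; have [c c0 hc] := dominate_upto n0.+1 F0 G0.
exists c => //; elim/ltn_ind => n IH.
have [/hc //|n0n] := ltnP n n0.+1.
have [M _ [hF hG]] := step n (ltnW n0n).
have n_gt0 : 0 < n%:R :> R by rewrite ltr0n (leq_trans _ n0n).
rewrite -(ler_pM2l n_gt0); apply: le_trans hF _.
apply: le_trans (sigma_conv_le M IH) _.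
by rewrite mulrCA ler_pM2l.
Qed.

Local Notation a := (partition_rate R).

Lemma seq_bounds P : (forall n, 0 < P n) ->
    (forall n M, (n <= M)%N -> n%:R * P n = sigma_conv M n P) ->
  exists B : R, 0 < B /\ forall n m, P m / P n <=
    B * (expR (a * sqrtS R m - a * sqrtS R n) * (sqrtS R n ^+ 2 / sqrtS R m ^+ 2)).
Proof.
move=> P0 Prec; have r1 n := sqrtS_ge1 R n.
have r0 n : 0 < sqrtS R n by apply: lt_le_trans ltr01 (r1 n).
have [KU [nU [KU0 hU]]] := upper_step R; have [KL [nL [KL0 hL]]] := lower_step R.
have [B B0 hB] : exists2 c, 0 < c & forall n, P n <= c * upper_barrier a KU (sqrtS R n).
  apply: (@dominate_sigma_conv _ _ nU) => // [n|n /hU[M nM h]].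
    by rewrite divr_gt0 ?expR_gt0 // mulr_gt0 // ltr_wpDr.
  by exists M => //; split=> //; rewrite (Prec n M).
have [A A0 hA] : exists2 c, 0 < c & forall n, lower_barrier a KL (sqrtS R n) <= c * P n.
  apply: (@dominate_sigma_conv _ _ nL) => // [n|n /hL[M nM h]].
    by rewrite divr_gt0 ?exprn_gt0 // mulr_gt0 ?expR_gt0 // ltr_wpDr.
  by exists M => //; split=> //; rewrite (Prec n M).
exists (B * A); split; first by rewrite mulr_gt0.
move=> n m.
have p n' : 0 < sqrtS R n' ^+ 2 by rewrite exprn_gt0.
have h1 : P m <= B * (expR (a * sqrtS R m) / sqrtS R m ^+ 2).
  apply: le_trans (hB m) _; rewrite ler_pM2l // /upper_barrier ler_pM2l ?expR_gt0 //.
  rewrite lef_pV2 ?posrE // ?mulr_gt0 // ?ltr_wpDr // expr2 ler_pM2l //.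
  by rewrite lerDl.
have h2 : expR (a * sqrtS R n) / sqrtS R n ^+ 2 <= A * P n.
  apply: le_trans (hA n); rewrite /lower_barrier -mulrA ler_pM2l ?expR_gt0 //.
  have := r0 n; move: (sqrtS R n) => r rp; rewrite -subr_ge0.
  have -> : (r + KL) / r ^+ 3 - r ^- 2 = KL / r ^+ 3 by field; rewrite gt_eqF.
  by rewrite divr_ge0 // exprn_ge0 // ltW.
rewrite ler_pdivrMr //; apply: le_trans h1 _.
rewrite expRD expRN.
have -> : B * A * (expR (a * sqrtS R m) / expR (a * sqrtS R n) *
  (sqrtS R n ^+ 2 / sqrtS R m ^+ 2)) * P n =
  B * (expR (a * sqrtS R m) / sqrtS R m ^+ 2) * ((A * P n) / (expR (a *
    sqrtS R n) / sqrtS R n ^+ 2)).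
  move: (expR _) (expR _) (expR_gt0 (a * sqrtS R m)) (expR_gt0 (a * sqrtS R n)) => e1 e2 e10 e20.
  by field; rewrite !gt_eqF.
rewrite ler_peMr //; first by rewrite mulr_ge0 ?divr_ge0 ?expR_ge0 // ltW.
by rewrite ler_pdivlMr ?divr_gt0 ?expR_gt0 // mul1r.
Qed.

Lemma ratio_bound P : (forall n, 0 < P n) ->
    (forall n M, (n <= M)%N -> n%:R * P n = sigma_conv M n P) ->
  exists B : R, 0 < B /\ forall n t, (0 < t <= n)%N ->
    P (n - t)%N / P n <= B * expR (- (a / 2 * (t%:R / Num.sqrt n%:R))).
Proof.
move=> P0 Prec; have [B [B0 hB]] := seq_bounds P0 Prec.
have a0 := partition_rate_gt0 R.
(* [4] bounds [w ^- 2] for [w >= 1/2]; otherwise [w ^- 2 <= r ^ 2], and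
   [r ^ 2 * expR (- (a * r / 8))] is at most [(16 / a) ^ 2]. *)
pose E := 4 + (16 / a) ^+ 2; have E0 : 0 < E by rewrite addr_gt0 ?exprn_gt0 ?divr_gt0.
exists (B * (E * expR a)); split; first by rewrite !mulr_gt0 ?expR_gt0.
move=> n t tn; apply: le_trans (hB _ _) _; rewrite -[leRHS]mulrA ler_pM2l //.
have [w [w0 w1 rw wE]] := sqrtS_sub R tn.
have r1 := sqrtS_ge1 R n; set r := sqrtS R n in w0 rw wE r1 *.
have rp : 0 < r by lra.
have wp : 0 < w by apply: lt_le_trans w0; rewrite divr_gt0.
rewrite -rw.
have -> : expR (a * (r * w) - a * r) =
   expR (- (a * r * (1 - w ^+ 2) / 2)) * expR (- (a * r * (1 - w) ^+ 2 / 2)).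
  by rewrite -expRD; congr expR; field.
have -> : r ^+ 2 / (r * w) ^+ 2 = w ^- 2 by field; rewrite !gt_eqF.
have h1 : expR (- (a * r * (1 - w) ^+ 2 / 2)) / w ^+ 2 <= E.
  have [w2|w2] := lerP (1 / 2) w.
    apply: (@le_trans _ _ 4); last by rewrite /E lerDl exprn_ge0 // divr_ge0 // ltW.
    rewrite ler_pdivrMr ?exprn_gt0 //; apply: (@le_trans _ _ 1).
      rewrite expR_le1 oppr_le0 divr_ge0 // mulr_ge0 ?sqr_ge0 // mulr_ge0 //; exact: ltW.
    have : 0 <= (w - 1 / 2) * (w + 1 / 2) by apply: mulr_ge0; lra.
    lra.
  have h2 : w ^- 2 <= r ^+ 2.
    rewrite -[r ^+ 2]invrK lef_pV2 ?posrE ?invr_gt0 ?exprn_gt0 // -exprVn.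
    by rewrite lerXn2r ?nnegrE ?invr_ge0 ?(ltW rp) ?(ltW wp) // -div1r.
  have h3 : expR (- (a * r * (1 - w) ^+ 2 / 2)) <= expR (- (a * r / 8)).
    rewrite ler_expR lerN2; have h : 1 / 4 <= (1 - w) ^+ 2.
      by have : 0 <= (1 / 2 - w) * (3 / 2 - w); [apply: mulr_ge0; lra | lra].
    have ar : 0 <= a * r by rewrite mulr_ge0 // ltW.
    by have := ler_wpM2l ar h; lra.
  apply: (@le_trans _ _ (expR (- (a * r / 8)) * r ^+ 2)).
    by apply: ler_pM => //; rewrite invr_ge0 exprn_ge0 // ltW.
  have ar8 : 0 <= a * r / 8 by rewrite divr_ge0 // mulr_ge0 // ltW.
  have := exprM_expRN_le (isT : (0 < 2)%N) ar8; move: (expR _) => e he.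
  have -> : e * r ^+ 2 = (8 / a) ^+ 2 * ((a * r / 8) ^+ 2 * e) by field; rewrite gt_eqF.
  apply: (@le_trans _ _ ((8 / a) ^+ 2 * 2 ^+ 2)).
    by rewrite ler_pM2l // exprn_gt0 // divr_gt0.
  have -> : (8 / a) ^+ 2 * 2 ^+ 2 = (16 / a) ^+ 2 by field; rewrite gt_eqF.
  by rewrite /E lerDr.
rewrite -[leLHS]mulrA -[leRHS]mulrA [leLHS]mulrC; apply: ler_pM => //.
- by rewrite mulr_ge0 ?expR_ge0 // invr_ge0 exprn_ge0 // ltW.
rewrite -expRD ler_expR wE.
have n0 : 0 < n%:R :> R by rewrite ltr0n; case/andP: tn => t0; apply: leq_trans t0.
pose q := Num.sqrt n%:R : R; have q2 : q ^+ 2 = n%:R by rewrite sqr_sqrtr // ltW.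
have q0 : 0 < q by rewrite sqrtr_gt0.
have qr : q <= r by rewrite ler_sqrt // ler_nat.
rewrite -/q.
have -> : a * r * (t%:R / r ^+ 2) / 2 = a / 2 * (t%:R / r) by field; rewrite gt_eqF.
(* Passing from [sqrt (n + 1)] to [sqrt n] costs at most 1 because [t <= n]; the factor [expR a] of
   the constant pays for it. *)
have h : t%:R / q <= t%:R / r + 1.
  have tq : t%:R <= q ^+ 2 by rewrite q2 ler_nat; case/andP: tn.
  have t0 : 0 <= t%:R :> R by [].
  have rq : r ^+ 2 = q ^+ 2 + 1 by rewrite q2 sqrtS_sqr natr1.
  have rq1 : q * (r - q) <= r.
    have : 0 <= (r - q) ^+ 2 by apply: sqr_ge0.
    have : r <= r ^+ 2 by rewrite expr2 ler_peMl // ltW.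
    have : q * r <= r * r by rewrite ler_pM2r.
    nra.
  rewrite -subr_ge0.
  have -> : t%:R / r + 1 - t%:R / q = (r * q - t%:R * (r - q)) / (r * q) by field; rewrite !gt_eqF.
  rewrite divr_ge0 ?mulr_ge0 ?(ltW rp) ?(ltW q0) // subr_ge0.
  have h3 : t%:R * (r - q) <= q ^+ 2 * (r - q) by rewrite ler_wpM2r // subr_ge0.
  apply: le_trans h3 _; have -> : q ^+ 2 * (r - q) = q * (r - q) * q by ring.
  by rewrite ler_pM2r.
have a2 : 0 <= a / 2 by rewrite divr_ge0 // ltW.
have := ler_wpM2l a2 h; rewrite mulrDr; lra.
Qed.

End Comparison.

Local Open Scope ring_scope.

(** * From the ratio to the bound of the theorem *)

Section FinalBound.
Variable R : realType.
Local Notation pi := (@pi R).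
Local Notation a := (partition_rate R).

Lemma partition_rate_sqrt6 : pi / Num.sqrt 6 = a / 2.
Proof.
have e : Num.sqrt (2 / 3) * Num.sqrt 6 = 2 :> R.
  rewrite -sqrtrM ?divr_ge0 //; have -> : 2 / 3 * 6 = 2 ^+ 2 :> R by field.
  by rewrite sqrtr_sqr ger0_norm.
have s0 : 0 < Num.sqrt 6 :> R by rewrite sqrtr_gt0.
rewrite /partition_rate; move: e s0; move: (Num.sqrt (2 / 3)) (Num.sqrt 6) pi => u v p e v0.
have -> : u = 2 / v by rewrite -e mulfK // gt_eqF.
by field; rewrite gt_eqF.
Qed.

(** With [1 < a * c] this yields [1/4 < c], hence lower bounds for the powers of [c]. *)
Lemma partition_rate_le4 : a <= 4.
Proof.
have := partition_rate_sqr R; have := pi_gt0 R; have := partition_rate_gt0 R; have := pihalf_lt2 R.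
move: pi a => p b p4 b0 p0 e; rewrite leNgt; apply/negP => b4.
have : 0 < (4 - p) * (4 + p) by apply: mulr_gt0; lra.
have : 0 < (b - 4) * (4 + b) by apply: mulr_gt0; lra.
lra.
Qed.

Lemma partition_rate_c c : Num.sqrt (3 / 2) / pi < c -> 1 < a * c.
Proof.
have e : Num.sqrt (2 / 3) * Num.sqrt (3 / 2) = 1 :> R.
  by rewrite -sqrtrM ?divr_ge0 // (_ : 2 / 3 * (3 / 2) = 1 :> R) ?sqrtr1 //; field.
move=> hc; have h : a * (Num.sqrt (3 / 2) / pi) < a * c by rewrite ltr_pM2l ?partition_rate_gt0.
apply: le_lt_trans h.
have p0 := pi_gt0 R; rewrite /partition_rate; move: e p0;
  move: (Num.sqrt (2 / 3)) (Num.sqrt (3 / 2)) pi => u v p e p0.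
have -> : p * u * (v / p) = u * v by field; rewrite gt_eqF.
by rewrite e.
Qed.

(** The function [x expR (- b x)] decreases after its maximum at [1 / b]; this lets [t] be replaced
    by its lower bound [c sqrt n log n]. *)
Lemma xexpN_anti (b x y : R) : 0 < x -> x <= y -> 1 <= b * x ->
  y * expR (- (b * y)) <= x * expR (- (b * x)).
Proof.
move=> x0 xy bx.
have h : y <= x * expR (b * y - b * x).
  apply: (@le_trans _ _ (x * (1 + (b * y - b * x)))); last first.
    by rewrite ler_pM2l // expR_ge1Dx.
  have : (y - x) * 1 <= (y - x) * (b * x) by rewrite ler_wpM2l // subr_ge0.
  lra.
apply: le_trans (ler_wpM2r (expR_ge0 _) h) _.
by rewrite -mulrA -expRD (_ : _ + _ = - (b * x)) //; ring.
Qed.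

(** [X] stands for the number of partitions that are not t-cores. The count of rim hooks is used for
    [log n >= 4]; below, [X <= P n] suffices. *)
Lemma vanishing_bound (P : nat -> R) : (forall n, 0 < P n) ->
    (forall n M, (n <= M)%N -> n%:R * P n = sigma_conv M n P) ->
  exists d : R, 0 < d /\ forall (n t : nat) (c X : R), (2 <= n)%N ->
    Num.sqrt (3 / 2) / pi < c -> c * Num.sqrt n%:R * ln n%:R <= t%:R -> (t <= n)%N ->
    X <= P n -> ((n < t ^ 2)%N -> X <= 3 * t%:R * P (n - t)%N) ->
    X / P n <= c ^+ 4 * d * ln n%:R / n%:R `^ (c * pi / Num.sqrt 6 - 1 / 2).
Proof.
move=> P0 Prec; have [B [B0 hB]] := ratio_bound P0 Prec.
have a0 := partition_rate_gt0 R.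
(* If [log n < 4], then [c sqrt n log n <= t <= n] gives [c log n <= sqrt n < expR 2], so the power
   of [n] in the denominator is at most [Q]. *)
have [Q Q0 QE] : exists2 Q : R, 0 < Q & Q = expR (a / 2 * expR 2).
  by exists (expR (a / 2 * expR 2)); rewrite ?expR_gt0.
(* [192 = 3 * 64] and [512 = 2 * 256] compensate for [c ^ 3 >= 1/64], and for [c ^ 4 >= 1/256] with
   [log n >= 1/2]. *)
have S0 : 0 < 192 * B + 512 * Q by lra.
exists (192 * B + 512 * Q); split => //.
move=> n t c X n2 hc ht tn XP XQ.
have ac := partition_rate_c hc; have a4 := partition_rate_le4.
have c4 : 1 / 4 < c.
  rewrite ltNge; apply/negP => h; have := ler_pM (ltW a0) _ a4 h.
  have [c0|c0] := lerP 0 c; first by move/(_ isT); clear -ac; lra.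
  have : 0 < a * - c by rewrite mulr_gt0 // oppr_gt0.
  by lra.
have c0 : 0 < c by lra.
have n0 : 0 < n%:R :> R by rewrite ltr0n; apply: leq_trans n2.
pose L : R := ln n%:R; pose q : R := Num.sqrt n%:R.
have q0 : 0 < q by rewrite sqrtr_gt0.
have q2 : q ^+ 2 = n%:R by rewrite sqr_sqrtr // ltW.
have nE : n%:R = expR L by rewrite lnK ?posrE.
have qE : q = expR (L / 2).
  by apply/eqP; rewrite -(@eqrXn2 _ 2) ?expR_ge0 ?(ltW q0) // q2 nE expr2 -expRD; apply/eqP;
    congr expR; field.
have L2 : 1 / 2 <= L.
  rewrite -ler_expR -nE; apply: (@le_trans _ _ 2); last by rewrite ler_nat.
  have h1 := expR_ge1Dx (- (1 / 2) : R); have h2 := expRxMexpNx_1 (1 / 2 : R).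
  by have h3 := expR_gt0 (1 / 2 : R); clear -h1 h2 h3; nra.
have L0 : 0 < L by apply: lt_le_trans L2.
have -> : c * pi / Num.sqrt 6 - 1 / 2 = a * c / 2 - 1 / 2.
  by rewrite -mulrA partition_rate_sqrt6; field.
have -> : n%:R `^ (a * c / 2 - 1 / 2) = expR ((a * c / 2 - 1 / 2) * L).
  by rewrite /powR gt_eqF.
rewrite -/L; rewrite -/L -/q in ht.
rewrite -expRN.
have c3 : 1 / 64 <= c ^+ 3.
  have : (1 / 4) ^+ 3 <= c ^+ 3 by rewrite lerXn2r ?nnegrE ?ltW.
  lra.
have c44 : 1 / 256 <= c ^+ 4.
  have : (1 / 4) ^+ 4 <= c ^+ 4 by rewrite lerXn2r ?nnegrE ?ltW.
  lra.
have e0 := expR_gt0 (- ((a * c / 2 - 1 / 2) * L)).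
have [L4|L4] := lerP 4 L; last first.
  apply: (@le_trans _ _ 1); first by rewrite ler_pdivrMr // mul1r.
  have h1 : Q^-1 <= expR (- ((a * c / 2 - 1 / 2) * L)).
    rewrite QE -expRN ler_expR lerN2.
    have cL : c * L <= q.
      rewrite -(ler_pM2l q0) -expr2 q2; apply: le_trans (_ : _ <= t%:R) _; last by rewrite ler_nat.
      by apply: le_trans ht; rewrite le_eqVlt; apply/orP; left; apply/eqP; ring.
    have qq : q <= expR 2 by rewrite qE ler_expR; clear -L4; lra.
    have a2 : 0 <= a / 2 by rewrite divr_ge0 // ltW.
    have := ler_wpM2l a2 (le_trans cL qq); clear -L0; lra.
  apply: (@le_trans _ _ (512 * (c ^+ 4 * L) * (Q * Q^-1))).
    rewrite mulfV ?gt_eqF // mulr1.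
    have : 1 / 256 * L <= c ^+ 4 * L by rewrite ler_pM2r.
    move: (c ^+ 4 * L) => z; clear -L2; lra.
  have -> : 512 * (c ^+ 4 * L) * (Q * Q^-1) = c ^+ 4 * (512 * Q) * L * Q^-1 by ring.
  have cp : 0 < c ^+ 4 by rewrite exprn_gt0.
  have le1 : c ^+ 4 * (512 * Q) * L <= c ^+ 4 * (192 * B + 512 * Q) * L.
    by rewrite ler_pM2r // ler_pM2l // lerDr; clear -B0; lra.
  have cQ := mulr_gt0 (mulr_gt0 cp S0) L0.
  apply: le_trans (ler_wpM2l (ltW cQ) h1); rewrite ler_pM2r ?invr_gt0 //.
pose T := c * q * L.
have T0 : 0 < T by rewrite !mulr_gt0.
(* The case split at 4 serves here: [c > 1/4] and [log n >= 4] give [c log n > 1], hence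
   [n < t ^ 2]. *)
have tq : q < t%:R.
  apply: lt_le_trans ht; have h : 1 / 4 * L < c * L by rewrite ltr_pM2r.
  rewrite mulrAC -[ltLHS]mul1r ltr_pM2r //; clear -h L4; lra.
have nt : (n < t ^ 2)%N.
  by rewrite -(ltr_nat R) natrX -q2 ltr_pXn2r ?nnegrE ?ler0n ?(ltW q0).
have t0 : (0 < t)%N by rewrite -(ltr_nat R) (lt_trans q0).
have {hB} := hB n t; rewrite t0 tn => /(_ isT) hB.
have h1 : X / P n <= 3 * t%:R * (B * expR (- (a / 2 * (t%:R / q)))).
  apply: (@le_trans _ _ (3 * t%:R * (P (n - t)%N / P n))).
    by rewrite mulrA ler_pM2r ?invr_gt0 // XQ.
  by rewrite ler_pM2l // mulr_gt0 // ltr0n.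
apply: le_trans h1 _.
have h2 : t%:R * expR (- (a / 2 * (t%:R / q))) <= T * expR (- (a / 2 * (T / q))).
  have -> : a / 2 * (t%:R / q) = a / 2 / q * t%:R by ring.
  have -> : a / 2 * (T / q) = a / 2 / q * T by ring.
  apply: xexpN_anti => //.
  have -> : a / 2 / q * T = a * c / 2 * L by rewrite /T; field; rewrite gt_eqF.
  have : 1 * 4 <= a * c * L by apply: ler_pM => //; exact: ltW.
  clear; lra.
have h3 : T * expR (- (a / 2 * (T / q))) = c * L * expR (- ((a * c / 2 - 1 / 2) * L)).
  have -> : a / 2 * (T / q) = a * c / 2 * L by rewrite /T; field; rewrite gt_eqF.
  rewrite /T (_ : c * q * L = c * L * q); last by ring.
  by rewrite -mulrA qE -expRD; congr (_ * expR _); field.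
rewrite h3 in h2.
have -> : 3 * t%:R * (B * expR (- (a / 2 * (t%:R / q)))) =
  3 * B * (t%:R * expR (- (a / 2 * (t%:R / q)))) by ring.
have B3 : 0 < 3 * B by rewrite mulr_gt0.
apply: le_trans (ler_wpM2l (ltW B3) h2) _.
rewrite mulrA ler_pM2r //.
have -> : 3 * B * (c * L) = c * (3 * B) * L by ring.
have -> : c ^+ 4 * (192 * B + 512 * Q) * L = c * (c ^+ 3 * (192 * B + 512 * Q)) * L by ring.
rewrite ler_pM2r // ler_pM2l //.
have : 1 / 64 * (192 * B + 512 * Q) <= c ^+ 3 * (192 * B + 512 * Q) by rewrite ler_pM2r.
clear -B0 Q0; lra.
Qed.

End FinalBound.

End Asymptotics.

Import Order.TTheory.
Local Open Scope ring_scope.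

(** * The recurrence on a square of indices, and the conclusion *)

Lemma pn_rec_widen n M : (n <= M)%N ->
  (n * pn n = \sum_(k < M) \sum_(v < M)
     if k.+1 * v.+1 <= n then v.+1 * pn (n - k.+1 * v.+1) else 0)%N.
Proof.
move=> nM; rewrite pn_rec exchange_big /=.
rewrite big_add1 /= big_mkord.
rewrite (big_ord_widen _ (fun v => \sum_(1 <= k < n.+1 | k * v.+1 <=
  n) v.+1 * pn (n - k * v.+1))%N nM).
rewrite big_mkcond; apply: eq_bigr => v _.
have large (k : 'I_M) : (n <= k -> n < k.+1 * v.+1)%N by move=> nk;
  rewrite (leq_trans _ (leq_pmulr _ _)).
have large' (k : 'I_M) : (n <= v -> n < k.+1 * v.+1)%N by move=> nk;
  rewrite (leq_trans _ (leq_pmull _ _)).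
case: ltnP => [_|nv]; last first.
  by rewrite big1 // => k _; rewrite leqNgt large'.
rewrite big_add1 /= big_mkord.
rewrite (big_ord_widen_cond _ (fun k => k.+1 * v.+1 <= n)%N (fun k =>
  v.+1 * pn (n - k.+1 * v.+1))%N nM).
rewrite big_mkcond; apply: eq_bigr => k _; case: (leqP (k.+1 * v.+1) n) => //= le.
by case: ltnP => // nk; have := large k nk; rewrite ltnNge le.
Qed.

Lemma sigma_conv_pn (R : realType) n M : (n <= M)%N ->
  n%:R * (pn n)%:R = Asymptotics.sigma_conv M n (fun m => (pn m)%:R) :> R.
Proof.
move=> nM; rewrite -natrM (pn_rec_widen nM) natr_sum; apply: eq_bigr => k _.
rewrite natr_sum; apply: eq_bigr => v _.
by case: ifP => _; rewrite ?mulr0 // natrM.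
Qed.

Lemma count_mul_leq_sumn (x : nat) s : (x * count_mem x s <= sumn s)%N.
Proof.
elim: s => [|y s IH] /=; first by rewrite muln0.
by rewrite mulnDr; apply: leq_add => //; have [->|_] := eqVneq y x; rewrite ?muln1 ?muln0.
Qed.

Theorem theorem1p2 (R : realType) :
  exists d : R, 0 < d /\
    forall (p n : nat) (c : R) (la : intpart n),
      prime p -> (2 <= n)%N -> Num.sqrt (3 / 2) / pi < c ->
      la \in Omega p n ->
      (exists a s : nat,
         [/\ a \in parts la,
             (p ^ s <= count_mem a (parts la))%N
           & c * Num.sqrt n%:R * ln n%:R <= (a * p ^ s)%N%:R]) ->
      forall mu : intpart n, mu \in K p la ->
        1 - c ^+ 4 * d * ln n%:R / n%:R `^ (c * pi / Num.sqrt 6 - 1 / 2)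
        <= #|[set al : intpart n | (p %| chi_val al mu)%C]|%:R
           / #|{: intpart n}|%:R.
Proof.
have P0 n : 0 < (pn n)%:R :> R by rewrite ltr0n pn_gt0.
have [d [d0 hd]] := Asymptotics.vanishing_bound P0 (@sigma_conv_pn R).
exists d; split=> // p n c la pp n2 hc _ [a [s [ala ples ht]]] mu Kmu.
set t := (a * p ^ s)%N in ht.
have tn : (t <= n)%N.
  rewrite -(parts_sumn la); apply: leq_trans (count_mul_leq_sumn a _).
  by rewrite leq_mul2l ples orbT.
have t0 : (0 < t)%N.
  rewrite muln_gt0; apply/andP; split; last by rewrite expn_gt0 prime_gt0.
  by rewrite lt0n; apply: contraNneq (parts_gt0 la) => <-.
pose N := [set al : intpart n | ~~ core n (part al) t].
have hN : #|N|%:R / (pn n)%:R <= c ^+ 4 * d * ln n%:R / n%:R `^ (c * pi / Num.sqrt 6 - 1 / 2).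
  apply: (hd n t) => //; first by rewrite ler_nat max_card.
  by move=> nt; rewrite -!natrM ler_nat card_noncore.
apply: le_trans (_ : 1 - #|N|%:R / (pn n)%:R <= _); first by rewrite lerD2l lerN2.
rewrite -[X in X - _](@mulfV _ (pn n)%:R) ?gt_eqF // -mulrBl ler_pM2r ?invr_gt0 //.
rewrite lerBlDr -natrD ler_nat {1}/pn -(cardsC N) addnC leq_add2r.
apply: subset_leq_card; apply/subsetP => al; rewrite !inE negbK => core_al.
exact: chi_val_dvd pp Kmu ala ples core_al.
Qed.
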